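(* The decision problem \textsc{Mahjong Solitaire} is NP-complete: given a (perfect-information) Mahjong arrangement as defined in the context, decide whether there is a sequence of legal moves resulting in the empty arrangement.
   Context: Tiles are partitioned into $m$ disjoint tile sets $\mathcal{T}_1,\dots,\mathcal{T}_m$, where $|\mathcal{T}_p|=s_p$ is even; two tiles match iff they belong to the same tile set. Let $\mathcal{T}=\bigcup_p \mathcal{T}_p$. A configuration $C$ is a finite set of positions $(i,j,k)$ of nonnegative integers such that (1) if $(i,j,k),(i,j',k)\in C$ with $j<j'$ then $(i,j'',k)\in C$ for all $j\le j''\le j'$, and (2) if $(i,j,k)\in C$ with $k>0$ then $(i,j,k-1)\in C$. A position $(i,j,k)$ is hidden if $(i,j,k+1)\in C$. An arrangement consists of $\mathcal{T}$, a configuration $C$ with $|C|=|\mathcal{T}|$, and a bijection from $C$ to $\mathcal{T}$ (any such bijection is allowed; the whole arrangement is known to the player). A position is available if it is not hidden and at least one of $(i,j-1,k)$, $(i,j+1,k)$ is not in $C$. A legal move removes two matching tiles $a,b$ whose positions are both available, deleting them from $\mathcal{T}$ and their positions from $C$. The game is won if a sequence of moves yields the empty arrangement. *)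

(* Defs.v *)
From Stdlib Require Relation_Operators.
From mathcomp Require Import all_boot all_algebra.
Set Implicit Arguments.
Unset Strict Implicit.
Unset Printing Implicit Defensive.

(** * Deterministic multitape Turing machines *)

Inductive direction := Left | Stay | Right.

(* Tape alphabet with work symbols [W]: [None] is the blank and
   [Some (inl b)] are the input/output letters. *)
Definition symbol (W : finType) : finType := option (bool + W).

(* The state [tm_halt] is final.  There are [tm_extra.+1] tapes; tape [ord0]
   carries the input and the output. *)
Record machine := Machine {
  tm_state : finType;
  tm_work : finType;
  tm_extra : nat;
  tm_start : tm_state;
  tm_halt : tm_state;
  tm_delta : tm_state -> {ffun 'I_tm_extra.+1 -> symbol tm_work} ->
    tm_state * {ffun 'I_tm_extra.+1 -> symbol tm_work * direction}
}.

Section Run.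
Variable M : machine.
Notation sym := (symbol (tm_work M)).

(* A two-way infinite tape [(l, r)]: [l] is the part strictly left of the head,
   nearest cell first; [r] starts with the scanned cell; every cell beyond the
   two lists is blank. *)
Definition tape := (seq sym * seq sym)%type.

Definition read (t : tape) : sym := head None t.2.

Definition write_move (t : tape) (a : sym * direction) : tape :=
  let: (l, r) := (t.1, a.1 :: behead t.2) in
  match a.2 with
  | Left => (behead l, head None l :: r)
  | Stay => (l, r)
  | Right => (head None r :: l, behead r)
  end.

Definition tm_config := (tm_state M * {ffun 'I_(tm_extra M).+1 -> tape})%type.

Definition tm_init (w : seq bool) : tm_config :=
  (tm_start M, [ffun i => if i == ord0 then ([::], [seq Some (inl b) | b <- w])
                          else ([::], [::])]).

Definition tm_step (c : tm_config) : tm_config :=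
  if c.1 == tm_halt M then c else
  let: (q, act) := tm_delta c.1 [ffun i => read (c.2 i)] in
  (q, [ffun i => write_move (c.2 i) (act i)]).

Definition tm_run (w : seq bool) (t : nat) : tm_config :=
  iter t tm_step (tm_init w).

Fixpoint leading_bits (s : seq sym) : seq bool :=
  if s is Some (inl b) :: s' then b :: leading_bits s' else [::].

(* The output is the word that starts at the head of tape [ord0] and extends
   to the right up to the first cell not holding a bit. *)
Definition tm_output (c : tm_config) : seq bool := leading_bits (c.2 ord0).2.

End Run.

(** * Polynomial time and NP-completeness *)

Definition poly_time (f : seq bool -> seq bool) : Prop :=
  exists (M : machine) (p : {poly nat}), forall w : seq bool,
    let c := tm_run M w p.[size w]%R in
    c.1 = tm_halt M /\ tm_output c = f w.

Definition language := seq bool -> Prop.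

(* Self-delimiting code of a word: each bit [b] becomes [1b], and [0] ends it. *)
Definition delimit (w : seq bool) : seq bool :=
  flatten [seq [:: true; b] | b <- w] ++ [:: false].

Definition pair_code (x y : seq bool) : seq bool := delimit x ++ y.

Definition in_NP (L : language) : Prop :=
  exists (p : {poly nat}) (V : seq bool -> seq bool), poly_time V /\
    forall x, L x <->
      exists y, (size y <= p.[size x]%R) /\ V (pair_code x y) = [:: true].

Definition poly_reducible (L1 L2 : language) : Prop :=
  exists f, poly_time f /\ forall x, L1 x <-> L2 (f x).

Definition NP_hard (L : language) : Prop :=
  forall L', in_NP L' -> poly_reducible L' L.

Definition NP_complete (L : language) : Prop := in_NP L /\ NP_hard L.

(** * Mahjong arrangements and the game *)

Definition position := (nat * nat * nat)%type.

(* [(p, q)] is the tile with name [q] in the [p]-th tile set, [p] counted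
   from 0. *)
Definition tile := (nat * nat)%type.

Definition matching (a b : tile) : bool := a.1 == b.1.

Definition configuration (C : seq position) : Prop :=
  [/\ uniq C,
      forall i j j' j'' k, (i, j, k) \in C -> (i, j', k) \in C -> j < j' ->
        j <= j'' <= j' -> (i, j'', k) \in C
    & forall i j k, (i, j, k) \in C -> 0 < k -> (i, j, k.-1) \in C].

Definition hidden (C : seq position) (x : position) : bool :=
  let: (i, j, k) := x in (i, j, k.+1) \in C.

(* There is no position left of [j = 0], hence the guard [0 < j]. *)
Definition available (C : seq position) (x : position) : bool :=
  let: (i, j, k) := x in
  [&& x \in C, ~~ hidden C x
    & ~~ ((0 < j) && ((i, j.-1, k) \in C)) || ((i, j.+1, k) \notin C)].

(* The graph of a bijection from a finite set of positions onto a finite set of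
   tiles, listed without repetition. *)
Definition board := seq (position * tile).

Definition positions (B : board) : seq position := unzip1 B.
Definition tiles (B : board) : seq tile := unzip2 B.

Record arrangement := Arrangement { num_sets : nat; layout : board }.

(* [uniq C] (part of [configuration]) and [uniq T] say that the graph is that
   of a bijection from C to T. *)
Definition is_arrangement (A : arrangement) : Prop :=
  let C := positions (layout A) in
  let T := tiles (layout A) in
  [/\ configuration C, uniq T,
      forall t, t \in T -> t.1 < num_sets A
    & forall p, p < num_sets A -> ~~ odd (count (fun t => t.1 == p) T)].

Definition legal_move (B B' : board) : Prop :=
  exists a b : position * tile,
    [/\ a \in B, b \in B & a != b] /\
    [/\ matching a.2 b.2,
        available (positions B) a.1,
        available (positions B) b.1
      & B' = [seq e <- B | (e != a) && (e != b)]].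

Definition winnable (A : arrangement) : Prop :=
  Relation_Operators.clos_refl_trans_1n board legal_move (layout A) [::].

(** * Instances as binary words *)

(* Bits, least significant first. *)
Fixpoint positive_bits (n : BinNums.positive) : seq bool :=
  match n with
  | BinNums.xH => [:: true]
  | BinNums.xO n' => false :: positive_bits n'
  | BinNums.xI n' => true :: positive_bits n'
  end.

Definition nat_bits (n : nat) : seq bool :=
  if bin_of_nat n is BinNums.Npos n' then positive_bits n' else [::].

Definition nat_code (n : nat) : seq bool := delimit (nat_bits n).

Definition entry_code (e : position * tile) : seq bool :=
  let: ((i, j, k), (p, q)) := e in
  nat_code i ++ nat_code j ++ nat_code k ++ nat_code p ++ nat_code q.

Definition arrangement_code (A : arrangement) : seq bool :=
  nat_code (num_sets A) ++ flatten (map entry_code (layout A)).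

Lemma delimit_inj u v x y : delimit u ++ x = delimit v ++ y -> u = v /\ x = y.
Proof.
elim: u v => [|a u IH] [|b v] //=; first by case.
by rewrite /delimit /= => -[-> H]; case: (IH v H) => -> ->.
Qed.

Lemma positive_bits_inj : injective positive_bits.
Proof.
have N p : positive_bits p <> [::] by case: p.
elim=> [p IH|p IH|] [q|q|] //=.
- by case=> H; rewrite (IH _ H).
- by case=> H; case: (N p).
- by case=> H; rewrite (IH _ H).
- by case=> H; case: (N q).
Qed.

Lemma nat_bits_inj : injective nat_bits.
Proof.
move=> m n; rewrite /nat_bits => H.
suff E: bin_of_nat m = bin_of_nat n by rewrite -(bin_of_natK m) E bin_of_natK.
case: (bin_of_nat m) (bin_of_nat n) H => [|p] [|q] //; first by case: q.
  by case: p.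
by move/positive_bits_inj->.
Qed.

Lemma nat_code_inj m n x y : nat_code m ++ x = nat_code n ++ y -> m = n /\ x = y.
Proof. by move/delimit_inj => [/nat_bits_inj-> ->]. Qed.

Lemma nat_code_nil n : nat_code n <> [::].
Proof. by rewrite /nat_code /delimit; case: flatten. Qed.

Lemma arrangement_code_inj : injective arrangement_code.
Proof.
case=> m B [n D]; rewrite /arrangement_code /= => /nat_code_inj [-> H]; congr Arrangement.
have N e x : entry_code e ++ x <> [::].
  case: e => [[[i j] k] [p q]] /=; rewrite -catA; move: (@nat_code_nil i); by case: nat_code.
elim: B D H => [|e B IH] [|f D] //=; [by move/esym/N | by move/N |].
case: e f => [[[i j] k] [p q]] [[[i' j'] k'] [p' q']] /=.
rewrite -!(catA (nat_code _)) => /nat_code_inj[-> /nat_code_inj[-> /nat_code_inj[-> /nat_code_inj[-> /nat_code_inj[-> H]]]]].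
by rewrite (IH _ H).
Qed.

Definition mahjong_solitaire : language := fun w =>
  exists A : arrangement,
    [/\ is_arrangement A, w = arrangement_code A & winnable A].

(* Main.v *)
(** Membership in NP: a certificate lists the entries of the layout and the moves
    of a winning play.  All conditions on an arrangement are then checked entry
    against entry; parity needs no check, since a won game is made of pairs.

    Hardness: that a machine accepts [delimit x ++ y] for some short [y] is
    expressed by clauses saying that cell [z] holds symbol [a] at time [t], with
    cells numbered relative to the head.  Apart from the guess of [y] and the
    final rejection of wrong outputs the clauses are Horn, so every satisfying
    assignment contains the true computation and no clause has to say that facts
    exclude each other.

    A formula becomes a set of isolated towers (all positions have [j = 0]), for
    which a winning play is a matching of tiles of equal colour together with a
    ranking that is constant on pairs and increases downwards in each tower.  A
    variable [x] has, from top to bottom, a tower X P X and one tower with top X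
    per literal.  The upper X has to be matched with one of the literal towers,
    which opens this literal; the other one stays closed until P is removed.  An
    open literal frees one token per occurrence, a clause tower C Y can only start
    with a token of that clause, and the main tower holds all Y above all P, so
    that P is reached only if the open literals satisfy the formula.  The tokens
    that are left over are matched at the bottom of the main tower.

    Both directions need concrete polynomial-time functions.  Data are binary
    trees whose self-delimiting prefix code lies on top of a stack, so that a
    program replacing the topmost tree ignores what is below it; such programs
    are closed under composition, pairing, case distinction and iterations whose
    intermediate results are polynomially bounded. *)

Require Import Defs.
From Stdlib Require Relation_Operators.
From mathcomp Require Import all_boot all_algebra zify.
Set Implicit Arguments.
Unset Strict Implicit.
Unset Printing Implicit Defensive.

(** * A structured language of stack programs and its compilation *)

(** No tile, colour or tower is ever numbered consecutively. Each is identified by a word that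
    spells out its role and is read as a binary numeral. These numbers are exponentially large, but
    only their bits are computed, so the board of a formula is written by concatenating words. The
    gaps do no harm: a tile set to which no tile belongs is empty, hence even.

    Evenness of the other sets is never counted. It is read off from a winning play, so an
    unsatisfiable formula may yield a board with an odd tile set; the language contains winnable
    arrangements only, and such a word is rightly outside it.

    Numbers that measure lengths, times and indices are unary instead, which makes arithmetic on
    them a matter of list folds.

    As for time bounds, a step writes at most one cell, so a bound on time is also a bound on the
    output. Composition of programs therefore needs no separate size estimate. Iteration does,
    because repeated polynomial growth can become exponential. *)

Inductive reg := R0 | R1 | R2 | R3.

Definition stacks := (seq bool * seq bool * seq bool * seq bool)%type.

Definition get (s : stacks) (i : reg) : seq bool :=
  let: (a, b, c, d) := s in
  match i with R0 => a | R1 => b | R2 => c | R3 => d end.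

Definition upd (s : stacks) (i : reg) (v : seq bool) : stacks :=
  let: (a, b, c, d) := s in
  match i with
  | R0 => (v, b, c, d) | R1 => (a, v, c, d)
  | R2 => (a, b, v, d) | R3 => (a, b, c, v)
  end.

Definition top (s : stacks) (i : reg) : option bool := ohead (get s i).

Inductive cmd :=
  | Skip
  | Push of reg & bool
  | Pop of reg
  | Seq of cmd & cmd
  | If of reg & (option bool -> bool) & cmd & cmd
  | While of reg & (option bool -> bool) & cmd.

(* [run c s s' t]: started on [s], [c] stops on [s'] within [t] machine steps. *)
Inductive run : cmd -> stacks -> stacks -> nat -> Prop :=
  | RunSkip s : run Skip s s 0
  | RunPush i b s : run (Push i b) s (upd s i (b :: get s i)) 2
  | RunPop i s : run (Pop i) s (upd s i (behead (get s i))) 1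
  | RunSeq c1 c2 s1 s2 s3 t1 t2 :
      run c1 s1 s2 t1 -> run c2 s2 s3 t2 -> run (Seq c1 c2) s1 s3 (t1 + t2)
  | RunThen i (p : option bool -> bool) c1 c2 s s' t :
      p (top s i) -> run c1 s s' t -> run (If i p c1 c2) s s' t.+2
  | RunElse i (p : option bool -> bool) c1 c2 s s' t :
      ~~ p (top s i) -> run c2 s s' t -> run (If i p c1 c2) s s' t.+2
  | RunDo i (p : option bool -> bool) c s1 s2 s3 t1 t2 :
      p (top s1 i) -> run c s1 s2 t1 -> run (While i p c) s2 s3 t2 ->
      run (While i p c) s1 s3 (t1 + t2).+2
  | RunDone i (p : option bool -> bool) c s : ~~ p (top s i) -> run (While i p c) s s 1
  | RunLe c s s' t t' : run c s s' t -> t <= t' -> run c s s' t'.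

Definition cells (s : stacks) : nat :=
  size (get s R0) + size (get s R1) + size (get s R2) + size (get s R3).

(** Time bounds space. Every later estimate of an output size in terms of a running time rests on
    this. *)
Lemma run_cells c s s' t : run c s s' t -> cells s' <= cells s + t.
Proof.
elim=> {c s s' t}; try (intros; lia).
- by move=> [] b [[[a1 a2] a3] a4]; rewrite /cells /=; lia.
- by move=> [] [[[a1 a2] a3] a4]; rewrite /cells /= size_behead; lia.
Qed.

(** A machine step writes before it moves, so a push takes two instructions: move left onto a fresh
    cell, then write there. A pop is a single step that blanks the scanned cell and moves right. *)
Inductive instr :=
  | IMoveLeft of reg
  | IWrite of reg & bool
  | IPop of reg
  | ITest of reg & (option bool -> bool) & nat & nat.

Definition jump n := ITest R0 xpredT n n.

(** Jump targets are absolute, so code is generated for its start address [o]. The offset [2] counts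
    the leading test and the closing jump. *)
Fixpoint compile (c : cmd) (o : nat) : seq instr :=
  match c with
  | Skip => [::]
  | Push i b => [:: IMoveLeft i; IWrite i b]
  | Pop i => [:: IPop i]
  | Seq c1 c2 => let b1 := compile c1 o in b1 ++ compile c2 (o + size b1)
  | If i p c1 c2 =>
      let b1 := compile c1 o.+1 in
      let o2 := o + size b1 + 2 in
      let b2 := compile c2 o2 in
      ITest i p o.+1 o2 :: b1 ++ jump (o2 + size b2) :: b2
  | While i p c1 =>
      let b1 := compile c1 o.+1 in
      ITest i p o.+1 (o + size b1 + 2) :: b1 ++ [:: jump o]
  end.

Definition tape_of_reg (i : reg) : 'I_4 :=
  match i with
  | R0 => @Ordinal 4 0 isT | R1 => @Ordinal 4 1 isT
  | R2 => @Ordinal 4 2 isT | R3 => @Ordinal 4 3 isT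
  end.

Definition bit_of_symbol (a : symbol void) : option bool :=
  if a is Some (inl b) then Some b else None.

(** * Instruction lists as Turing machines *)

Section Compile.
Variable P : seq instr.

(** The state is the program counter; the value [size P], just past the last instruction, is the
    halting state. *)
Definition prog_delta (q : 'I_(size P).+1) (a : {ffun 'I_4 -> symbol void}) :
    'I_(size P).+1 * {ffun 'I_4 -> symbol void * direction} :=
  let act i x := [ffun j => if j == tape_of_reg i then x else (a j, Stay)] in
  match nth (jump 0) P q with
  | IMoveLeft i => (inord q.+1, act i (a (tape_of_reg i), Left))
  | IWrite i b => (inord q.+1, act i (Some (inl b), Stay))
  | IPop i => (inord q.+1, act i (None, Right))
  | ITest i p n1 n2 =>
      (inord (if p (bit_of_symbol (a (tape_of_reg i))) then n1 else n2),
       [ffun j => (a j, Stay)])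
  end.

Definition prog_machine : machine :=
  @Machine 'I_(size P).+1 void 3 ord0 ord_max prog_delta.

Notation tape := (tape prog_machine).
Notation config := (tm_config prog_machine).

(** A tape represents a stack only up to blanks: pops leave them on the left, and rewriting an empty
    cell makes them explicit on the right. *)
Definition is_stack (x : tape) (s : seq bool) : Prop :=
  all (pred1 None) x.1 /\
  exists m, x.2 = [seq Some (inl b) | b <- s] ++ nseq m None.

Lemma is_stack_stay x s : is_stack x s -> is_stack (write_move x (read x, Stay)) s.
Proof.
case: x => l r [/= hl [m]] -> ; split=> //=.
case: s => [|b s]; last by exists m.
by case: m => [|m]; [exists 1 | exists m.+1].
Qed.

Lemma is_stack_pop x s :
  is_stack x s -> is_stack (write_move x (None, Right)) (behead s).
Proof.
case: x => l r [/= hl [m]] ->; rewrite /write_move /=; split=> /=.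
  by case: s => [|b s] /=; [case: m|]; rewrite hl.
by case: s => [|b s] /=; [exists m.-1; case: m | exists m].
Qed.

Lemma is_stack_push x s b : is_stack x s ->
  is_stack (write_move (write_move x (read x, Left)) (Some (inl b), Stay)) (b :: s).
Proof.
case: x => l r [/= hl [m]] ->; rewrite /write_move /=; split=> /=.
  by case: l hl => //= a l /andP[].
by case: s => [|b' s] /=; [case: m => [|m]; [exists 1 | exists m.+1] | exists m].
Qed.

Lemma is_stack_top x s : is_stack x s -> bit_of_symbol (read x) = ohead s.
Proof. by case: x => l r [_ [m]] /= ->; rewrite /read; case: s => //=; case: m. Qed.

Definition at_state (k : config) (o : nat) (s : stacks) : Prop :=
  k.1 = o :> nat /\ forall i, is_stack (k.2 (tape_of_reg i)) (get s i).

Definition code_at (o : nat) (C : seq instr) : Prop :=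
  exists2 pre, size pre = o & exists post, P = pre ++ C ++ post.

Lemma code_at_cat o C1 C2 :
  code_at o (C1 ++ C2) -> code_at o C1 /\ code_at (o + size C1) C2.
Proof.
case=> pre ho [post e]; split; first by exists pre => //; exists (C2 ++ post); rewrite e -!catA.
by exists (pre ++ C1); [rewrite size_cat ho | exists post; rewrite e -!catA].
Qed.

Lemma code_at_cons o i C : code_at o (i :: C) ->
  [/\ o < size P, nth (jump 0) P o = i & code_at o.+1 C].
Proof.
move=> h; have /(code_at_cat (C1 := [:: i])) [_] := h; rewrite addn1 => h'; split=> //.
  by case: h => pre <- [post e]; rewrite e !size_cat /=; lia.
by case: h => pre <- [post e]; rewrite e nth_cat ltnn subnn.
Qed.

Lemma code_at_le o C : code_at o C -> o + size C <= size P.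
Proof. by case=> pre <- [post e]; rewrite e !size_cat; lia. Qed.

Lemma step_delta (k : config) : k.1 < size P ->
  tm_step k = let: (q, act) := prog_delta k.1 [ffun i => read (k.2 i)] in
              (q, [ffun i => write_move (k.2 i) (act i)]).
Proof.
move=> h; rewrite /tm_step; case: eqP => // e; move: h; rewrite e /=; lia.
Qed.

Lemma get_upd s i v j : get (upd s i v) j = if tape_of_reg j == tape_of_reg i then v else get s j.
Proof. by case: s => [[[? ?] ?] ?]; case: i; case: j. Qed.

Lemma step_push (k : config) o i b s : code_at o [:: IMoveLeft i; IWrite i b] ->
  at_state k o s -> at_state (tm_step (tm_step k)) o.+2 (upd s i (b :: get s i)).
Proof.
move=> /code_at_cons[lt1 e1 /code_at_cons[lt2 e2 _]] [ho hs].
rewrite [tm_step k]step_delta ?ho // /prog_delta ho e1.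
rewrite step_delta; last by rewrite /= inordK.
rewrite /prog_delta /= inordK // e2.
split=> [|j] /=; first by rewrite inordK.
rewrite !ffunE get_upd; case: eqP => [e|_]; last exact/is_stack_stay/is_stack_stay/hs.
by rewrite e; apply/is_stack_push/hs.
Qed.

Lemma step_pop (k : config) o i s : code_at o [:: IPop i] ->
  at_state k o s -> at_state (tm_step k) o.+1 (upd s i (behead (get s i))).
Proof.
move=> /code_at_cons[lt1 e1 _] [ho hs].
rewrite [tm_step k]step_delta ?ho // /prog_delta ho e1.
split=> [|j] /=; first by rewrite inordK.
rewrite !ffunE get_upd; case: eqP => [e|_]; last exact/is_stack_stay/hs.
by rewrite e; apply/is_stack_pop/hs.
Qed.

Lemma step_test (k : config) o i p n1 n2 C s :
  code_at o (ITest i p n1 n2 :: C) -> n1 <= size P -> n2 <= size P ->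
  at_state k o s -> at_state (tm_step k) (if p (top s i) then n1 else n2) s.
Proof.
move=> /code_at_cons[lt1 e1 _] l1 l2 [ho hs].
rewrite [tm_step k]step_delta ?ho // /prog_delta ho e1.
rewrite ffunE (is_stack_top (hs i)).
split=> [|j] /=; first by rewrite inordK //; case: ifP.
by rewrite !ffunE; apply/is_stack_stay/hs.
Qed.

(** The induction is on the execution and not on the command: the remaining rounds of a loop run the
    same code at the same address, so the hypothesis about the code is used again for them. *)
Lemma compile_correct c s s' t : run c s s' t -> forall o (k : config),
  code_at o (compile c o) -> at_state k o s ->
  exists2 u, u <= t & at_state (iter u (@tm_step _) k) (o + size (compile c o)) s'.
Proof.
elim=> {c s s' t}.
- by move=> s o k _ h; exists 0 => //=; rewrite addn0.
- by move=> i b s o k hc h; exists 2 => //=; rewrite addn2; apply: step_push.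
- by move=> i s o k hc h; exists 1 => //=; rewrite addn1; apply: step_pop.
- move=> c1 c2 s1 s2 s3 t1 t2 _ IH1 _ IH2 o k /= /code_at_cat[h1 h2] hk.
  have [u1 l1 k1] := IH1 _ _ h1 hk; have [u2 l2 k2] := IH2 _ _ h2 k1.
  by exists (u2 + u1); [lia | rewrite iterD size_cat addnA].
- move=> i p c1 c2 s s' t hp _ IH o k /= hc hk.
  have le := code_at_le hc; rewrite /= size_cat /= in le.
  have /code_at_cons[_ _ /code_at_cat[h1 h2]] := hc.
  have := step_test hc _ _ hk; rewrite hp => /(_ ltac:(lia) ltac:(lia)) k1.
  have [u lu k2] := IH _ _ h1 k1.
  have := step_test h2 _ _ k2; rewrite /= => /(_ ltac:(lia) ltac:(lia)) k3.
  exists u.+2 => //; rewrite iterS -iterSr iterS in k3 *.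
  by rewrite size_cat /=; congr at_state: k3; lia.
- move=> i p c1 c2 s s' t hp _ IH o k /= hc hk.
  have le := code_at_le hc; rewrite /= size_cat /= in le.
  have /code_at_cons[_ _ /code_at_cat[_ /code_at_cons [_ _ h2]]] := hc.
  have := step_test hc _ _ hk; rewrite (negbTE hp) => /(_ ltac:(lia) ltac:(lia)) k1.
  rewrite (_ : (o.+1 + size (compile c1 o.+1)).+1 = o + size (compile c1 o.+1) + 2) in h2; last lia.
  have [u lu k2] := IH _ _ h2 k1.
  exists u.+1; first lia.
  by rewrite iterSr size_cat /=; congr at_state: k2; lia.
- move=> i p c s1 s2 s3 t1 t2 hp _ IH1 _ IH2 o k /= hc hk.
  have le := code_at_le hc; rewrite /= size_cat /= in le.
  have /code_at_cons[_ _ /code_at_cat[h1 h2]] := hc.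
  have := step_test hc _ _ hk; rewrite hp => /(_ ltac:(lia) ltac:(lia)) k1.
  have [u lu k2] := IH1 _ _ h1 k1.
  have := step_test h2 _ _ k2; rewrite /= => /(_ ltac:(lia) ltac:(lia)) k3.
  have [u' lu' k4] := IH2 _ _ hc k3.
  exists (u' + u.+2); first lia.
  by rewrite iterD iterS iterSr.
- move=> i p c s hp o k /= hc hk.
  have le := code_at_le hc; rewrite /= size_cat /= in le.
  have := step_test hc _ _ hk; rewrite (negbTE hp) => /(_ ltac:(lia) ltac:(lia)) k1.
  by exists 1 => //=; rewrite size_cat /=; congr at_state: k1; lia.
- move=> c s s' t t' _ IH le o k hc hk; have [u lu k1] := IH _ _ hc hk.
  by exists u => //; lia.
Qed.

End Compile.

(** * Polynomial bounds *)

(** Being polynomial up to pointwise equality lets bounds be written as ordinary arithmetic. *)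
Definition polyfun (g : nat -> nat) := exists p : {poly nat}, g =1 (fun n => p.[n]%R).

Lemma polyfun_const c : polyfun (fun=> c).
Proof. by exists (c%:P)%R => n; rewrite hornerC. Qed.

Lemma polyfun_id : polyfun id.
Proof. by exists 'X%R => n; rewrite hornerX. Qed.

Lemma polyfun_add g h : polyfun g -> polyfun h -> polyfun (fun n => g n + h n).
Proof. by move=> [p hp] [q hq]; exists (p + q)%R => n; rewrite hornerD hp hq. Qed.

Lemma polyfun_mul g h : polyfun g -> polyfun h -> polyfun (fun n => g n * h n).
Proof. by move=> [p hp] [q hq]; exists (p * q)%R => n; rewrite hornerM hp hq. Qed.

Lemma polyfun_comp g h : polyfun g -> polyfun h -> polyfun (fun n => g (h n)).
Proof. by move=> [p hp] [q hq]; exists (p \Po q)%R => n; rewrite horner_comp hp hq. Qed.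

Lemma horner_nat_mono (p : {poly nat}) m n : m <= n -> p.[m]%R <= p.[n]%R.
Proof.
move=> le; elim/poly_ind: p => [|p c IH]; first by rewrite !horner0.
by rewrite !hornerE /=; apply: leq_add => //; apply: leq_mul.
Qed.

Lemma polyfun_mono g m n : polyfun g -> m <= n -> g m <= g n.
Proof. by case=> p hp le; rewrite !hp; apply: horner_nat_mono. Qed.

Ltac polyfun_tac := repeat first
  [ assumption | exact: polyfun_const | exact: polyfun_id
  | apply: polyfun_add | apply: polyfun_mul
  | match goal with h : polyfun ?g |- polyfun (fun n => ?g (@?f n)) =>
      apply: (@polyfun_comp g f) end ].

(** * Binary trees and the functions that stack programs compute on them *)

Inductive tree := Leaf | Node of tree & tree.

Fixpoint code (x : tree) : seq bool :=
  if x is Node a b then true :: code a ++ code b else [:: false].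

Definition tree_size x := size (code x).

Lemma tree_size_node a b : tree_size (Node a b) = (tree_size a + tree_size b).+1.
Proof. by rewrite /tree_size /= size_cat. Qed.

Lemma tree_size_gt0 x : 0 < tree_size x.
Proof. by case: x. Qed.

(** Between operations only [R0] is in use; the other three stacks are scratch space and are left
    empty. *)
Definition main w : stacks := (w, [::], [::], [::]).

Definition Tst i b c1 c2 := If i (pred1 (Some b)) c1 c2.

Definition Unload i :=
  While i isSome (Tst i true (Seq (Pop i) (Push R0 true)) (Seq (Pop i) (Push R0 false))).

Lemma run_le c s s' t t' : t <= t' -> run c s s' t -> run c s s' t'.
Proof. by move=> le h; apply: RunLe le. Qed.

Lemma run_push i b s s' : s' = upd s i (b :: get s i) -> run (Push i b) s s' 2.
Proof. by move->; constructor. Qed.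

Lemma run_pop i s s' : s' = upd s i (behead (get s i)) -> run (Pop i) s s' 1.
Proof. by move->; constructor. Qed.

Ltac run_step := lazymatch goal with
  | |- run (Seq _ _) _ _ _ => eapply RunSeq
  | |- run (Push _ _) _ _ _ => apply: run_push; reflexivity
  | |- run (Pop _) _ _ _ => apply: run_pop; reflexivity
  | |- run Skip _ _ _ => exact: RunSkip
  end.

Lemma run_unload1 a w c d :
  run (Unload R1) (w, a, c, d) (catrev a w, [::], c, d) (7 * size a + 1).
Proof.
elim: a w => [|b a IH] w /=; first exact: RunDone.
apply: (run_le (t := (2 + 3 + (7 * size a + 1)).+2)); first lia.
apply: RunDo (IH (b :: w)) => //.
case: b; [apply: (@RunThen _ _ _ _ _ _ 3) => // | apply: (@RunElse _ _ _ _ _ _ 3) => //];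
  by apply: (@RunSeq _ _ _ _ _ 1 2); repeat run_step.
Qed.

Lemma run_unload3 d w a c :
  run (Unload R3) (w, a, c, d) (catrev d w, a, c, [::]) (7 * size d + 1).
Proof.
elim: d w => [|b d IH] w /=; first exact: RunDone.
apply: (run_le (t := (2 + 3 + (7 * size d + 1)).+2)); first lia.
apply: RunDo (IH (b :: w)) => //.
case: b; [apply: (@RunThen _ _ _ _ _ _ 3) => // | apply: (@RunElse _ _ _ _ _ _ 3) => //];
  by apply: (@RunSeq _ _ _ _ _ 1 2); repeat run_step.
Qed.

(** * Moving prefix codes between stacks *)

Section Skim.
Variables e1 e3 : bool.

(** The flags select the stacks that receive a copy of the symbols read. The four settings serve to
    drop a tree, to duplicate it, and to do the two halves of a swap. *)
Definition Emit b :=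
  Seq (if e1 then Push R1 b else Skip) (if e3 then Push R3 b else Skip).

(* The counter [R2] holds one mark per tree still to be read from [R0]. *)
Definition SkimLoop := While R2 isSome
  (Tst R0 true (Seq (Pop R0) (Seq (Emit true) (Push R2 true)))
               (Seq (Pop R0) (Seq (Emit false) (Pop R2)))).

Definition Skim := Seq (Push R2 true) SkimLoop.

Definition out (e : bool) (w a : seq bool) := if e then catrev w a else a.

Lemma run_emit b w a c d :
  run (Emit b) (w, a, c, d) (w, out e1 [:: b] a, c, out e3 [:: b] d) 4.
Proof.
rewrite /Emit; apply: (@RunSeq _ _ _ (w, out e1 [:: b] a, c, d) _ 2 2).
  by case: e1; [run_step | apply: RunLe (RunSkip _) _].
by case: e3; [run_step | apply: RunLe (RunSkip _) _].
Qed.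

(** Stated with the rest of the loop as a continuation, so that the two subtrees of a node can be
    treated one after the other within a single loop. *)
Lemma run_skim_loop x r a d n s' t :
  run SkimLoop (r, out e1 (code x) a, nseq n true, out e3 (code x) d) s' t ->
  run SkimLoop (code x ++ r, a, nseq n.+1 true, d) s' (11 * tree_size x + t).
Proof.
elim: x r a d n t => [|x1 IH1 x2 IH2] r a d n t h.
  apply: (@run_le _ _ _ (7 + 2 + t).+2); first by rewrite /tree_size /=; lia.
  apply: RunDo h => //; apply: (@RunElse _ _ _ _ _ _ 7) => //.
  apply: (@RunSeq _ _ _ (r, a, nseq n.+1 true, d) _ 1 6); first by run_step.
  apply: (@RunSeq _ _ _ _ _ 4 2); first exact: run_emit.
  by apply: RunLe (_ : 1 <= 2) => //; run_step.
rewrite tree_size_node.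
apply: (@run_le _ _ _ (7 + 2 + (11 * tree_size x1 + (11 * tree_size x2 + t))).+2); first lia.
apply: (@RunDo _ _ _ _
  (code x1 ++ code x2 ++ r, out e1 [:: true] a, nseq n.+2 true, out e3 [:: true] d)) => //.
  rewrite /= -catA; apply: (@RunThen _ _ _ _ _ _ 7) => //.
  apply: (@RunSeq _ _ _ _ _ 1 6); first by run_step.
  by apply: (@RunSeq _ _ _ _ _ 4 2); [exact: run_emit | run_step].
apply/IH1/IH2; congr run: h.
by congr (_, _, _, _); rewrite /out /=; [case: e1 | case: e3] => //=; rewrite catrev_catl.
Qed.

Lemma run_skim x r a d :
  run Skim (code x ++ r, a, [::], d)
    (r, out e1 (code x) a, [::], out e3 (code x) d) (11 * tree_size x + 3).
Proof.
apply: (@run_le _ _ _ (2 + (11 * tree_size x + 1))); first lia.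
apply: RunSeq; first by run_step.
by apply: (@run_skim_loop x r a d 0); apply: RunDone.
Qed.

End Skim.

Definition Drop := Skim false false.

Definition Dup := Seq (Skim true true) (Seq (Unload R1) (Unload R3)).

Definition Swap := Seq (Skim true false) (Seq (Skim false true) (Seq (Unload R1) (Unload R3))).

Lemma run_drop x r : run Drop (main (code x ++ r)) (main r) (11 * tree_size x + 3).
Proof. exact: run_skim. Qed.

Lemma catrev_catrev (T : Type) (u v : seq T) : catrev (catrev u [::]) v = u ++ v.
Proof. by rewrite -[catrev u _]/(rev u) catrevE revK. Qed.

Lemma run_dup x r :
  run Dup (main (code x ++ r)) (main (code x ++ code x ++ r)) (25 * tree_size x + 5).
Proof.
apply: (@run_le _ _ _ (11 * tree_size x + 3 + ((7 * tree_size x + 1) + (7 * tree_size x + 1)))); first lia.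
apply: RunSeq; first exact: run_skim.
rewrite /out -!(catrev_catrev (code x)) /tree_size -!(size_rev (code x)).
by apply: RunSeq; [exact: run_unload1 | exact: run_unload3].
Qed.

Lemma run_swap x y r :
  run Swap (main (code x ++ code y ++ r)) (main (code y ++ code x ++ r))
    (18 * (tree_size x + tree_size y) + 8).
Proof.
apply: (@run_le _ _ _ (11 * tree_size x + 3 + (11 * tree_size y + 3 +
  ((7 * tree_size x + 1) + (7 * tree_size y + 1))))); first lia.
apply: RunSeq; first exact: run_skim.
apply: RunSeq; first exact: run_skim.
rewrite /out -(catrev_catrev (code y)) -(catrev_catrev (code x)).
rewrite /tree_size -(size_rev (code x)) -(size_rev (code y)).
by apply: RunSeq; [exact: run_unload1 | exact: run_unload3].
Qed.

(** The program only has to be correct on trees of the form [u a], so ill-formed inputs need no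
    convention, and [A] may index the states of a loop as well as inputs. The arbitrary [r] is what
    allows the program to run on top of saved data. *)
Definition computes (A : Type) (u v : A -> tree) := exists c g, polyfun g /\
  forall a r, run c (main (code (u a) ++ r)) (main (code (v a) ++ r)) (g (tree_size (u a))).

Definition tcar x := if x is Node a _ then a else Leaf.
Definition tcdr x := if x is Node _ b then b else Leaf.
Definition is_node x := if x is Node _ _ then true else false.

(** * Closure properties of stack computations *)

Section Computes.
Variable A : Type.
Implicit Types u v w : A -> tree.

Lemma computes_size u v : computes u v ->
  exists2 g, polyfun g & forall a, tree_size (v a) <= g (tree_size (u a)).
Proof.
case=> c [g [hg h]]; exists (fun n => n + g n); first by polyfun_tac.
by move=> a; have /run_cells := h a [::]; rewrite /cells /main /= !cats0 /tree_size; lia.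
Qed.

Lemma computes_id u : computes u u.
Proof. by exists Skip, (fun=> 0); split=> [|x r]; [polyfun_tac | exact: RunSkip]. Qed.

Lemma computes_comp u v w : computes u v -> computes v w -> computes u w.
Proof.
move=> hF [cG [gG [pG hG]]]; have [g pg hg] := computes_size hF.
case: hF => cF [gF [pF hF]].
exists (Seq cF cG), (fun n => gF n + gG (g n)); split=> [|x r]; first by polyfun_tac.
apply: RunSeq (hF _ _) _; apply: run_le (hG _ _).
exact: polyfun_mono.
Qed.

Lemma computes_const u z : computes u (fun=> z).
Proof.
exists (Seq Drop (foldr (fun b c => Seq c (Push R0 b)) Skip (code z))).
exists (fun n => 11 * n + 3 + 2 * tree_size z); split=> [|x r]; first by polyfun_tac.
apply: RunSeq (run_drop _ _) _; rewrite [tree_size z]/tree_size.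
elim: (code z) => [|b s IH] /=; first exact: RunSkip.
apply: (@run_le _ _ _ (2 * size s + 2)); first lia.
by apply: RunSeq; [exact: IH | run_step].
Qed.

(** The second component is computed first: the prefix code requires the first one to end up on top
    of it. *)
Lemma computes_node u v w :
  computes u v -> computes u w -> computes u (fun a => Node (v a) (w a)).
Proof.
move=> [cF [gF [pF hF]]] hG; have [g pg hg] := computes_size hG.
case: hG => cG [gG [pG hG]].
exists (Seq Dup (Seq cG (Seq Swap (Seq cF (Push R0 true))))).
exists (fun n => 25 * n + 5 + (gG n + (18 * (g n + n) + 8 + (gF n + 2)))).
split=> [|x r]; first by polyfun_tac.
apply: RunSeq (run_dup _ _) _; apply: RunSeq (hG _ _) _; apply: RunSeq.
  by apply: run_le (run_swap _ _ _); rewrite !(leq_add, leq_mul).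
by apply: RunSeq (hF _ _) _; apply: run_push; rewrite /= -catA.
Qed.

Lemma computes_car u : computes u (fun a => tcar (u a)).
Proof.
exists (Tst R0 true (Seq (Pop R0) (Seq Swap Drop)) Skip), (fun n => 40 * n + 40).
split=> [|a r]; first by polyfun_tac.
case: (u a) => [|x y].
  apply: (@run_le _ _ _ 2); first lia.
  by apply: (@RunElse _ _ _ _ _ _ 0) => //; run_step.
rewrite tree_size_node.
apply: (@run_le _ _ _ (1 + (18 * (tree_size x + tree_size y) + 8 + (11 * tree_size y + 3))).+2); first lia.
apply: RunThen => //=; rewrite -catA; apply: RunSeq; first by run_step.
by apply: RunSeq (run_swap _ _ _) (run_drop _ _).
Qed.

Lemma computes_cdr u : computes u (fun a => tcdr (u a)).
Proof.
exists (Tst R0 true (Seq (Pop R0) Drop) Skip), (fun n => 40 * n + 40).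
split=> [|a r]; first by polyfun_tac.
case: (u a) => [|x y].
  apply: (@run_le _ _ _ 2); first lia.
  by apply: (@RunElse _ _ _ _ _ _ 0) => //; run_step.
rewrite tree_size_node.
apply: (@run_le _ _ _ (1 + (11 * tree_size x + 3)).+2); first lia.
apply: RunThen => //=; rewrite -catA; apply: RunSeq; first by run_step.
exact: run_drop.
Qed.

Lemma computes_if u p v w : computes u p -> computes u v -> computes u w ->
  computes u (fun a => if is_node (p a) then v a else w a).
Proof.
move=> hP [cF [gF [pF hF]]] [cG [gG [pG hG]]]; have [g pg hg] := computes_size hP.
case: hP => cP [gP [pP hP]].
exists (Seq Dup (Seq cP (Tst R0 true (Seq Drop cF) (Seq Drop cG)))).
exists (fun n => 25 * n + 5 + (gP n + (2 + (11 * g n + 3 + (gF n + gG n))))).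
split=> [|a r]; first by polyfun_tac.
apply: RunSeq (run_dup _ _) _; apply: RunSeq (hP _ _) _.
have := hg a; case e: (p a) => [|x y] /= le.
  apply: RunElse => //; rewrite -[_ :: _]/(code Leaf ++ _).
  apply: RunSeq; first by apply: run_le (run_drop _ _); rewrite !(leq_add, leq_mul).
  by apply: run_le (hG _ _); lia.
apply: RunThen => //; rewrite -[_ :: _]/(code (Node x y) ++ _).
apply: RunSeq; first by apply: run_le (run_drop _ _); rewrite !(leq_add, leq_mul).
by apply: run_le (hF _ _); lia.
Qed.

End Computes.

Lemma computes_reindex (A B : Type) (h : B -> A) u v :
  computes u v -> computes (fun b => u (h b)) (fun b => v (h b)).
Proof. by move=> [c [g [pg hc]]]; exists c, g; split=> // b r; apply: hc. Qed.

(** The number of rounds for which a tree can serve as loop counter; for an encoded list it is the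
    length. *)
Fixpoint spine x := if x is Node _ b then (spine b).+1 else 0.

Lemma spine_le x : spine x <= tree_size x.
Proof. by elim: x => // a _ b; rewrite tree_size_node /=; lia. Qed.

(** The counter lies on top of the loop state. Each round removes one node of its spine and brings
    the state to the top just for the body. *)
Definition Loop c := While R0 (pred1 (Some true))
  (Seq (Pop R0) (Seq Drop (Seq Swap (Seq c Swap)))).

Lemma run_loop (s : nat -> tree) c g n r B k : polyfun g ->
  (forall j r, j < spine n + k ->
    run c (main (code (s j) ++ r)) (main (code (s j.+1) ++ r)) (g (tree_size (s j)))) ->
  (forall j, j <= spine n + k -> tree_size (s j) <= B) ->
  run (Loop c) (main (code n ++ code (s k) ++ r)) (main (code Leaf ++ code (s (spine n + k)) ++ r))
    (spine n * (60 * tree_size n + 60 * B + g B + 60) + 1).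
Proof.
move=> pg; elim: n k => [|a _ n IH] k hc hB; first exact: RunDone.
have h0 : tree_size (s k) <= B by apply: hB; rewrite /=; lia.
have h1 : tree_size (s k.+1) <= B by apply: hB; rewrite /=; lia.
rewrite tree_size_node /=.
apply: (@run_le _ _ _ ((1 + (11 * tree_size a + 3 + (18 * (tree_size n + tree_size (s k)) + 8 + (g (tree_size (s k)) +
   (18 * (tree_size (s k.+1) + tree_size n) + 8))))) +
   (spine n * (60 * tree_size n + 60 * B + g B + 60) + 1)).+2).
  have lg : g (tree_size (s k)) <= g B by apply: polyfun_mono.
  set x := g _ in lg *; set y := g _ in lg *.
  have : spine n * (60 * tree_size n + 60 * B + y + 60) <=
    spine n * (60 * (tree_size a + tree_size n).+1 + 60 * B + y + 60) by apply: leq_mul => //; lia.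
  rewrite mulSn; lia.
apply: RunDo => //.
  apply: RunSeq; first by run_step.
  rewrite /= -catA; apply: RunSeq (run_drop _ _) _; apply: RunSeq (run_swap _ _ _) _.
  by apply: RunSeq (hc k _ _) (run_swap _ _ _); rewrite /=; lia.
by rewrite addSnnS; apply: IH => j; rewrite -addSnnS; [exact: hc | exact: hB].
Qed.

(** [J] indexes the transitions that actually occur, and the body has to be correct on these only.
    The bound [q] applies to all intermediate states: a polynomial-time body alone would not keep
    them polynomial. *)
Lemma computes_iter (A J : Type) (n : A -> tree) (s : A -> nat -> tree) (u v : J -> tree) q :
  polyfun q -> computes u v ->
  (forall a k, k < spine (n a) -> exists2 j, u j = s a k & v j = s a k.+1) ->
  (forall a k, k <= spine (n a) -> tree_size (s a k) <= q (tree_size (Node (n a) (s a 0)))) ->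
  computes (fun a => Node (n a) (s a 0)) (fun a => s a (spine (n a))).
Proof.
move=> pq [c [g [pg hF]]] hs hq.
exists (Seq (Pop R0) (Seq (Loop c) (Pop R0))).
exists (fun n => 10 + n * (60 * n + 60 * q n + g (q n) + 60)); split=> [|a r].
  by polyfun_tac.
set m := tree_size _; set B := q m.
have ls : spine (n a) <= m by rewrite /m tree_size_node; have := spine_le (n a); lia.
have ln : tree_size (n a) <= m by rewrite /m tree_size_node; lia.
apply: (@run_le _ _ _ (1 + (spine (n a) * (60 * tree_size (n a) + 60 * B + g B + 60) + 1 + 1))).
  suff: spine (n a) * (60 * tree_size (n a) + 60 * B + g B + 60) <= m * (60 * m + 60 * B + g B + 60) by lia.
  by apply: leq_mul => //; lia.
apply: RunSeq; first by run_step.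
rewrite /= -catA; apply: RunSeq.
  apply: (@run_loop (s a) _ _ _ _ B 0 pg) => [j r'|j]; rewrite addn0; last exact: hq.
  by case/hs => i <- <-; apply: hF.
by rewrite addn0; run_step.
Qed.

(** * Polynomial-time functions between encoded types *)

Structure encType := EncType { esort :> Type; enc : esort -> tree }.

Arguments enc {e} _.

Canonical enc_unit := @EncType unit (fun=> Leaf).
Canonical enc_bool := @EncType bool (fun b => if b then Node Leaf Leaf else Leaf).
(** Unary; binary numerals are treated as words of bits throughout. *)
Canonical enc_nat := @EncType nat (fun n => iter n (Node Leaf) Leaf).
Canonical enc_pair (A B : encType) := @EncType (A * B) (fun p => Node (enc p.1) (enc p.2)).
Canonical enc_seq (A : encType) := @EncType (seq A) (foldr (fun a => Node (enc a)) Leaf).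

Definition sz (A : encType) (a : A) := tree_size (enc a).

Lemma sz_gt0 (A : encType) (a : A) : 0 < sz a.
Proof. exact: tree_size_gt0. Qed.

Lemma sz_pair (A B : encType) (p : A * B) : sz p = (sz p.1 + sz p.2).+1.
Proof. exact: tree_size_node. Qed.

Lemma sz_cons (A : encType) (a : A) s : sz (a :: s) = (sz a + sz s).+1.
Proof. exact: tree_size_node. Qed.

Lemma sz_bool (b : bool) : sz b <= 3.
Proof. by case: b. Qed.

Lemma sz_S n : sz n.+1 = (sz n).+2.
Proof. by rewrite /sz [LHS]tree_size_node. Qed.

Lemma size_le_sz (A : encType) (s : seq A) : size s <= sz s.
Proof. by elim: s => // a s IH; rewrite sz_cons /=; lia. Qed.

Lemma sz_cat (A : encType) (s t : seq A) : sz (s ++ t) < sz s + sz t.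
Proof.
have ht : 0 < sz t := sz_gt0 _; have h0 : 0 < sz (Nil A) := sz_gt0 _.
by elim: s => [|a s IH] /=; rewrite ?sz_cons; lia.
Qed.

Lemma sz_drop (A : encType) (s : seq A) k : sz (drop k s) <= sz s.
Proof. by elim: s k => [|a s IH] [|k] //=; have := IH k; rewrite sz_cons; lia. Qed.

Section PT.

Definition PT (A B : encType) (f : A -> B) : Prop :=
  computes enc (fun a => enc (f a)).

Variables E A B C : encType.
Implicit Types (e : E) (f g : E -> A).

Lemma PT_size_bound f : PT f -> exists2 q, polyfun q & forall e, sz (f e) <= q (sz e).
Proof. by move/computes_size. Qed.

Lemma PT_ext f g : g =1 f -> PT f -> PT g.
Proof. by move=> e [c [q [pq h]]]; exists c, q; split=> // a r; rewrite e. Qed.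

Lemma PT_id : PT (fun e => e).
Proof. exact: computes_id. Qed.

Lemma PT_const (a : A) : PT (fun e => a).
Proof. exact: computes_const. Qed.

Lemma PT_comp f (g : A -> B) : PT g -> PT f -> PT (fun e => g (f e)).
Proof. by move=> hg hf; apply: computes_comp hf _; apply: (computes_reindex f hg). Qed.

Lemma PT_pair f (g : E -> B) : PT f -> PT g -> PT (fun e => (f e, g e)).
Proof. exact: computes_node. Qed.

Lemma PT_comp2 f (g : E -> B) (h : A -> B -> C) :
  PT (fun p : A * B => h p.1 p.2) -> PT f -> PT g -> PT (fun e => h (f e) (g e)).
Proof.
by move=> hh hf hg; apply: computes_comp (PT_pair hf hg) _; apply: (computes_reindex _ hh).
Qed.

Lemma PT_fst (f : E -> A * B) : PT f -> PT (fun e => (f e).1).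
Proof. by move=> hf; apply: computes_comp hf (computes_car _). Qed.

Lemma PT_snd (f : E -> A * B) : PT f -> PT (fun e => (f e).2).
Proof. by move=> hf; apply: computes_comp hf (computes_cdr _). Qed.

Lemma PT_if (b : E -> bool) f g : PT b -> PT f -> PT g -> PT (fun e => if b e then f e else g e).
Proof.
move=> hb hf hg; have [c [q [pq h]]] := computes_if hb hf hg.
by exists c, q; split=> // e r; have := h e r; case: (b e).
Qed.

Lemma PT_cons f (s : E -> seq A) : PT f -> PT s -> PT (fun e => f e :: s e).
Proof. exact: computes_node. Qed.

End PT.

Arguments PT_const {E A} a.
Arguments PT_id {E}.

Section PTList.
Variables E A B C : encType.
Implicit Types (e : E) (f g : E -> A).

Lemma PT_behead (s : E -> seq A) : PT s -> PT (fun e => behead (s e)).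
Proof.
move=> hs; have [c [q [pq h]]] := computes_comp hs (computes_cdr _).
by exists c, q; split=> // e r; have := h e r; case: (s e).
Qed.

Lemma PT_nilp (s : E -> seq A) : PT s -> PT (fun e => nilp (s e)).
Proof.
move=> hs.
have [c [q [pq h]]] := computes_if hs (PT_const false) (PT_const true).
by exists c, q; split=> // e r; have := h e r; rewrite /nilp; case: (s e).
Qed.

Lemma PT_head f (s : E -> seq A) : PT f -> PT s -> PT (fun e => head (f e) (s e)).
Proof.
move=> hf hs; have [c [q [pq h]]] := computes_if hs (computes_comp hs (computes_car _)) hf.
by exists c, q; split=> // e r; have := h e r; case: (s e).
Qed.

Lemma PT_S (n : E -> nat) : PT n -> PT (fun e => (n e).+1).
Proof. by move=> hn; apply: computes_node hn; apply: computes_const. Qed.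

Lemma PT_pred (n : E -> nat) : PT n -> PT (fun e => (n e).-1).
Proof.
move=> hn; have [c [q [pq h]]] := computes_comp hn (computes_cdr _).
by exists c, q; split=> // e r; have := h e r; case: (n e).
Qed.

Lemma PT_eq0 (n : E -> nat) : PT n -> PT (fun e => n e == 0).
Proof.
move=> hn.
have [c [q [pq h]]] := computes_if hn (PT_const false) (PT_const true).
by exists c, q; split=> // e r; have := h e r; case: (n e).
Qed.

(** A unary number and a list of that many units have the same code, so iteration on a number
    becomes a fold over a list. *)
Lemma PT_nseq_unit (n : E -> nat) : PT n -> PT (fun e => nseq (n e) tt).
Proof.
move=> hn; have [c [q [pq h]]] := hn.
exists c, q; split=> // e r; have := h e r.
by congr run; congr (main (code _ ++ _)); elim: (n e) => //= k; rewrite /= => ->.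
Qed.

Lemma spine_enc_seq (s : seq A) : spine (enc s) = size s.
Proof. by elim: s => //= a s; rewrite /= => ->. Qed.

Lemma PT_foldl (s : E -> seq A) (z : E -> B) (f : E -> B -> A -> B) :
  PT s -> PT z -> PT (fun p : E * B * A => f p.1.1 p.1.2 p.2) ->
  (exists2 q, polyfun q & forall e k, sz (foldl (f e) (z e) (take k (s e))) <= q (sz e)) ->
  PT (fun e => foldl (f e) (z e) (s e)).
Proof.
move=> hs hz hf [q pq hq].
have [qs pqs hqs] := PT_size_bound hs.
(* The loop state consists of the environment, the unread suffix and the accumulator, while a second
   copy of the list is the counter. The transition [u] to [v] consumes one element of the suffix. *)
pose st e k := Node (enc e) (Node (enc (drop k (s e))) (enc (foldl (f e) (z e) (take k (s e))))).
pose u (j : E * A * seq A * B) := let: (e, x, r, b) := j in Node (enc e) (Node (enc (x :: r)) (enc b)).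
pose v (j : E * A * seq A * B) := let: (e, x, r, b) := j in Node (enc e) (Node (enc r) (enc (f e b x))).
have huv : computes u v.
  have h1 : computes u (fun j => tcdr (tcar (tcdr (u j)))).
    by apply: computes_comp (computes_cdr _) _; apply: computes_comp (computes_car _) (computes_cdr _).
  have h2 : computes u (fun j => tcar (tcar (tcdr (u j)))).
    by apply: computes_comp (computes_cdr _) _; apply: computes_comp (computes_car _) (computes_car _).
  have h3 : computes u (fun j => tcdr (tcdr (u j))).
    by apply: computes_comp (computes_cdr _) (computes_cdr _).
  have h4 : computes u (fun j => enc (f j.1.1.1 j.2 j.1.1.2)).
    apply: computes_comp (computes_node (computes_node (computes_car u) h3) h2) _.
    have [c [p [pp h]]] := computes_reindex (fun j : E * A * seq A * B => (j.1.1.1, j.2, j.1.1.2)) hf.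
    by exists c, p; split=> // -[[[e x] r] b] w; exact: (h (e, x, r, b) w).
  have [c [p [pp h]]] := computes_node (computes_car u) (computes_node h1 h4).
  by exists c, p; split=> // -[[[e x] r] b] w; exact: (h (e, x, r, b) w).
have hst : computes enc (fun e => Node (enc (s e)) (st e 0)).
  apply: computes_node => //; apply: computes_node; first exact: computes_id.
  have [c [p [pp h]]] := computes_node hs hz.
  by exists c, p; split=> // e r; have := h e r; rewrite drop0 take0.
have hit := computes_iter (q := fun n => 4 * n + q n + qs n) _ huv.
have : computes enc (fun e => st e (size (s e))).
  apply: computes_comp hst _.
  have [||| c [p [pp h]]] := hit _ (fun e => enc (s e)) st.
  - by polyfun_tac.
  - move=> e k; rewrite spine_enc_seq => lt.
    case E0: (drop k (s e)) => [|x r]; first by move/(congr1 size): E0; rewrite size_drop /=; lia.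
    exists (e, x, r, foldl (f e) (z e) (take k (s e))); rewrite /u /v /st ?E0 //.
    congr (Node _ (Node _ _)); congr enc.
      by rewrite -addn1 addnC -drop_drop E0 /= drop0.
    by rewrite (take_nth x) // -cats1 foldl_cat /= -[in nth _ _ _](addn0 k) -nth_drop E0.
  - move=> e k _; have := hq e k; have := hqs e; have := sz_drop (s e) k.
    rewrite /sz; set N := tree_size (Node (enc (s e)) _) => l1 l2 l3.
    have leN : tree_size (enc e) <= N by rewrite /N /st !tree_size_node; lia.
    have l4 := polyfun_mono pq leN; have l5 := polyfun_mono pqs leN.
    have l6 : tree_size (enc (s e)) + 2 <= N by rewrite /N /st !tree_size_node; lia.
    by rewrite /st !tree_size_node; lia.
  by exists c, p; split=> // e r; have := h e r; rewrite spine_enc_seq.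
move=> /computes_comp/(_ (computes_cdr _))/computes_comp/(_ (computes_cdr _)).
case=> c [p [pp h]]; exists c, p; split=> // e r.
by have := h e r; rewrite /= take_size.
Qed.

End PTList.

(** If each step adds at most an amount that is polynomial in the data outside the accumulator, then
    the total growth is that amount times the number of steps. This is the usual case, and it spares
    a bound on partial folds. *)
Lemma PT_foldl_add (E A B : encType) (s : E -> seq A) (z : E -> B) (f : E -> B -> A -> B) :
  PT s -> PT z -> PT (fun p : E * B * A => f p.1.1 p.1.2 p.2) ->
  (exists2 q, polyfun q & forall e b a, sz (f e b a) <= sz b + q (sz e + sz a)) ->
  PT (fun e => foldl (f e) (z e) (s e)).
Proof.
move=> hs hz hf [q pq hq].
have [qs pqs hqs] := PT_size_bound hs; have [qz pqz hqz] := PT_size_bound hz.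
apply: PT_foldl => //; exists (fun n => qz n + qs n * q (n + qs n)); first by polyfun_tac.
move=> e k; apply: (@leq_trans (sz (z e) + sz (s e) * q (sz e + sz (s e)))); last first.
  by apply: leq_add => //; apply: leq_mul => //; apply: polyfun_mono => //; rewrite leq_add2l.
set Q := q _.
have {hq}hq b a : sz a <= sz (s e) -> sz (f e b a) <= sz b + Q.
  move=> le; apply: leq_trans (hq _ _ _) _; rewrite leq_add2l.
  by apply: polyfun_mono => //; rewrite leq_add2l.
move: Q hq; move: (z e) (s e) => b0 l Q hq {hz hqz hs hqs}.
elim: l k b0 hq => [|a l IH] k b0 hq /=; first lia.
case: k => [|k] /=; first lia.
rewrite sz_cons in hq *.
have h1 := hq b0 a ltac:(lia).
have := IH k (f e b0 a) (fun b x le => hq b x ltac:(lia)).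
by rewrite mulSn mulnDl; lia.
Qed.

Lemma PT_comp3 (E A B C D : encType) (f : E -> A) (g : E -> B) (h : E -> C) (k : A -> B -> C -> D) :
  PT (fun p : A * B * C => k p.1.1 p.1.2 p.2) -> PT f -> PT g -> PT h ->
  PT (fun e => k (f e) (g e) (h e)).
Proof.
move=> hk hf hg hh.
exact: (PT_comp (g := fun p : A * B * C => k p.1.1 p.1.2 p.2) hk (PT_pair (PT_pair hf hg) hh)).
Qed.

(* Deriving polynomial time from the shape of a definition *)
Create HintDb pt.

Ltac pt_side := solve [assumption | auto with pt nocore].

Ltac pt_eta := cbv beta zeta; lazymatch goal with
  | |- PT (fun _ => _) => idtac
  | |- PT ?f => change (PT (fun e => f e))
  end.

Ltac pt_step := pt_eta; lazymatch goal with
  | |- PT (fun e => e) => exact: PT_id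
  | |- PT (fun e => fst (@?f e)) => apply: PT_fst
  | |- PT (fun e => snd (@?f e)) => apply: PT_snd
  | |- PT (fun e => (@?f e, @?g e)) => apply: PT_pair
  | |- PT (fun e => @?f e :: @?g e) => apply: PT_cons
  | |- PT (fun e => (@?f e).+1) => apply: PT_S
  | |- PT (fun e => (@?f e).-1) => apply: PT_pred
  | |- PT (fun e => @?f e == 0) => apply: PT_eq0
  | |- PT (fun e => nilp (@?f e)) => apply: PT_nilp
  | |- PT (fun e => behead (@?f e)) => apply: PT_behead
  | |- PT (fun e => head (@?f e) (@?g e)) => apply: PT_head
  end.

(* Overridden once the closure lemmas for list functions are available. *)
Ltac pt_fold := fail.

Ltac pt_app := pt_eta; match goal with
  | |- PT (fun e => ?g (@?f e)) => apply: (@PT_comp _ _ _ f g); [pt_side |]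
  | |- PT (fun e => ?h (@?f e) (@?g e)) => apply: (@PT_comp2 _ _ _ _ f g h); [pt_side | |]
  | |- PT (fun e => ?k (@?f e) (@?g e) (@?h e)) =>
      apply: (@PT_comp3 _ _ _ _ _ f g h k); [pt_side | | |]
  end.

Ltac pt := repeat first [solve [simple apply PT_const] | pt_side | pt_step | pt_fold | pt_app | simple apply PT_if].

(** * Polynomial-time operations on booleans, lists and unary numbers *)

Lemma PT_andb : PT (fun p : bool * bool => p.1 && p.2).
Proof. by rewrite /andb; pt. Qed.

Lemma PT_orb : PT (fun p : bool * bool => p.1 || p.2).
Proof. by rewrite /orb; pt. Qed.

Lemma PT_negb : PT negb.
Proof. by rewrite /negb; pt. Qed.

Lemma PT_eqb : PT (fun p : bool * bool => p.1 == p.2).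
Proof.
apply: (@PT_ext _ _ (fun p : bool * bool => if p.1 then p.2 else if p.2 then false else true)).
  by case=> [] [] [].
by pt.
Qed.
#[global] Hint Resolve PT_andb PT_orb PT_negb PT_eqb : pt.

Lemma PT_rev (A : encType) : PT (@rev A).
Proof.
apply: (@PT_ext _ _ (fun s => foldl (fun b a => a :: b) [::] s)).
  by move=> s; rewrite /rev; elim: s [::] => //= a l IH b; rewrite -IH.
apply: PT_foldl_add; try by pt.
by exists (fun n => n + 1); [polyfun_tac | move=> e b a; rewrite sz_cons; lia].
Qed.
#[global] Hint Resolve PT_rev : pt.

Lemma PT_foldr_add (E A B : encType) (s : E -> seq A) (z : E -> B) (f : E -> A -> B -> B) :
  PT s -> PT z -> PT (fun p : E * A * B => f p.1.1 p.1.2 p.2) ->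
  (exists2 q, polyfun q & forall e a b, sz (f e a b) <= sz b + q (sz e + sz a)) ->
  PT (fun e => foldr (f e) (z e) (s e)).
Proof.
move=> hs hz hf [q pq hq].
apply: (@PT_ext _ _ (fun e => foldl (fun b a => f e a b) (z e) (rev (s e)))).
  by move=> e; rewrite foldl_rev.
apply: (@PT_foldl_add _ _ _ _ _ (fun e b a => f e a b)) => //; first by pt.
  by apply: (PT_comp3 (k := f)) => //; pt.
by exists q.
Qed.

Lemma PT_map (E A B : encType) (s : E -> seq A) (f : E -> A -> B) :
  PT s -> PT (fun p : E * A => f p.1 p.2) -> PT (fun e => map (f e) (s e)).
Proof.
move=> hs hf; have [q pq hq] := PT_size_bound hf.
apply: (@PT_ext _ _ (fun e => foldr (fun a b => f e a :: b) [::] (s e))).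
  by move=> e; elim: (s e) => //= a l ->.
apply: (PT_foldr_add (f := fun e a b => f e a :: b)) => //; first by pt.
  by apply: PT_cons; [apply: (PT_comp2 (h := f)) => //; pt | pt].
exists (fun n => q n.+1 + 1); first by apply: polyfun_add;
  [apply: (polyfun_comp (g := q) (h := fun n => 1 + n)) => // |]; polyfun_tac.
by move=> e a b; have := hq (e, a); rewrite sz_cons sz_pair /=; lia.
Qed.

Lemma PT_filter (E A : encType) (s : E -> seq A) (f : E -> A -> bool) :
  PT s -> PT (fun p : E * A => f p.1 p.2) -> PT (fun e => filter (f e) (s e)).
Proof.
move=> hs hf.
apply: (@PT_ext _ _ (fun e => foldr (fun a b => if f e a then a :: b else b) [::] (s e))).
  by move=> e; elim: (s e) => //= a l ->.
apply: (PT_foldr_add (f := fun e a b => if f e a then a :: b else b)) => //; first by pt.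
  by apply: PT_if; [apply: (PT_comp2 (h := f)) => //; pt | pt | pt].
by exists (fun n => n + 1); [polyfun_tac | move=> e a b; case: ifP; rewrite ?sz_cons; lia].
Qed.

Lemma PT_all (E A : encType) (s : E -> seq A) (f : E -> A -> bool) :
  PT s -> PT (fun p : E * A => f p.1 p.2) -> PT (fun e => all (f e) (s e)).
Proof.
move=> hs hf.
apply: (PT_foldr_add (z := fun=> true) (f := fun e a b => f e a && b)) => //; first by pt.
  by apply: (PT_comp2 (h := andb)) PT_andb _ _; [apply: (PT_comp2 (h := f)) => //; pt | pt].
by exists (fun=> 3) => [|e a b]; [polyfun_tac | apply: leq_trans (sz_bool _) (leq_addl _ _)].
Qed.

Lemma PT_has (E A : encType) (s : E -> seq A) (f : E -> A -> bool) :
  PT s -> PT (fun p : E * A => f p.1 p.2) -> PT (fun e => has (f e) (s e)).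
Proof.
move=> hs hf.
apply: (PT_foldr_add (z := fun=> false) (f := fun e a b => f e a || b)) => //; first by pt.
  by apply: (PT_comp2 (h := orb)) PT_orb _ _; [apply: (PT_comp2 (h := f)) => //; pt | pt].
by exists (fun=> 3) => [|e a b]; [polyfun_tac | apply: leq_trans (sz_bool _) (leq_addl _ _)].
Qed.

Lemma PT_iter (E A : encType) (n : E -> nat) (z : E -> A) (f : E -> A -> A) :
  PT n -> PT z -> PT (fun p : E * A => f p.1 p.2) ->
  (exists2 q, polyfun q & forall e a, sz (f e a) <= sz a + q (sz e)) ->
  PT (fun e => iter (n e) (f e) (z e)).
Proof.
move=> hn hz hf [q pq hq].
apply: (@PT_ext _ _ (fun e => foldr (fun=> f e) (z e) (nseq (n e) tt))).
  by move=> e; elim: (n e) => //= k ->.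
apply: (PT_foldr_add (f := fun e _ b => f e b)) => //; first exact: PT_nseq_unit.
  by apply: (PT_comp2 (h := f)) => //; pt.
exists q => // e a b; apply: leq_trans (hq _ _) _; rewrite leq_add2l.
by apply: polyfun_mono => //; lia.
Qed.

Ltac pt_fold ::= pt_eta; lazymatch goal with
  | |- PT (fun e => map (@?f e) (@?s e)) => apply: (@PT_map _ _ _ s f)
  | |- PT (fun e => filter (@?f e) (@?s e)) => apply: (@PT_filter _ _ s f)
  | |- PT (fun e => all (@?f e) (@?s e)) => apply: (@PT_all _ _ s f)
  | |- PT (fun e => has (@?f e) (@?s e)) => apply: (@PT_has _ _ s f)
  end.

Lemma PT_cat (A : encType) : PT (fun p : seq A * seq A => p.1 ++ p.2).
Proof.
apply: (@PT_ext _ _ (fun p : seq A * seq A => foldr cons p.2 p.1)).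
  by case=> s t; elim: s => //= a l ->.
apply: (PT_foldr_add (f := fun _ => cons)); try by pt.
by exists (fun n => n + 1); [polyfun_tac | move=> e a b; rewrite sz_cons; lia].
Qed.
#[global] Hint Resolve PT_cat : pt.

Lemma PT_flatten (A : encType) : PT (@flatten A).
Proof.
apply: (PT_foldr_add (s := id) (z := fun=> [::]) (f := fun _ => cat)); try by pt.
exists (fun n => n); first by polyfun_tac.
by move=> e a b; have := sz_cat a b; lia.
Qed.

Lemma PT_size (A : encType) : PT (fun s : seq A => size s).
Proof.
apply: (@PT_ext _ _ (fun s : seq A => foldr (fun _ n => n.+1) 0 s)).
  by elim=> //= a s ->.
apply: (PT_foldr_add (s := id) (z := fun=> 0) (f := fun _ _ n => n.+1)); try by pt.
by exists (fun=> 2); [polyfun_tac | move=> e a b; rewrite sz_S; lia].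
Qed.
#[global] Hint Resolve PT_flatten PT_size : pt.

Lemma PT_addn : PT (fun p : nat * nat => p.1 + p.2).
Proof.
apply: (@PT_ext _ _ (fun p : nat * nat => iter p.1 S p.2)).
  by case=> m n; elim: m => //= m <-.
apply: (PT_iter (f := fun _ => S)); try by pt.
by exists (fun=> 2); [polyfun_tac | move=> e a; rewrite sz_S; lia].
Qed.
#[global] Hint Resolve PT_addn : pt.

Lemma sz_addn m n : sz (m + n) <= sz m + sz n.
Proof. by elim: m => [|m IH]; rewrite ?(addSn m n) ?add0n ?sz_S; lia. Qed.

Lemma PT_muln : PT (fun p : nat * nat => p.1 * p.2).
Proof.
apply: (@PT_ext _ _ (fun p : nat * nat => iter p.1 (addn p.2) 0)).
  by case=> m n; elim: m => //= m <-; rewrite mulSn.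
apply: (PT_iter (z := fun=> 0) (f := fun p : nat * nat => addn p.2)); try by pt.
exists (fun n => n) => [|[m n] a]; first by polyfun_tac.
by rewrite sz_pair /=; have := sz_addn n a; lia.
Qed.

Lemma sz_pred n : sz n.-1 <= sz n.
Proof. by case: n => // n; rewrite sz_S /=; lia. Qed.

Lemma PT_subn : PT (fun p : nat * nat => p.1 - p.2).
Proof.
apply: (@PT_ext _ _ (fun p : nat * nat => iter p.2 predn p.1)).
  by case=> m n /=; elim: n => [|n IH] /=; rewrite ?subn0 // subnS IH.
apply: (PT_iter (f := fun _ => predn)); try by pt.
by exists (fun=> 0); [polyfun_tac | move=> e a; have := sz_pred a; lia].
Qed.
#[global] Hint Resolve PT_muln PT_subn : pt.

Lemma PT_leq : PT (fun p : nat * nat => p.1 <= p.2).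
Proof. by rewrite /leq; pt. Qed.
#[global] Hint Resolve PT_leq : pt.

Lemma PT_eqn : PT (fun p : nat * nat => p.1 == p.2).
Proof.
apply: (@PT_ext _ _ (fun p : nat * nat => (p.1 <= p.2) && (p.2 <= p.1))).
  by case=> m n; rewrite /= eqn_leq.
by pt.
Qed.
#[global] Hint Resolve PT_eqn : pt.

Lemma PT_nseq (A : encType) : PT (fun p : nat * A => nseq p.1 p.2).
Proof.
apply: (@PT_ext _ _ (fun p : nat * A => iter p.1 (cons p.2) [::])).
  by case=> n a; elim: n => //= n ->.
apply: (PT_iter (z := fun=> [::]) (f := fun p : nat * A => cons p.2)); try by pt.
by exists (fun n => n + 1); [polyfun_tac | move=> [m x] a; rewrite sz_cons sz_pair /=; lia].
Qed.
#[global] Hint Resolve PT_nseq : pt.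

Lemma PT_drop (A : encType) : PT (fun p : nat * seq A => drop p.1 p.2).
Proof.
apply: (@PT_ext _ _ (fun p : nat * seq A => iter p.1 behead p.2)).
  by case=> n; elim: n => [|n IH] s /=; rewrite ?drop0 // -iterS iterSr -IH; case: s.
apply: (PT_iter (f := fun _ => @behead A)); try by pt.
by exists (fun=> 0) => [|e a]; [polyfun_tac | case: a => // a s; rewrite sz_cons /=; lia].
Qed.
#[global] Hint Resolve PT_drop : pt.

Lemma PT_nth (A : encType) : PT (fun p : A * seq A * nat => nth p.1.1 p.1.2 p.2).
Proof.
apply: (@PT_ext _ _ (fun p : A * seq A * nat => head p.1.1 (drop p.2 p.1.2))).
  by case=> [[a s] n]; rewrite /= -nth0 nth_drop addn0.
by pt.
Qed.
#[global] Hint Resolve PT_nth : pt.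

Lemma sz_leq m n : m <= n -> sz m <= sz n.
Proof.
by move=> /subnK <-; elim: (_ - _) => // k IH; rewrite (addSn k m) sz_S; lia.
Qed.

Lemma PT_iota : PT (fun n => iota 0 n).
Proof.
(* The length of the list built so far determines the next entry, so the iteration needs no counter
   of its own. *)
apply: (@PT_ext _ _ (fun n => iter n (fun s => n - (size s).+1 :: s) [::])).
  move=> n; suff: forall k, k <= n -> iota (n - k) k = iter k (fun s => n - (size s).+1 :: s) [::].
    by move=> /(_ n (leqnn n)); rewrite subnn.
  elim=> //= k IH lt; rewrite -IH 1?ltnW //= size_iota; congr cons.
  by rewrite -subSn // subSS.
apply: (PT_iter (n := id) (z := fun=> [::]) (f := fun n s => n - (size s).+1 :: s)); try by pt.
exists (fun n => n + 1); first by polyfun_tac.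
move=> e a; rewrite sz_cons; move: (sz_leq (leq_subr (size a).+1 e)).
by move: (sz _) (sz a) (sz e) => x y z; lia.
Qed.
#[global] Hint Resolve PT_iota : pt.

Lemma PT_eqw : PT (fun p : seq bool * seq bool => p.1 == p.2).
Proof.
(* The state records whether the words agree so far and what is left of the second one. *)
pose f (st : bool * seq bool) a := (st.1 && (~~ nilp st.2 && (head a st.2 == a)), behead st.2).
apply: (@PT_ext _ _ (fun p : seq bool * seq bool =>
    let st := foldl f (true, p.2) p.1 in st.1 && nilp st.2)).
  case=> s t /=; rewrite -[s == t]andTb; elim: s t true => [|a s IH] [|b t] o //=.
    by rewrite -IH /f /= !andbF.
  by rewrite eqseq_cons -IH /f /= eq_sym andbA.
have h : PT (fun p : seq bool * seq bool => foldl f (true, p.2) p.1).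
  apply: (PT_foldl_add (f := fun=> f)); try by (rewrite /f; pt).
  exists (fun=> 3) => [|e [o r] a]; first by polyfun_tac.
  rewrite /f !sz_pair /=; have := sz_bool (o && (~~ nilp r && (head a r == a))).
  have : 0 < sz o by exact: sz_gt0.
  by case: r => [|b r] /=; rewrite ?sz_cons; lia.
by pt.
Qed.
#[global] Hint Resolve PT_eqw : pt.

Lemma PT_memw : PT (fun p : seq bool * seq (seq bool) => p.1 \in p.2).
Proof.
apply: (@PT_ext _ _ (fun p : seq bool * seq (seq bool) => has (fun x => x == p.1) p.2)).
  by case=> x s /=; rewrite -has_pred1.
by pt.
Qed.

Lemma PT_inw (E : encType) (x : E -> seq bool) (s : E -> seq (seq bool)) :
  PT x -> PT s -> PT (fun e => x e \in s e).
Proof. by move=> hx hs; apply: (PT_comp2 (h := fun x (s : seq (seq bool)) => x \in s)) PT_memw _ _. Qed.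

Ltac pt ::= repeat first [solve [simple apply PT_const | refine (PT_const _)] | pt_side | pt_step | pt_fold | pt_app
  | apply: PT_inw | apply: PT_if].

Lemma PT_undupw : PT (fun s : seq (seq bool) => undup s).
Proof.
apply: (@PT_ext _ _ (fun s : seq (seq bool) =>
    foldr (fun x r => if x \in r then r else x :: r) [::] s)).
  by elim=> //= x s <-; rewrite mem_undup.
apply: (PT_foldr_add (s := id) (z := fun=> [::])
  (f := fun _ (x : seq bool) (r : seq (seq bool)) => if x \in r then r else x :: r)); try by pt.
by exists (fun n => n + 1); [polyfun_tac | move=> e a b; case: ifP; rewrite ?sz_cons; lia].
Qed.

Lemma PT_uniqw : PT (fun s : seq (seq bool) => uniq s).
Proof.
apply: (@PT_ext _ _ (fun s : seq (seq bool) => size (undup s) == size s)).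
  by move=> s; rewrite eqn_leq size_undup /= leqNgt ltn_size_undup negbK.
by have h := PT_undupw; pt.
Qed.
#[global] Hint Resolve PT_undupw PT_uniqw : pt.

Lemma PT_delimit : PT delimit.
Proof. by rewrite /delimit; pt. Qed.
#[global] Hint Resolve PT_delimit : pt.

(** * From words to trees and back *)

Definition Load := While R0 isSome
  (Tst R0 true (Seq (Pop R0) (Push R1 true)) (Seq (Pop R0) (Push R1 false))).

(** In the code of a word, a leading bit [true] is spelled 1100 and a leading [false] is spelled 10.
    The symbols are pushed last one first, and [R1] delivers the word backwards. [Shrink] undoes
    this. *)
Definition Grow := While R1 isSome
  (Tst R1 true
    (Seq (Pop R1) (Seq (Push R0 false) (Seq (Push R0 false) (Seq (Push R0 true) (Push R0 true)))))
    (Seq (Pop R1) (Seq (Push R0 false) (Push R0 true)))).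

Definition Shrink := While R0 (pred1 (Some true))
  (Seq (Pop R0) (Tst R0 true
    (Seq (Pop R0) (Seq (Pop R0) (Seq (Pop R0) (Push R1 true))))
    (Seq (Pop R0) (Push R1 false)))).

Lemma run_load w v : run Load (w, v, [::], [::]) ([::], catrev w v, [::], [::]) (7 * size w + 1).
Proof.
elim: w v => [|b w IH] v /=; first exact: RunDone.
apply: (run_le (t := (2 + 3 + (7 * size w + 1)).+2)); first lia.
apply: RunDo (IH (b :: v)) => //.
case: b; [apply: (@RunThen _ _ _ _ _ _ 3) => // | apply: (@RunElse _ _ _ _ _ _ 3) => //];
  by apply: (@RunSeq _ _ _ _ _ 1 2); repeat run_step.
Qed.

Lemma run_grow (v w : seq bool) :
  run Grow (code (enc w), v, [::], [::]) (code (enc (catrev v w)), [::], [::], [::])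
    (13 * size v + 1).
Proof.
elim: v w => [|b v IH] w /=; first exact: RunDone.
apply: (run_le (t := (2 + 9 + (13 * size v + 1)).+2)); first lia.
apply: RunDo (IH (b :: w)) => //.
case: b; [apply: (@RunThen _ _ _ _ _ _ 9) => // | apply: (@RunElse _ _ _ _ _ _ 9) => //].
  by apply: (@RunSeq _ _ _ _ _ 1 (2 + (2 + (2 + 2)))); repeat run_step.
by apply: run_le (_ : 1 + (2 + 2) <= 9) _ => //; repeat run_step.
Qed.

Lemma run_shrink (w v : seq bool) :
  run Shrink (code (enc w), v, [::], [::]) ([:: false], catrev w v, [::], [::]) (10 * size w + 1).
Proof.
elim: w v => [|b w IH] v /=; first exact: RunDone.
apply: (run_le (t := (1 + (2 + 5) + (10 * size w + 1)).+2)); first lia.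
apply: RunDo (IH (b :: v)) => //.
apply: RunSeq; first by run_step.
case: b; [apply: (@RunThen _ _ _ _ _ _ 5) => // | apply: (@RunElse _ _ _ _ _ _ 5) => //].
  by apply: (@RunSeq _ _ _ _ _ 1 (1 + (1 + 2))); repeat run_step.
by apply: run_le (_ : 1 + 2 <= 5) _ => //; repeat run_step.
Qed.

Definition Wrap c :=
  Seq Load (Seq (Push R0 false) (Seq Grow (Seq c (Seq Shrink (Seq (Pop R0) (Unload R1)))))).

Lemma tree_size_word (w : seq bool) : tree_size (enc w) <= 4 * size w + 1.
Proof.
rewrite -/(sz w); elim: w => // b w IH; rewrite sz_cons [size _]/=; have := sz_bool b; lia.
Qed.

Lemma cells_main w : cells (main w) = size w.
Proof. by rewrite /cells /main /= !addn0. Qed.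

Lemma run_wrap f c g : polyfun g ->
  (forall (w : seq bool) r,
    run c (main (code (enc w) ++ r)) (main (code (enc (f w : seq bool)) ++ r)) (g (tree_size (enc w)))) ->
  exists2 h, polyfun h & forall w, run (Wrap c) (main w) (main (f w)) (h (size w)).
Proof.
move=> pg hc.
pose k n := g (4 * n + 1).
have pk : polyfun k.
  by apply: (polyfun_comp (g := g) (h := fun n => 4 * n + 1)) => //; polyfun_tac.
exists (fun n => 7 * n + 1 + (2 + (13 * n + 1 + (k n + (10 * (4 * n + 1 + k n) + 1 +
   (1 + (7 * (4 * n + 1 + k n) + 1))))))); first by polyfun_tac.
move=> w; have hw := tree_size_word w.
have lk : g (tree_size (enc w)) <= k (size w) by apply: polyfun_mono.
have ls : size (f w) <= 4 * size w + 1 + k (size w).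
  have := run_cells (hc w [::]); rewrite !cells_main !cats0 -!/(tree_size _).
  have hs : size (f w) <= tree_size (enc (f w)) := size_le_sz (f w : seq enc_bool).
  lia.
apply: RunSeq (run_load _ _) _; apply: RunSeq; first by run_step.
apply: RunSeq; first by apply: run_le (run_grow (catrev w [::]) [::]); rewrite size_rev.
rewrite catrev_catrev cats0; apply: RunSeq.
  by have := hc w [::]; rewrite !cats0; apply: run_le.
apply: RunSeq; first by apply: run_le (run_shrink _ _); lia.
apply: RunSeq; first by run_step.
have := run_unload1 (catrev (f w) [::]) [::] [::] [::].
by rewrite catrev_catrev cats0; apply: run_le; rewrite size_rev; lia.
Qed.

Lemma leading_bits_stack M (s : seq bool) m :
  @leading_bits M ([seq Some (inl b) | b <- s] ++ nseq m None) = s.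
Proof. by elim: s => [|b s /= ->] //; case: m. Qed.

Theorem poly_time_of_PT (f : seq bool -> seq bool) : PT f -> poly_time f.
Proof.
case=> c [g [pg hc]]; have [h [p hp] hrun] := run_wrap pg hc.
pose P := compile (Wrap c) 0.
exists (prog_machine P), p => w.
have hat : code_at P 0 P by exists [::] => //; exists [::]; rewrite cats0.
have h0 : at_state (tm_init (prog_machine P) w) 0 (main w).
  split=> // i; rewrite /tm_init /= ffunE; case: i; (split=> //; exists 0; rewrite //= cats0 //).
have [u le [h1 h2]] := compile_correct (hrun w) hat h0.
have hu : (tm_run (prog_machine P) w u).1 = tm_halt (prog_machine P) by apply/val_inj; exact: h1.
(* The configuration is inspected at exactly the polynomial time, while the program stops at some
   earlier [u]; a halted machine no longer changes. *)
have -> : tm_run (prog_machine P) w p.[size w]%R = tm_run (prog_machine P) w u.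
  rewrite -hp -(subnK le) /tm_run iterD -/(tm_run _ w u).
  by elim: (_ - _) => // k; rewrite iterS => ->; rewrite /tm_step hu eqxx.
split=> //; rewrite /tm_output; case: (h2 R0) => _ [m].
by rewrite /= (_ : Ordinal _ = ord0) /=; [move=> ->; exact: leading_bits_stack | apply/val_inj].
Qed.

(** * Winning play on isolated towers *)

Notation plays := (Relation_Operators.clos_refl_trans_1n board legal_move).

Lemma count_move (B : board) (P : pred (position * tile)) a b :
  uniq B -> a \in B -> b \in B -> a != b -> P a = P b ->
  count P B = count P [seq e <- B | (e != a) && (e != b)] + (P a).*2.
Proof.
move=> uB ha hb nab Pab.
have pB : perm_eq B [:: a, b & [seq e <- B | (e != a) && (e != b)]].
  apply: uniq_perm => //=.
    by rewrite filter_uniq // inE !mem_filter !eqxx /= andbF orbF nab.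
  move=> e; rewrite !inE mem_filter; case: eqP => [->|_] //=; by case: eqP => [->|_].
by rewrite (permP pB) -[LHS]/(P a + (P b + _)) -Pab addnA addnn addnC.
Qed.

Lemma plays_even (B : board) p : plays B [::] -> uniq B ->
  ~~ odd (count (fun t => t.1 == p) (tiles B)).
Proof.
move eN: [::] => N h; elim: h eN => [_ <- //|{}B B' B'' [a [b [[ha hb nab] [hm _ _ ->]]]] _ IH eN uB].
rewrite count_map (@count_move _ _ a b) //=; last by rewrite (eqP hm).
by rewrite oddD odd_double addbF -count_map; exact: IH eN (filter_uniq _ uB).
Qed.

Section Towers.
Variables (T : eqType) (ent : T -> position * tile).

Definition above (t' t : T) : bool :=
  (ent t').1 == ((ent t).1.1.1, (ent t).1.1.2, (ent t).1.2.+1).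

(** Row neighbours are not mentioned: winning a board implies such a ranking in general, and the
    converse is proved where all positions have [j = 0], so that a tile can be blocked only from
    above. *)
Definition pairing (L : seq T) (mate : T -> T) (rank : T -> nat) : Prop :=
  (forall t, t \in L -> [/\ mate t \in L, mate t != t, mate (mate t) = t,
     matching (ent t).2 (ent (mate t)).2 & rank (mate t) = rank t]) /\
  (forall t t', t \in L -> t' \in L -> above t' t -> rank t' < rank t).

Lemma hidden_above (L : seq T) t : hidden (positions (map ent L)) (ent t).1 = has (above^~ t) L.
Proof.
case E: (ent t).1 => [[i j] k]; rewrite /hidden /positions /unzip1 -map_comp.
apply/mapP/hasP => -[t' ht' h]; exists t' => //.
  by rewrite /above E -[(ent t').1]h.
by move: h; rewrite /above E => /eqP.
Qed.

Lemma mem_positions (L : seq T) t : t \in L -> (ent t).1 \in positions (map ent L).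
Proof. by move=> h; apply/map_f/map_f. Qed.

Lemma available_hidden C x : available C x -> ~~ hidden C x.
Proof. by case: x => [[i j] k] /and3P[]. Qed.

(** Induction on the play: the first pair gets rank 0 and all later ranks go up by one. Nothing lies
    above a tile of the first pair, because both are available. *)
Lemma pairing_of_plays (L : seq T) : uniq L -> {in L &, injective ent} ->
  plays (map ent L) [::] -> exists mate rank, pairing L mate rank.
Proof.
move eB: (map ent L) => B; move eN: [::] => N uL inj h.
elim: h L eN eB uL inj => {B N} [B L <-|B B' B'' hm _ IH L eN eB uL inj].
  by case: L => // _ _ _; exists id, (fun=> 0); split.
case: hm => a' [b' [[]]]; rewrite -eB => /mapP[a ha ->{a'}] /mapP[b hb ->{b'}].
rewrite (inj_in_eq inj) // => nab [hab fa fb eB'].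
have {}eB' : map ent [seq t <- L | (t != a) && (t != b)] = B'.
  rewrite eB' filter_map; congr map; apply: eq_in_filter => t ht /=.
  by rewrite !(inj_in_eq inj).
have [||mate [rank [h1 h2]]] := IH _ eN eB'; first exact: filter_uniq.
  by move=> t t'; rewrite !mem_filter => /andP[_ ?] /andP[_ ?]; exact: inj.
have top t t' : t \in L -> t' \in L -> above t' t -> (t != a) && (t != b).
  move=> ht ht' up; apply/andP; split; apply/eqP => et; subst t.
    by have := available_hidden fa; rewrite hidden_above; case/hasP; exists t'.
  by have := available_hidden fb; rewrite hidden_above; case/hasP; exists t'.
exists (fun t => if t == a then b else if t == b then a else mate t).
exists (fun t => if (t != a) && (t != b) then (rank t).+1 else 0); split.
  move=> t ht; case: (eqVneq t a) => [->|na] /=.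
    rewrite [b == a]eq_sym (negbTE nab) eqxx /=.
    by split=> //; rewrite 1?eq_sym //= andbF.
  case: (eqVneq t b) => [->|nb] /=; first by rewrite eqxx /= nab; split=> //; rewrite /matching eq_sym.
  have /h1[] : t \in [seq t <- L | (t != a) && (t != b)] by rewrite mem_filter na nb.
  rewrite mem_filter => /andP[/andP[ma mb] hmt] h3 h4 h5 h6.
  by rewrite (negbTE ma) (negbTE mb) /= h6.
move=> t t' ht ht' up; have lt := top _ _ ht ht' up; rewrite lt.
case: ifP => // lt'; rewrite ltnS; apply: h2 => //; by rewrite mem_filter ?lt ?lt'.
Qed.

Lemma plays_of_pairing (L : seq T) mate rank :
  uniq L -> {in L &, injective (fun t => (ent t).1)} ->
  (forall t, t \in L -> (ent t).1.1.2 = 0) -> pairing L mate rank ->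
  plays (map ent L) [::].
Proof.
move: {2}(size L) (leqnn (size L)) => n.
elim: n L => [|n IH] L; first by case: L => // *; apply: Relation_Operators.rt1n_refl.
case E: (has predT L); last first.
  by case: L E => // *; apply: Relation_Operators.rt1n_refl.
case/hasP: E => t0 ht0 _ sL uL inj j0 [h1 h2].
have [a ha mina] : exists2 a, a \in L & forall t, t \in L -> rank a <= rank t.
  have ex : exists m, has (fun t => rank t == m) L by exists (rank t0); apply/hasP; exists t0.
  case: (ex_minnP ex) => m /hasP[a ha /eqP <-] hm; exists a => // t ht.
  by apply: hm; apply/hasP; exists t.
have [hb nb inv mat rk] := h1 a ha; set b := mate a in hb nb inv mat rk.
have free t : t \in L -> rank t = rank a -> available (positions (map ent L)) (ent t).1.
  move=> ht rt; have hid : ~~ hidden (positions (map ent L)) (ent t).1.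
    rewrite hidden_above; apply/hasP => -[t' ht' up].
    by have := h2 _ _ ht ht' up; have := mina _ ht'; rewrite rt; lia.
  have := mem_positions ht; have := j0 _ ht; move: hid.
  by case: (ent t).1 => [[i j] k] hid /= ej m; subst j; rewrite /available m hid.
have einj : {in L &, injective ent} by move=> t t' ht ht' e; apply: inj => //; rewrite e.
apply: (Relation_Operators.rt1n_trans _ _ _ (map ent [seq t <- L | (t != a) && (t != b)])).
  exists (ent a), (ent b); split; split; rewrite ?map_f ?free ?(inj_in_eq einj) // 1?eq_sym //.
  rewrite filter_map; congr map; apply: eq_in_filter => t ht /=.
  by rewrite !(inj_in_eq einj).
have sub t : t \in [seq t <- L | (t != a) && (t != b)] -> t \in L.
  by rewrite mem_filter => /andP[].
apply: IH.
- have : size [seq t <- L | (t != a) && (t != b)] < size L; last by lia.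
  rewrite size_filter -(count_predC (fun t => (t != a) && (t != b)) L) -{1}[count _ _]addn0 ltn_add2l.
  by rewrite -has_count; apply/hasP; exists a => //=; rewrite eqxx.
- exact: filter_uniq.
- by move=> t t' /sub ht /sub ht'; apply: inj.
- by move=> t /sub; apply: j0.
split; last by move=> t t' /sub ht /sub ht'; apply: h2.
move=> t; rewrite mem_filter => /andP[/andP[na nb'] ht].
have [m1 m2 m3 m4 m5] := h1 t ht; split=> //; rewrite mem_filter m1 andbT.
apply/andP; split; apply/eqP => e.
  by move/negP: nb'; apply; rewrite -m3 e.
by move/negP: na; apply; rewrite -m3 e inv.
Qed.

End Towers.

(** * Boards given as lists of towers *)

Section Stacks.
Variables (T : eqType) (col idn : T -> nat).
Hypothesis idn_inj : injective idn.

Fixpoint tower (n : nat) (s : seq T) : board :=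
  if s is t :: s' then ((n, 0, size s'), (col t, idn t)) :: tower n s' else [::].

(** The name of the top tile serves as the [i] coordinate. Since tiles have distinct names, nonempty
    towers get distinct places. *)
Definition base (s : seq T) : nat := if s is t :: _ then idn t else 0.

Definition towers (S : seq (seq T)) : board := flatten [seq tower (base s) s | s <- S].

Definition stack_pairing (S : seq (seq T)) (mate : T -> T) (rank : T -> nat) : Prop :=
  (forall t, t \in flatten S -> [/\ mate t \in flatten S, mate t != t, mate (mate t) = t,
     col t = col (mate t) & rank (mate t) = rank t]) /\
  (forall s, s \in S -> sorted (fun t' t => rank t' < rank t) s).

Variable S : seq (seq T).
Hypothesis uS : uniq (flatten S).

Definition home (t : T) : seq T := nth [::] S (find (fun s => t \in s) S).

Definition stack_ent (t : T) : position * tile :=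
  ((base (home t), 0, size (home t) - (index t (home t)).+1), (col t, idn t)).

Lemma home_eq s t : s \in S -> t \in s -> home t = s.
Proof.
rewrite /home; elim: S uS => //= s0 S0 IH; rewrite cat_uniq => /and3P[u0 d0 u1].
rewrite inE => /orP[/eqP->|hs] ht; first by rewrite ht.
case: ifP => [h|_] /=; last exact: IH.
by case/hasP: d0; exists t => //; apply/flattenP; exists s.
Qed.

Lemma home_mem t : t \in flatten S -> home t \in S /\ t \in home t.
Proof. by case/flattenP => s hs ht; rewrite (home_eq hs ht). Qed.

Lemma uniq_stack s : s \in S -> uniq s.
Proof.
elim: S uS => //= s0 S0 IH; rewrite cat_uniq => /and3P[u0 _ u1].
by rewrite inE => /orP[/eqP->|] //; apply: IH.
Qed.

Lemma tower_ent s : s \in S -> tower (base s) s = map stack_ent s.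
Proof.
move=> hs; have us := uniq_stack hs.
have h : forall s1 s2, s = s1 ++ s2 -> tower (base s) s2 = map stack_ent s2.
  move=> s1 s2; elim: s2 s1 => //= t s2 IH s1 e; congr cons; last first.
    by apply: (IH (rcons s1 t)); rewrite cat_rcons.
  rewrite /stack_ent (@home_eq s) //; last by rewrite e mem_cat mem_head orbT.
  congr (_, _, _, _); rewrite {1 2}e size_cat index_cat /= eqxx addn0.
  case: ifP => [h|_]; last by lia.
  by move: us; rewrite e cat_uniq /= => /and3P[_ /norP[/negP]].
exact: (h [::]).
Qed.

Lemma towersE : towers S = map stack_ent (flatten S).
Proof.
rewrite map_flatten; congr flatten; apply/eq_in_map => s hs; exact: tower_ent.
Qed.

Lemma base_inj s s' : s \in S -> s' \in S -> s != [::] -> s' != [::] -> base s = base s' -> s = s'.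
Proof.
case: s => // t s hs; case: s' => // t' s' hs' _ _ /idn_inj e; subst t'.
by rewrite -(home_eq hs (mem_head _ _)) -(home_eq hs' (mem_head _ _)).
Qed.

Lemma stack_ent_base t t' : t \in flatten S -> t' \in flatten S ->
  (stack_ent t).1.1.1 = (stack_ent t').1.1.1 -> home t = home t'.
Proof.
move=> /home_mem[h1 m1] /home_mem[h2 m2] /= e; apply: base_inj e => //.
  by case: (home t) m1. by case: (home t') m2.
Qed.

Lemma stack_ent_inj : {in flatten S &, injective (fun t => (stack_ent t).1)}.
Proof.
move=> t t' ht ht' [e1 e2]; have eh := stack_ent_base ht ht' e1.
have [_ m1] := home_mem ht; have [_ m2] := home_mem ht'; move: e2; rewrite eh in m1 *.
have l1 : index t (home t') < size (home t') by rewrite index_mem.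
have l2 : index t' (home t') < size (home t') by rewrite index_mem.
move=> e; have ei : index t (home t') = index t' (home t') by lia.
by have := nth_index t m1; rewrite ei nth_index.
Qed.

Lemma above_succ t' t : t' \in flatten S -> t \in flatten S -> above stack_ent t' t ->
  home t' = home t /\ index t (home t) = (index t' (home t)).+1.
Proof.
move=> ht' ht /eqP /=; case=> e1 e2.
have eh := stack_ent_base ht' ht e1; split=> //; move: e2; rewrite eh.
have [_ m1] := home_mem ht; have [_ m2] := home_mem ht'; rewrite eh in m2.
have l1 : index t (home t) < size (home t) by rewrite index_mem.
have l2 : index t' (home t) < size (home t) by rewrite index_mem.
lia.
Qed.

Lemma above_nth s i x : s \in S -> i.+1 < size s -> above stack_ent (nth x s i) (nth x s i.+1).
Proof.
move=> hs lt; have us := uniq_stack hs.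
rewrite /above /stack_ent /= !(@home_eq s) ?mem_nth // 1?ltnW //.
rewrite !index_uniq // 1?ltnW //; apply/eqP; congr (_, _, _); lia.
Qed.

Lemma plays_towers : plays (towers S) [::] <-> exists mate rank, stack_pairing S mate rank.
Proof.
have inj : {in flatten S &, injective stack_ent}.
  by move=> t t' ht ht' e; apply: stack_ent_inj => //; rewrite e.
rewrite towersE; split=> [/(pairing_of_plays uS inj)|] [mate [rank [h1 h2]]].
  exists mate, rank; split=> [t /h1[? ? ? /eqP ? ?]|s hs]; first by split.
  case: s hs => // x s hs; apply/(sortedP x) => i lt.
  apply: h2; last exact: above_nth.
    by apply/flattenP; exists (x :: s) => //; apply: mem_nth.
  by apply/flattenP; exists (x :: s) => //; apply: mem_nth; apply: ltnW.
apply: (plays_of_pairing (mate := mate) (rank := rank)) => //; first exact: stack_ent_inj.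
split=> [t /h1[? ? ? e ?]|t t' ht ht' up]; first by split=> //; rewrite /matching /= -e.
have [eh ei] := above_succ ht' ht up.
have [hs m] := home_mem ht; have [_ m'] := home_mem ht'; rewrite eh in m'.
have /(sortedP t)/(_ (index t' (home t))) := h2 _ hs.
by rewrite -ei index_mem !nth_index // => /(_ m).
Qed.

(** The winning play is assumed because it yields the evenness of the tile sets. *)
Lemma towers_arrangement N : (forall t, t \in flatten S -> col t < N) ->
  plays (towers S) [::] -> is_arrangement (Arrangement N (towers S)).
Proof.
move=> hN h; have ut : uniq (tiles (towers S)).
  rewrite towersE /tiles /unzip2 -map_comp map_inj_in_uniq //.
  by move=> t t' _ _ [_] /idn_inj.
split=> //=.
- rewrite towersE; split.
  + rewrite /positions /unzip1 -map_comp map_inj_in_uniq //; exact: stack_ent_inj.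
  + move=> i j j' j'' k; rewrite /positions /unzip1 -map_comp.
    by case/mapP => t ht [_ -> _] /mapP[t' ht' [_ -> _]].
  move=> i j k; rewrite /positions /unzip1 -map_comp => /mapP[t ht [-> -> ->]] gt0.
  have [hs m] := home_mem ht; have us := uniq_stack hs.
  have lt : (index t (home t)).+1 < size (home t) by lia.
  apply/mapP; exists (nth t (home t) (index t (home t)).+1).
    by apply/flattenP; exists (home t) => //; apply: mem_nth.
  have eh : home (nth t (home t) (index t (home t)).+1) = home t.
    by apply: home_eq => //; apply: mem_nth.
  by rewrite /= eh index_uniq //; congr (_, _, _); lia.
- by rewrite towersE /tiles /unzip2 -map_comp => _ /mapP[t /hN lt ->].
by move=> p _; apply: plays_even => //; apply: (map_uniq ut).
Qed.

End Stacks.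

(** * From formulas in conjunctive normal form to towers *)

Definition literal := (seq bool * bool)%type.
Definition cnf := seq (seq literal).

Definition satisfies (v : seq bool -> bool) (F : cnf) : bool :=
  all (has (fun l : literal => v l.1 == l.2)) F.

Lemma pairwise_flatten_map (A B : Type) (r : rel B) (f : A -> seq B) s :
  pairwise (fun x y => allrel r (f x) (f y)) s -> all (fun x => pairwise r (f x)) s ->
  pairwise r (flatten (map f s)).
Proof.
elim: s => //= x s IH /andP[h1 h2] /andP[h3 h4].
rewrite pairwise_cat h3 IH //= andbT.
elim: s h1 {h2 h4 IH} => [|y s IH] /=; first by rewrite allrel0r.
by case/andP => h /IH; rewrite allrel_catr h.
Qed.

(* The four fields are a kind, a variable, a clause index and an index within
   the clause; fields that a kind does not use are [0] or [[::]], and for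
   [Lit] the third field is the sign of the literal. *)
Definition gtile := (nat * seq bool * nat * nat)%type.

(** In the notation X, P, C, Y of the overview: [Vtop], [Vmid], [Vbot] form the tower X P X; [Lit]
    is the X on a literal tower, whose other tiles are the [Fan]s; each [Wire] covers a [Token];
    [Need] over [Done] is C Y; the main tower holds the Y ([Mdone]), the P ([Mvar]) and partners for
    leftover tokens ([Mrest]). *)
Definition Vtop x : gtile := (0, x, 0, 0).
Definition Vmid x : gtile := (1, x, 0, 0).
Definition Vbot x : gtile := (2, x, 0, 0).
Definition Lit x (b : bool) : gtile := (3, x, nat_of_bool b, 0).
Definition Fan c i : gtile := (4, [::], c, i).
Definition Wire c i : gtile := (5, [::], c, i).
Definition Token c i : gtile := (6, [::], c, i).
Definition Need c : gtile := (7, [::], c, 0).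
Definition Done c : gtile := (8, [::], c, 0).
Definition Mdone c : gtile := (9, [::], c, 0).
Definition Mvar x : gtile := (10, x, 0, 0).
Definition Mrest c j : gtile := (11, [::], c, j).

(** Most colours have two tiles, which forces the mates: [Vmid] with [Mvar], [Fan] with [Wire],
    [Done] with [Mdone]. There is a choice only among the four tiles of a variable and among the
    tokens of a clause with their partners. *)
Definition color (t : gtile) : gtile :=
  let: (k, x, c, i) := t in
  match k with
  | 0 | 2 | 3 => (0, x, 0, 0)
  | 1 | 10 => (1, x, 0, 0)
  | 4 | 5 => (4, x, c, i)
  | 6 | 7 | 11 => (6, x, c, 0)
  | _ => (8, x, c, 0)
  end.

Section Formula.
Variable F : cnf.

Definition clause c := nth [::] F c.
Definition lit c i : literal := nth ([::], false) (clause c) i.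
Definition occs := [seq (c, i) | c <- iota 0 (size F), i <- iota 0 (size (clause c))].
Definition vars := undup [seq (lit p.1 p.2).1 | p <- occs].

Definition lit_stack x b :=
  Lit x b :: [seq Fan p.1 p.2 | p <- occs & ((lit p.1 p.2).1 == x) && ((lit p.1 p.2).2 == b)].

Definition var_stacks x := [:: [:: Vtop x; Vmid x; Vbot x]; lit_stack x true; lit_stack x false].

(** [Need] takes one token of its clause, hence the predecessor in the number of [Mrest] tiles. For
    an empty clause [Need] has no partner at all, in accordance with unsatisfiability. *)
Definition main_stack :=
  [seq Mdone c | c <- iota 0 (size F)] ++ [seq Mvar x | x <- vars] ++
  [seq Mrest c j | c <- iota 0 (size F), j <- iota 0 (size (clause c)).-1].

Definition stacks_of :=
  flatten [seq var_stacks x | x <- vars] ++ [seq [:: Wire p.1 p.2; Token p.1 p.2] | p <- occs] ++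
  [seq [:: Need c; Done c] | c <- iota 0 (size F)] ++ [:: main_stack].

Lemma mem_occs c i : ((c, i) \in occs) = (c < size F) && (i < size (clause c)).
Proof.
apply/allpairsPdep/andP => [[c' [i' [+ + [-> ->]]]]|[lc li]]; first by rewrite !mem_iota.
by exists c, i; rewrite !mem_iota.
Qed.

Lemma uniq_occs : uniq occs.
Proof.
by apply: allpairs_uniq_dep => [|c _|[? ?] [? ?] _ _ /= [-> ->]] //; exact: iota_uniq.
Qed.

Lemma mem_vars c i : (c, i) \in occs -> (lit c i).1 \in vars.
Proof. by move=> h; rewrite mem_undup; apply/mapP; exists (c, i). Qed.

(** Describes the tiles in use by their fields alone, so that questions about mates become case
    analyses on the kind. *)
Definition valid (t : gtile) : bool :=
  let: (k, x, c, i) := t in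
  match k with
  | 0 | 1 | 2 | 10 => [&& c == 0, i == 0 & x \in vars]
  | 3 => [&& c < 2, i == 0 & x \in vars]
  | 4 | 5 | 6 => (x == [::]) && ((c, i) \in occs)
  | 7 | 8 | 9 => [&& x == [::], i == 0 & c < size F]
  | 11 => [&& x == [::], c < size F & i < (size (clause c)).-1]
  | _ => false
  end.

Lemma mem_var_stacks x t : (t \in flatten (var_stacks x)) =
  [|| t == Vtop x, t == Vmid x, t == Vbot x, t == Lit x true, t == Lit x false |
      has (fun p => (t == Fan p.1 p.2) && ((lit p.1 p.2).1 == x)) occs].
Proof.
rewrite /= cats0 !inE !mem_cat !inE; do 4 congr (_ || _).
rewrite orbCA; congr (_ || _); apply/orP/hasP => [[] /mapP[p]|[p hp /andP[/eqP-> e]]].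
- by rewrite mem_filter => /andP[/andP[e _] hp] ->; exists p; rewrite ?eqxx.
- by rewrite mem_filter => /andP[/andP[e _] hp] ->; exists p; rewrite ?eqxx.
by case eb: (lit p.1 p.2).2; [left | right]; apply/mapP; exists p; rewrite // mem_filter eb e hp.
Qed.

Lemma mem_main t : (t \in main_stack) = (8 < t.1.1.1) && valid t.
Proof.
rewrite !mem_cat; apply/or3P/idP.
  case=> [/mapP[c]|/mapP[x hx ->]|/allpairsPdep[c [j [+ + ->]]]] /=.
  - by rewrite mem_iota /= => lt ->.
  - by rewrite hx.
  by rewrite !mem_iota /= => -> ->.
case: t => [[[k x] c] i]; do 9 (case: k => // k) => /=.
case: k => [|[|[|//]]] /=.
- case/and3P => /eqP -> /eqP -> lt; apply: Or31; apply: map_f; by rewrite mem_iota.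
- case/and3P => /eqP -> /eqP -> lt; apply: Or32; exact: map_f.
case/and3P => /eqP -> lc li; apply: Or33; apply/allpairsPdep; exists c, i.
by rewrite !mem_iota.
Qed.

(** The four groups of towers use the disjoint ranges 0 to 4, 5 to 6, 7 to 8 and 9 to 11 of kinds,
    so each group can be compared with [valid] on its own range. *)
Lemma mem_tiles t : (t \in flatten stacks_of) = valid t.
Proof.
have e : flatten [:: main_stack] = main_stack by rewrite /= cats0.
rewrite /stacks_of !flatten_cat {}e 3!mem_cat mem_main.
rewrite [X in [|| X, _, _ | _]](_ : _ = (t.1.1.1 < 5) && valid t).
  rewrite [X in [|| _, X, _ | _]](_ : _ = (4 < t.1.1.1 < 7) && valid t).
    rewrite [X in [|| _, _, X | _]](_ : _ = (6 < t.1.1.1 < 9) && valid t).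
      by case: t => [[[k x] c] i]; do 12 (case: k => [|k]; rewrite /= ?orbF //).
    apply/flattenP/idP => [[s /mapP[c]]|].
      by rewrite mem_iota => /= lt ->; rewrite !inE => /orP[] /eqP -> /=.
    case: t => [[[k x] c] i]; do 7 (case: k => // k).
    have h : c < size F -> [:: Need c; Done c] \in [seq [:: Need c; Done c] | c <- iota 0 (size F)].
      by move=> lt; apply/mapP; exists c; rewrite ?mem_iota.
    case: k => [|[|//]] /= /and3P[/eqP -> /eqP -> /h lt]; exists [:: Need c; Done c] => //;
      by rewrite !inE eqxx ?orbT.
  apply/flattenP/idP => [[s /mapP[[c i] hp ->]]|].
    by rewrite !inE => /orP[] /eqP -> /=; rewrite hp.
  case: t => [[[k x] c] i]; do 5 (case: k => // k).
  case: k => [|[|//]] /= /andP[/eqP -> hp]; exists [:: Wire c i; Token c i];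
    by rewrite ?inE ?eqxx ?orbT //; apply/mapP; exists (c, i).
have e : (t \in flatten (flatten [seq var_stacks x | x <- vars])) =
    has (fun x => t \in flatten (var_stacks x)) vars.
  elim: vars => // x s IH.
  rewrite -[flatten (map _ _)]/(var_stacks x ++ flatten [seq var_stacks x | x <- s]).
  by rewrite flatten_cat mem_cat IH.
rewrite {}e; apply/hasP/idP => [[x hx]|].
  rewrite mem_var_stacks; do 5 (case/orP => [/eqP->|]; first by rewrite /= hx).
  by case/hasP => -[c i] hp /andP[/eqP -> _] /=; rewrite hp.
case: t => [[[k x] c] i] /= /andP[lt hv].
exists (if k == 4 then (lit c i).1 else x).
  move: hv; case: k lt => [|[|[|[|[|//]]]]] _ /=; try by case/and3P.
  by case/andP => _ /mem_vars.
rewrite mem_var_stacks; move: hv.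
case: k lt => [|[|[|[|[|//]]]]] _ /=.
1-3: by case/and3P => /eqP-> /eqP-> _; rewrite eqxx ?orbT.
- by case/and3P; case: c => [|[|//]] _ /eqP-> _; rewrite eqxx ?orbT.
case/andP => /eqP-> hp; suff -> : has (fun p => ((4, [::], c, i) == Fan p.1 p.2) &&
  ((lit p.1 p.2).1 == (lit c i).1)) occs by rewrite ?orbT.
by apply/hasP; exists (c, i); rewrite //= !eqxx.
Qed.

End Formula.

Lemma uniq_flatten_map (A B : eqType) (f : A -> seq B) s : uniq s ->
  {in s, forall x, uniq (f x)} ->
  (forall x y b, x \in s -> y \in s -> b \in f x -> b \in f y -> x = y) ->
  uniq (flatten (map f s)).
Proof.
elim: s => //= x s IH /andP[nx us] hu hd; rewrite cat_uniq hu ?mem_head //= IH //.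
- rewrite andbT; apply/hasP => -[b /flattenP[_ /mapP[y hy ->] by_] bx].
  by move: nx; rewrite (hd x y b) ?hy ?mem_head // inE hy orbT.
- by move=> y hy; apply: hu; rewrite inE hy orbT.
- by move=> y z b hy hz; apply: hd; rewrite inE ?hy ?hz orbT.
Qed.

Section Uniq.
Variable F : cnf.
Notation vars := (vars F).
Notation occs := (occs F).

Definition fans x b := [seq Fan p.1 p.2 | p <- occs & ((lit F p.1 p.2).1 == x) && ((lit F p.1 p.2).2 == b)].

Lemma mem_fans t x b : t \in fans x b ->
  exists c i, [/\ t = Fan c i, (c, i) \in occs, (lit F c i).1 = x & (lit F c i).2 = b].
Proof.
case/mapP => -[c i]; rewrite mem_filter => /andP[/andP[/eqP h1 /eqP h2] h3] ->.
by exists c, i.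
Qed.

Lemma uniq_fans x b : uniq (fans x b).
Proof. by rewrite map_inj_uniq ?filter_uniq ?uniq_occs // => -[? ?] [? ?] [-> ->]. Qed.

Lemma flatten_var_stacks x : flatten (var_stacks F x) =
  [:: Vtop x; Vmid x; Vbot x] ++ Lit x true :: fans x true ++ Lit x false :: fans x false.
Proof. by rewrite /= cats0. Qed.

Lemma uniq_var_stacks x : uniq (flatten (var_stacks F x)).
Proof.
have nf t b : t.1.1.1 != 4 -> (t \in fans x b) = false.
  by move=> ht; apply/negP => /mem_fans[c [i [e _]]]; rewrite e in ht.
rewrite flatten_var_stacks /= !inE !mem_cat !inE !nf //= cat_uniq uniq_fans /= !nf // uniq_fans /= andbT.
rewrite orbF; apply/andP; split; first by apply/eqP => -[].
apply/hasP => -[t /mem_fans[c [i [e _ _ e1]]] /mem_fans[c' [i' [e' _ _ e2]]]].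
by move: e2; rewrite e in e' *; case: e' => <- <-; rewrite e1.
Qed.

Lemma uniq_tiles : uniq (flatten (stacks_of F)).
Proof.
have e : flatten [:: main_stack F] = main_stack F by rewrite /= cats0.
rewrite /stacks_of !flatten_cat {}e.
have e s : flatten (flatten [seq var_stacks F x | x <- s]) =
    flatten [seq flatten (var_stacks F x) | x <- s].
  elim: s => // x s IH.
  rewrite -[flatten (map _ _)]/(var_stacks F x ++ flatten [seq var_stacks F x | x <- s]).
  by rewrite flatten_cat IH.
rewrite {}e.
set A := flatten _; set B := flatten _; set C := flatten _; set D := main_stack F.
have kA t : t \in A -> t.1.1.1 < 5.
  case/flattenP => _ /mapP[x hx ->]; rewrite mem_var_stacks.
  by do 5 (case/orP => [/eqP->//|]); case/hasP => p _ /andP[/eqP -> _].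
have kB t : t \in B -> 4 < t.1.1.1 < 7.
  by case/flattenP => _ /mapP[p hp ->]; rewrite !inE => /orP[] /eqP->.
have kC t : t \in C -> 6 < t.1.1.1 < 9.
  by case/flattenP => _ /mapP[p hp ->]; rewrite !inE => /orP[] /eqP->.
have kD t : t \in D -> 8 < t.1.1.1 by rewrite mem_main => /andP[].
have uA : uniq A.
  apply: uniq_flatten_map; first exact: undup_uniq.
    by move=> x _; apply: uniq_var_stacks.
  move=> x y t _ _; rewrite !mem_var_stacks.
  do 5 (case/orP => [/eqP->|]; first by
    do 5 (case/orP => [/eqP[]//|]); case/hasP => p _ /andP[/eqP]).
  case/hasP => p _ /andP[/eqP-> /eqP<-].
  do 5 (case/orP => [/eqP[]//|]); case/hasP => q _ /andP[/eqP e /eqP <-].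
  by case: e => -> ->.
have uB : uniq B.
  apply: uniq_flatten_map; [exact: uniq_occs | by [] |].
  by move=> [c i] [c' i'] t _ _; rewrite !inE => /orP[] /eqP -> /orP[] /eqP [] // -> ->.
have uC : uniq C.
  apply: uniq_flatten_map; [exact: iota_uniq | by [] |].
  by move=> c c' t _ _; rewrite !inE => /orP[] /eqP -> /orP[] /eqP [].
have uD : uniq D.
  rewrite /D /main_stack !cat_uniq !map_inj_uniq ?iota_uniq ?undup_uniq /=; try by move=> ? ? [].
  rewrite allpairs_uniq_dep ?iota_uniq //=; last by move=> [? ?] [? ?] _ _ /= [-> ->].
    rewrite andbT; apply/andP; split; apply/hasP => -[t].
      rewrite mem_cat => /orP[/mapP[x _ ->] /mapP[c _]|/allpairsPdep[c [j [_ _ ->]]] /mapP[? _]] //.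
    by case/allpairsPdep => c [j [_ _ ->]] /mapP[? _].
  by move=> c _; exact: iota_uniq.
clearbody A B C D; rewrite !cat_uniq uA uB uC uD /= !andbT.
apply/and3P; split; apply/hasP => -[t].
- by rewrite !mem_cat => /or3P[/kB|/kC|/kD] + /kA; lia.
- by rewrite !mem_cat => /orP[/kC|/kD] + /kB; lia.
- by move=> /kD + /kC; lia.
Qed.

End Uniq.

Lemma eq_Lit x a b : (Lit x a == Lit x b) = (a == b).
Proof. by case: a b => [] []; rewrite ?eqxx //; apply/eqP => -[]. Qed.

(** * From a winning play to a satisfying assignment *)

Section Soundness.
Variables (F : cnf) (numb : gtile -> nat) (mate : gtile -> gtile) (rank : gtile -> nat).
Hypothesis numb_inj : injective numb.
Hypothesis pair : stack_pairing (fun t => numb (color t)) (stacks_of F) mate rank.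

Let before t' t := rank t' < rank t.

Lemma before_trans : transitive before.
Proof. by move=> y x z; rewrite /before; lia. Qed.

Lemma mateP t : valid F t -> [/\ valid F (mate t), mate t != t, mate (mate t) = t,
  color (mate t) = color t & rank (mate t) = rank t].
Proof.
case: pair => h _; rewrite -mem_tiles => /h[h1 h2 h3 /numb_inj h4 h5].
by split=> //; rewrite -mem_tiles.
Qed.

Lemma stack_before s : s \in stacks_of F -> pairwise before s.
Proof. by case: pair => _ h /h; rewrite (sorted_pairwise before_trans). Qed.

Lemma var_stack_mem x s : x \in vars F -> s \in var_stacks F x -> s \in stacks_of F.
Proof.
by move=> hx hs; rewrite mem_cat; apply/orP; left; apply/flattenP; exists (var_stacks F x) => //; exact: map_f.
Qed.

Lemma before_var x : x \in vars F ->
  rank (Vtop x) < rank (Vmid x) /\ rank (Vmid x) < rank (Vbot x).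
Proof.
move=> hx; have /stack_before := var_stack_mem hx (mem_head _ _).
by rewrite /= !andbT => /andP[/andP[h1 _] h2].
Qed.

Lemma before_lit c i : (c, i) \in occs F ->
  rank (Lit (lit F c i).1 (lit F c i).2) < rank (Fan c i).
Proof.
move=> h; set x := (lit F c i).1; set b := (lit F c i).2.
have : lit_stack F x b \in stacks_of F.
  apply: (@var_stack_mem x); first exact: mem_vars.
  by rewrite !inE; case: b; rewrite eqxx ?orbT.
move/stack_before; rewrite /= => /andP[/allP hall _]; apply: hall.
by apply/mapP; exists (c, i); rewrite // mem_filter h !eqxx.
Qed.

Lemma before_wire c i : (c, i) \in occs F -> rank (Wire c i) < rank (Token c i).
Proof.
move=> h; have : [:: Wire c i; Token c i] \in stacks_of F.
  by rewrite !mem_cat; apply/or4P; apply: Or42; apply/mapP; exists (c, i).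
by move/stack_before; rewrite /= !andbT.
Qed.

Lemma before_need c : c < size F -> rank (Need c) < rank (Done c).
Proof.
move=> h; have : [:: Need c; Done c] \in stacks_of F.
  by rewrite !mem_cat; apply/or4P; apply: Or43; apply/mapP; exists c; rewrite ?mem_iota.
by move/stack_before; rewrite /= !andbT.
Qed.

Lemma before_main c t : c < size F -> valid F t -> 9 < t.1.1.1 -> rank (Mdone c) < rank t.
Proof.
move=> hc hv hk; have : main_stack F \in stacks_of F.
  by rewrite !mem_cat !inE eqxx !orbT.
move/stack_before; rewrite /main_stack pairwise_cat => /and3P[/allrelP h _ _].
apply: h; first by apply: map_f; rewrite mem_iota.
have : t \in main_stack F by rewrite mem_main hv andbT ltnW.
by rewrite /main_stack mem_cat => /orP[/mapP[d _ e]|//]; rewrite e in hk.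
Qed.

Lemma color_var t x : valid F t -> color t = (0, x, 0, 0) ->
  [\/ t = Vtop x, t = Vbot x | exists b, t = Lit x b].
Proof.
case: t => [[[k y] c] i]; case: k => [|[|[|[|[|[|[|[|[|[|[|[|k]]]]]]]]]]]] //= h [e]; rewrite ?{}e in h *.
- by case/and3P: h => /eqP-> /eqP-> _; constructor 1.
- by case/and3P: h => /eqP-> /eqP-> _; constructor 2.
by case/and3P: h; case: c => [|[|//]] _ /eqP-> _; constructor 3; [exists false | exists true].
Qed.

Lemma color_clause t c : valid F t -> color t = (6, [::], c, 0) ->
  [\/ t = Need c, (exists2 i, t = Token c i & (c, i) \in occs F) | t.1.1.1 = 11].
Proof.
case: t => [[[k y] d] i]; case: k => [|[|[|[|[|[|[|[|[|[|[|[|k]]]]]]]]]]]] //= h [e1 e2]; rewrite ?{}e1 ?{}e2 in h *.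
- by case/andP: h => _ h; constructor 2; exists i.
- by case/and3P: h => _ /eqP-> _; constructor 1.
by constructor 3.
Qed.

Lemma mate_two t t' : valid F t -> (forall u, valid F u -> color u = color t -> u = t \/ u = t') ->
  rank t = rank t'.
Proof.
move=> hv h; have [v1 ne _ hc hr] := mateP hv.
by case: (h _ v1 hc) => e; [rewrite e eqxx in ne | rewrite -hr e].
Qed.

Lemma rank_done c : c < size F -> rank (Done c) = rank (Mdone c).
Proof.
move=> lt; apply: mate_two => //= -[[[k y] d] i]; case: k => [|[|[|[|[|[|[|[|[|[|[|[|k]]]]]]]]]]]] //= h [e1 e2];
  rewrite ?{}e1 ?{}e2 in h *; case/and3P: h => _ /eqP-> _; by [left | right].
Qed.

Lemma rank_mid x : x \in vars F -> rank (Vmid x) = rank (Mvar x).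
Proof.
move=> hx; apply: mate_two => //= -[[[k y] d] i]; case: k => [|[|[|[|[|[|[|[|[|[|[|[|k]]]]]]]]]]]] //= h [e1];
  rewrite ?{}e1 in h *; case/and3P: h => /eqP-> /eqP-> _; by [left | right].
Qed.

Lemma rank_fan c i : (c, i) \in occs F -> rank (Wire c i) = rank (Fan c i).
Proof.
move=> h; apply: mate_two => //= -[[[k y] d] j]; case: k => [|[|[|[|[|[|[|[|[|[|[|[|k]]]]]]]]]]]] //= _ [-> -> ->];
  by [left | right].
Qed.

(** [Need c] precedes [Done c], which goes together with [Mdone c], so its mate is not an [Mrest]
    further down but some token. For that token the ranks form a chain: [Lit] < [Fan] = [Wire] <
    [Token] = [Need] < [Done] = [Mdone] < [Mvar] = [Vmid] < [Vbot]. So this [Lit] is not matched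
    with [Vbot], and the only other possibility is [Vtop], which makes the literal true. *)
Lemma satisfies_of_pairing : satisfies (fun x => mate (Vtop x) == Lit x true) F.
Proof.
apply/(all_nthP [::]) => c lt; rewrite -/(clause F c).
have vN : valid F (Need c) by rewrite /= lt.
have [v1 ne _ hc hr] := mateP vN.
have b1 := before_need lt; have r1 := rank_done lt.
have [i e hi] : exists2 i, mate (Need c) = Token c i & (c, i) \in occs F.
  case: (color_clause v1 hc) => [e|//|e]; first by rewrite e eqxx in ne.
  by have := before_main lt v1 ltac:(by rewrite e); lia.
have b2 := before_wire hi; have b3 := before_lit hi; have r3 := rank_fan hi.
have li : i < size (clause F c) by move: hi; rewrite mem_occs => /andP[].
apply/(has_nthP ([::], false)); exists i => //; rewrite -/(lit F c i).
have hx := mem_vars hi; move: b3 hx; case: (lit F c i) => x b /= b3 hx.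
have [b4 b5] := before_var hx; have r4 := rank_mid hx.
have b6 := before_main lt (t := Mvar x) ltac:(by rewrite /= hx) isT.
have vL d : valid F (Lit x d) by rewrite /= hx; case: d.
have vT : valid F (Vtop x) by rewrite /= hx.
have [v2 n2 i2 c2 k2] := mateP vT.
(* [Vtop] lies above [Vbot] in the same tower, so they cannot have the same rank and be mates. *)
have [d ed] : exists d, mate (Vtop x) = Lit x d.
  case: (color_var v2 c2) => [e2|e2|//]; first by rewrite e2 eqxx in n2.
  by move: k2; rewrite e2; lia.
rewrite ed; have [v3 n3 i3 c3 k3] := mateP (vL b).
rewrite eq_Lit; suff -> : d = b by rewrite eqb_id.
rewrite e in hr; case: (color_var v3 c3) => [e3|e3|[d' e3]].
- by move: i3; rewrite e3 ed => -[]; case: (d) (b) => -[].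
- by move: k3; rewrite e3; lia.
(* What remains is that the two literal tiles are mates. If [d] differs from [b], the other literal
   tile would be the mate of both [Vtop x] and [Lit x b]. *)
have nd : d' != b by apply/eqP => ed'; rewrite e3 ed' eqxx in n3.
case: (eqVneq d b) => // ndb.
have e4 : d' = d by case: (d') (d) (b) nd ndb => [] [] [].
by move: i2; rewrite ed -e4 -e3 i3.
Qed.

End Soundness.

Lemma pairwise_sub_in (T : eqType) (r r' : rel T) s :
  {in s &, subrel r r'} -> pairwise r s -> pairwise r' s.
Proof. by move=> h; apply: (@sub_in_pairwise _ (mem s)); rewrite ?allss. Qed.

Lemma pairwise_iota n : pairwise ltn (iota 0 n).
Proof. by rewrite -(sorted_pairwise ltn_trans) iota_ltn_sorted. Qed.

(** As [K] bounds the row lengths, [c * K + i] numbers the pairs in lexicographic order. *)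
Lemma pairwise_lex (K n : nat) (g : nat -> nat) : (forall c, c < n -> g c <= K) ->
  pairwise (fun p q : nat * nat => p.1 * K + p.2 < q.1 * K + q.2)
    [seq (c, i) | c <- iota 0 n, i <- iota 0 (g c)].
Proof.
move=> hg; apply: pairwise_flatten_map.
  apply: pairwise_sub_in (pairwise_iota n) => c d; rewrite !mem_iota /= => lc ld lt.
  apply/allrelP => _ _ /mapP[i + ->] /mapP[j + ->]; rewrite !mem_iota /= => li lj.
  have := hg c lc; have : c.+1 * K <= d * K by rewrite leq_mul2r lt orbT.
  rewrite mulSn; lia.
apply/allP => c _ /=; rewrite pairwise_map; apply: sub_pairwise (pairwise_iota _) => i j /=; lia.
Qed.

(** * From a satisfying assignment to a winning play *)

Section Completeness.
Variables (F : cnf) (v : seq bool -> bool).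
Hypothesis sat : satisfies v F.

Definition holds (l : literal) := v l.1 == l.2.
Definition chosen c := find holds (clause F c).

(** Of each clause, the token of its first true literal goes to [Need]. The others go to the [Mrest]
    tiles in order, [bump] and [unbump] skipping the index of the token already used. *)
Definition mate (t : gtile) : gtile :=
  let: (k, x, c, i) := t in
  match k with
  | 0 => Lit x (v x)
  | 1 => Mvar x
  | 2 => Lit x (~~ v x)
  | 3 => if (c == 1) == v x then Vtop x else Vbot x
  | 4 => Wire c i
  | 5 => Fan c i
  | 6 => if i == chosen c then Need c else Mrest c (unbump (chosen c) i)
  | 7 => Token c (chosen c)
  | 8 => Mdone c
  | 9 => Done c
  | 10 => Vmid x
  | _ => Token c (bump (chosen c) i)
  end.

(** [K] exceeds every clause length, so [c * K + i + 1 < B0] for all occurrences. [B0] is the time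
    at which the tokens meet the [Need]s, [B1] comes after all clauses and variables of the main
    tower, and [B2] after the occurrences of the false literals. *)
Let K := (size (flatten F)).+1.
Let n := size F.
Let B0 := n * K + 2.
Let B1 := B0 + 1 + n + size (vars F).
Let B2 := B1 + B0.

(* Play order: the true literals, their occurrences, one token per clause, the
   clauses on the main stack, the variables on it, the false literals, their
   occurrences, and finally the tokens left over. *)
Definition rank (t : gtile) : nat :=
  let: (k, x, c, i) := t in
  match k with
  | 0 => 0
  | 1 | 10 => B0 + 1 + n + index x (vars F)
  | 2 => B1
  | 3 => if (c == 1) == v x then 0 else B1
  | 4 | 5 => (if holds (lit F c i) then 0 else B1) + 1 + (c * K + i)
  | 6 => if i == chosen c then B0 else B2 + (c * K + unbump (chosen c) i)
  | 7 => B0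
  | 8 | 9 => B0 + 1 + c
  | _ => B2 + (c * K + i)
  end.

Let before t' t := rank t' < rank t.

Lemma size_clause c : c < n -> size (clause F c) < K.
Proof.
move=> lt; rewrite ltnS size_flatten sumnE /shape big_map.
by rewrite (big_nth [::]) big_mkord (bigD1 (Ordinal lt)) //= leq_addr.
Qed.

Lemma chosen_lt c : c < n -> chosen c < size (clause F c).
Proof. by move=> lt; rewrite -has_find; move/allP: sat; apply; apply: mem_nth. Qed.

Lemma chosen_holds c : c < n -> holds (lit F c (chosen c)).
Proof. by move=> lt; apply: nth_find; rewrite has_find chosen_lt. Qed.

Lemma lex_lt c i : (c, i) \in occs F -> c * K + i + 1 < B0.
Proof.
rewrite mem_occs => /andP[lc li]; have := size_clause lc.
have : c.+1 * K <= n * K by rewrite leq_mul2r lc orbT.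
rewrite mulSn /B0; lia.
Qed.

Lemma pairwise_occs : pairwise (fun p q : nat * nat => p.1 * K + p.2 < q.1 * K + q.2) (occs F).
Proof. by apply: pairwise_lex => c /size_clause /ltnW. Qed.

Lemma mate_valid t : valid F t -> [/\ valid F (mate t), mate t != t, mate (mate t) = t,
  color t = color (mate t) & rank (mate t) = rank t].
Proof.
case: t => [[[k x] c] i]; case: k => [|[|[|[|[|[|[|[|[|[|[|[|//]]]]]]]]]]]] /=.
- case/and3P => /eqP-> /eqP-> hx.
  by rewrite hx eqb1 eqxx /=; case: (v x).
- by case/and3P => /eqP-> /eqP-> ->.
- case/and3P => /eqP-> /eqP-> hx.
  by rewrite hx eqb1; case: (v x).
- by case: c => [|[|//]] /and3P[_ /eqP-> hx]; case e: (v x); rewrite /= ?e ?hx ?eqxx.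
- by case/andP => /eqP-> ->.
- by case/andP => /eqP-> ->.
- case/andP => /eqP-> ho; have := ho; rewrite mem_occs => /andP[lc li].
  have := chosen_lt lc; case: eqP => [->|/eqP ne] lch /=; first by rewrite lc.
  rewrite unbumpK // lc; split=> //; rewrite /unbump; move: ne; lia.
- case/and3P => /eqP-> /eqP-> lc.
  by rewrite eqxx mem_occs lc chosen_lt.
- by case/and3P => /eqP-> /eqP-> ->.
- by case/and3P => /eqP-> /eqP-> ->.
- by case/and3P => /eqP-> /eqP-> ->.
case/and3P => /eqP-> lc li; rewrite eq_sym (negbTE (neq_bump _ _)) bumpK mem_occs lc.
by split=> //=; rewrite /bump; lia.
Qed.

Lemma before_fans x b s : pairwise (fun p q : nat * nat => p.1 * K + p.2 < q.1 * K + q.2) s ->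
  all (fun p => ((lit F p.1 p.2).1 == x) && ((lit F p.1 p.2).2 == b)) s ->
  pairwise before (Lit x b :: [seq Fan p.1 p.2 | p <- s]).
Proof.
have hl c i : ((lit F c i).1 == x) && ((lit F c i).2 == b) -> holds (lit F c i) = (v x == b).
  by rewrite /holds => /andP[/eqP-> /eqP->].
move=> hs /allP ha; rewrite pairwise_cons; apply/andP; split.
  apply/allP => _ /mapP[p /ha /hl h ->]; rewrite /before /= h.
  by rewrite eqb1 eq_sym; case: eqP; lia.
rewrite pairwise_map; apply: pairwise_sub_in hs => p q /ha /hl hp /ha /hl hq.
by rewrite /before /= hp hq; lia.
Qed.

Lemma before_main_stack : pairwise before (main_stack F).
Proof.
rewrite /main_stack !pairwise_cat; apply/and3P; split.
- apply/allrelP => _ t /mapP[c + ->]; rewrite mem_iota mem_cat /= => lc.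
  case/orP => [/mapP[x _ ->]|/allpairsPdep[d [j [_ _ ->]]]]; rewrite /before /= /B2 /B1 -/n in lc *; lia.
- by rewrite pairwise_map; apply: sub_pairwise (pairwise_iota _) => c d; rewrite /before /=; lia.
apply/and3P; split.
- apply/allrelP => _ _ /mapP[x hx ->] /allpairsPdep[d [j [_ _ ->]]].
  by rewrite -index_mem in hx; rewrite /before /= /B2 /B1; lia.
- rewrite pairwise_map -sorted_pairwise; last by move=> y x z; rewrite /before /=; lia.
  case E: (vars F) => [//|x0 s]; rewrite -E; apply/(sortedP x0) => i lt.
  have li := ltnW lt; rewrite /before /= !index_uniq ?undup_uniq //; lia.
have := @pairwise_lex K n (fun c => (size (clause F c)).-1).
move/(_ (fun c lt => leq_trans (leq_pred _) (ltnW (size_clause lt)))) => h.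
rewrite (_ : [seq Mrest c j | c <- _, j <- _] = [seq Mrest p.1 p.2 | p <-
  [seq (c, i) | c <- iota 0 n, i <- iota 0 (size (clause F c)).-1]]).
  by rewrite pairwise_map; apply: sub_pairwise h => p q; rewrite /before /=; lia.
by rewrite map_flatten -map_comp; congr flatten; apply: eq_map => c; rewrite /comp -map_comp.
Qed.

Lemma before_stack s : s \in stacks_of F -> pairwise before s.
Proof.
rewrite !mem_cat => /or4P[/flattenP[_ /mapP[x hx ->]]|/mapP[[c i] ho ->]|/mapP[c + ->]|].
- rewrite !inE => /or3P[] /eqP->; first by rewrite /before /= -index_mem in hx *; lia.
  + by apply: before_fans; [apply: subseq_pairwise (filter_subseq _ _) pairwise_occs | exact: filter_all].
  + by apply: before_fans; [apply: subseq_pairwise (filter_subseq _ _) pairwise_occs | exact: filter_all].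
- rewrite /= !andbT /before /=; have := lex_lt ho; have := ho; rewrite mem_occs => /andP[lc _].
  case: eqP => [->|_]; first by rewrite chosen_holds //; lia.
  by rewrite /B2; case: ifP; lia.
- by rewrite mem_iota /before /=; lia.
by rewrite inE => /eqP->; exact: before_main_stack.
Qed.

Lemma pairing_of_satisfies numb : stack_pairing (fun t => numb (color t) : nat) (stacks_of F) mate rank.
Proof.
split=> [t|s /before_stack].
  rewrite mem_tiles => /mate_valid[h1 h2 h3 h4 h5]; split; rewrite ?mem_tiles //.
  by rewrite h4.
by rewrite -sorted_pairwise // => y x z; rewrite /before; lia.
Qed.

End Completeness.

(** * Binary numerals as words *)

Definition val_bits (w : seq bool) : nat := foldr (fun (b : bool) n => b + n.*2) 0 w.

Definition canonical (w : seq bool) : bool := nilp w || last false w.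

Lemma val_positive_bits p : val_bits (positive_bits p) = nat_of_bin (BinNums.Npos p).
Proof. by elim: p => [p IH|p IH|] //=; rewrite IH /= ?natTrecE ?NatTrec.doubleE. Qed.

Lemma nat_bitsK : cancel nat_bits val_bits.
Proof.
by move=> n; rewrite -[RHS]bin_of_natK /nat_bits; case: (bin_of_nat n) => // p; apply: val_positive_bits.
Qed.

Lemma canonical_nat_bits n : canonical (nat_bits n).
Proof.
rewrite /nat_bits; case: (bin_of_nat n) => // p; rewrite /canonical; apply/orP; right.
by elim: p => [p IH|p IH|] //=; case: (positive_bits p) IH.
Qed.

Fixpoint positive_of_bits (w : seq bool) : BinNums.positive :=
  match w with
  | [::] => BinNums.xH
  | b :: w' => if b then BinNums.xI (positive_of_bits w') else BinNums.xO (positive_of_bits w')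
  end.

Lemma positive_of_bitsK w : positive_bits (positive_of_bits w) = rcons w true.
Proof. by elim: w => [|[] w IH] //=; rewrite IH. Qed.

Lemma val_bitsK w : canonical w -> nat_bits (val_bits w) = w.
Proof.
have ex p : nat_bits (val_bits (positive_bits p)) = positive_bits p.
  by rewrite val_positive_bits /nat_bits nat_of_binK.
case/lastP: w => [|w b] //; rewrite /canonical /nilp size_rcons last_rcons /= => ->.
by rewrite -positive_of_bitsK ex.
Qed.

Lemma val_bits_lt w : val_bits w < 2 ^ size w.
Proof. by elim: w => //= b w IH; rewrite expnS; case: b; lia. Qed.

Fixpoint inc (w : seq bool) : seq bool :=
  match w with
  | [::] => [:: true]
  | b :: w' => if b then false :: inc w' else true :: w'
  end.

Lemma val_inc w : val_bits (inc w) = (val_bits w).+1.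
Proof. by elim: w => [|[] w IH] //=; rewrite ?IH; lia. Qed.

Lemma inc_neq_nil w : inc w != [::].
Proof. by case: w => [|[] w]. Qed.

Lemma canonical_inc w : canonical w -> canonical (inc w).
Proof.
rewrite /canonical; elim: w => [|[] w IH] //=; last by case: w {IH}.
have := inc_neq_nil w; case E: (inc w) IH => [|c u] //= IH _.
by case: w E IH => [|d w] /=; [case=> <- <- | move=> _; apply].
Qed.

Lemma nat_bits_succ n : nat_bits n.+1 = inc (nat_bits n).
Proof.
by rewrite -[in LHS](nat_bitsK n) -val_inc val_bitsK // canonical_inc ?canonical_nat_bits.
Qed.

(** The recursion of [inc] stops at the first [false]. As a fold it carries a flag to the end of the
    word and collects the output in reverse. *)
Lemma inc_foldl w : inc w =
  let st := foldl (fun (st : bool * seq bool) b => (st.1 && b, (b (+) st.1) :: st.2)) (true, [::]) w in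
  rev (if st.1 then true :: st.2 else st.2).
Proof.
suff h : forall w u, let st := foldl (fun (st : bool * seq bool) b => (st.1 && b, (b (+) st.1) :: st.2)) (true, u) w in
    rev (if st.1 then true :: st.2 else st.2) = rev u ++ inc w by exact: (esym (h w [::])).
elim=> [|b v IH] u /=; first by rewrite rev_cons cats1.
case: b => /=; first by rewrite IH rev_cons cat_rcons.
have -> : forall v u, foldl (fun (st : bool * seq bool) b => (st.1 && b, (b (+) st.1) :: st.2)) (false, u) v
    = (false, catrev v u) by elim=> //= b s H t; rewrite H addbF.
by rewrite /= catrevE rev_cat revK rev_cons cat_rcons.
Qed.

Lemma PT_addb : PT (fun p : bool * bool => p.1 (+) p.2).
Proof.
apply: (@PT_ext _ _ (fun p : bool * bool => ~~ (p.1 == p.2))); last by pt.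
by case=> [] [] [].
Qed.
#[global] Hint Resolve PT_addb : pt.

Lemma PT_inc : PT inc.
Proof.
apply: (PT_ext inc_foldl).
have h : PT (fun w : seq bool => foldl (fun (st : bool * seq bool) b => (st.1 && b, (b (+) st.1) :: st.2)) (true, [::]) w).
  apply: (PT_foldl_add (s := id) (z := fun=> (true, [::]))
    (f := fun _ (st : bool * seq bool) b => (st.1 && b, (b (+) st.1) :: st.2))); try by pt.
  exists (fun=> 8) => [|e [o r] a]; first by polyfun_tac.
  rewrite !sz_pair /= sz_cons; have := sz_bool (o && a); have := sz_bool (a (+) o).
  have : 0 < sz o by exact: sz_gt0. lia.
by pt.
Qed.
#[global] Hint Resolve PT_inc : pt.

Lemma sz_inc w : sz (inc w) <= sz w + 6.
Proof.
elim: w => [|[] w IH] //=; rewrite !sz_cons; last by have := sz_bool true; lia.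
by rewrite (_ : sz true = 3) // (_ : sz false = 1) //; lia.
Qed.

(** The argument is unary, so counting up to it with [inc] takes polynomially many steps. *)
Lemma PT_nat_bits : PT nat_bits.
Proof.
apply: (@PT_ext _ _ (fun n => iter n inc [::])).
  by elim=> // n IH; rewrite nat_bits_succ IH.
apply: (PT_iter (n := id) (z := fun=> [::]) (f := fun=> inc)); try by pt.
by exists (fun=> 6) => [|e a]; [polyfun_tac | exact: sz_inc].
Qed.

Lemma PT_nat_code : PT nat_code.
Proof. by have h := PT_nat_bits; rewrite /nat_code; pt. Qed.
#[global] Hint Resolve PT_nat_bits PT_nat_code : pt.

(** * The board of a formula as a word *)

Definition gword (t : gtile) : seq bool :=
  delimit (nseq t.1.1.1 true) ++ delimit t.1.1.2 ++ delimit (nseq t.1.2 true) ++ nseq t.2 true.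

(* The last bit makes every word the binary numeral of some number. *)
Definition gname (t : gtile) : seq bool := gword t ++ [:: true].

Definition numb (t : gtile) : nat := val_bits (gname t).

Lemma gword_inj : injective gword.
Proof.
have ns m n : nseq m true = nseq n true -> m = n by move/(congr1 size); rewrite !size_nseq.
move=> [[[k x] c] i] [[[k' x'] c'] i']; rewrite /gword /=.
by move=> /delimit_inj[/ns-> /delimit_inj[-> /delimit_inj[/ns-> /ns->]]].
Qed.

Lemma nat_bits_numb t : nat_bits (numb t) = gname t.
Proof. by rewrite val_bitsK // /canonical /gname last_cat orbT. Qed.

Lemma numb_inj : injective numb.
Proof.
move=> t t' /(congr1 nat_bits); rewrite !nat_bits_numb /gname => e; apply: gword_inj.
by move: e; rewrite !cats1 => /rcons_inj[].
Qed.

Definition tile0 : gtile := (0, [::], 0, 0).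

Definition entry_word (b t : gtile) (k : nat) : seq bool :=
  delimit (gname b) ++ nat_code 0 ++ nat_code k ++ delimit (gname (color t)) ++ delimit (gname t).

Definition tower_word (s : seq gtile) : seq bool :=
  flatten [seq entry_word (head tile0 s) (nth tile0 s i) (size s - i.+1) | i <- iota 0 (size s)].

Definition cnf_body (F : cnf) : seq bool := flatten [seq tower_word s | s <- stacks_of F].

(** The number of tile sets is 2 to the length of the body. This is trivial to write in binary, and
    it exceeds every colour because the name of each colour occurs within the body. *)
Definition cnf_word (F : cnf) : seq bool :=
  delimit (nseq (size (cnf_body F)) false ++ [:: true]) ++ cnf_body F.

Definition cnf_arrangement (F : cnf) : arrangement :=
  Arrangement (2 ^ size (cnf_body F)) (towers (fun t => numb (color t)) numb (stacks_of F)).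

Lemma entry_word_code b t k :
  entry_word b t k = entry_code ((numb b, 0, k), (numb (color t), numb t)).
Proof. by rewrite /entry_code /nat_code !nat_bits_numb. Qed.

Lemma tower_word_code s :
  tower_word s = flatten (map entry_code (tower (fun t => numb (color t)) numb (base numb s) s)).
Proof.
case: s => // t0 s; congr flatten; rewrite [head _ _]/= [base _ _]/=.
elim: (t0 :: s) => // t u IH; rewrite /= -(addn0 1) iotaDl -map_comp subn1 /=.
by congr cons; rewrite ?entry_word_code // -IH.
Qed.

Lemma flatten_map_flatten (A B : Type) (f : A -> seq B) ss :
  flatten (map f (flatten ss)) = flatten [seq flatten (map f s) | s <- ss].
Proof. by elim: ss => //= s ss IH; rewrite map_cat flatten_cat IH. Qed.

Lemma cnf_body_code F :
  cnf_body F = flatten (map entry_code (towers (fun t => numb (color t)) numb (stacks_of F))).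
Proof.
rewrite /cnf_body flatten_map_flatten -map_comp; congr flatten.
by apply: eq_map => s; apply: tower_word_code.
Qed.

Lemma cnf_word_code F : cnf_word F = arrangement_code (cnf_arrangement F).
Proof.
rewrite /cnf_word /arrangement_code /= -cnf_body_code; congr (_ ++ _); congr delimit.
have e n : val_bits (nseq n false ++ [:: true]) = 2 ^ n.
  by elim: n => //= n IH; rewrite IH expnS; lia.
by rewrite -e val_bitsK // /canonical last_cat orbT.
Qed.

Lemma size_delimit w : size w <= size (delimit w).
Proof.
rewrite /delimit size_cat addn1; apply: leqW.
by elim: w => //= b w IH; lia.
Qed.

Lemma size_flatten_mem (T : eqType) (ss : seq (seq T)) s : s \in ss -> size s <= size (flatten ss).
Proof.
elim: ss => //= s' ss IH; rewrite inE size_cat => /orP[/eqP->|/IH le]; first exact: leq_addr.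
exact: leq_trans le (leq_addl _ _).
Qed.

Lemma numb_color_lt F t : t \in flatten (stacks_of F) -> numb (color t) < 2 ^ size (cnf_body F).
Proof.
case/flattenP => s hs ht; apply: leq_trans (val_bits_lt _) _; rewrite leq_exp2l //.
apply: (@leq_trans (size (tower_word s))); last by apply: size_flatten_mem; apply: map_f.
have : entry_word (head tile0 s) t (size s - (index t s).+1) \in
    [seq entry_word (head tile0 s) (nth tile0 s i) (size s - i.+1) | i <- iota 0 (size s)].
  by apply/mapP; exists (index t s); rewrite ?mem_iota ?index_mem ?nth_index.
move/size_flatten_mem; apply: leq_trans; rewrite /entry_word; move: (gname (color t)) => g.
apply: leq_trans (size_delimit _) _; move: (delimit g) => d.
by do 3 (rewrite size_cat; apply: (leq_trans _ (leq_addl _ _))); rewrite size_cat leq_addr.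
Qed.

Theorem cnf_word_correct F : (exists v, satisfies v F) <-> mahjong_solitaire (cnf_word F).
Proof.
have uS := uniq_tiles F; have hP := plays_towers (fun t => numb (color t)) numb_inj uS.
split=> [[v sat]|[A [_ e w]]].
  have h : plays (towers (fun t => numb (color t)) numb (stacks_of F)) [::].
    by apply/hP; exists (mate F v), (rank F v); apply: (pairing_of_satisfies sat numb).
  exists (cnf_arrangement F); split; [|exact: cnf_word_code | exact: h].
  apply: towers_arrangement => //; [exact: numb_inj | move=> t; exact: numb_color_lt].
(* The code is injective, so the arrangement whose existence the language asserts is the constructed
   one. *)
have {}e : A = cnf_arrangement F by apply: arrangement_code_inj; rewrite -e cnf_word_code.
move: w; rewrite e => /hP[m [r h]]; exists (fun x => m (Vtop x) == Lit x true).
exact: (satisfies_of_pairing numb_inj h).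
Qed.

(** * Computing the board in polynomial time *)

Lemma PT_color : PT color.
Proof.
apply: (@PT_ext _ _ (fun t : gtile => let: k := t.1.1.1 in
  if (k == 0) || (k == 2) || (k == 3) then (0, t.1.1.2, 0, 0)
  else if (k == 1) || (k == 10) then (1, t.1.1.2, 0, 0)
  else if (k == 4) || (k == 5) then (4, t.1.1.2, t.1.2, t.2)
  else if (k == 6) || (k == 7) || (k == 11) then (6, t.1.1.2, t.1.2, 0)
  else (8, t.1.1.2, t.1.2, 0))).
  by case=> [[[k x] c] i]; case: k => [|[|[|[|[|[|[|[|[|[|[|[|k]]]]]]]]]]]].
by pt.
Qed.
#[global] Hint Resolve PT_color : pt.

Lemma PT_gname : PT gname.
Proof. by rewrite /gname /gword; pt. Qed.
#[global] Hint Resolve PT_gname : pt.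

Lemma PT_entry_word : PT (fun p : gtile * gtile * nat => entry_word p.1.1 p.1.2 p.2).
Proof. by rewrite /entry_word; pt. Qed.
#[global] Hint Resolve PT_entry_word : pt.

Lemma PT_tower_word : PT tower_word.
Proof. by rewrite /tower_word; pt. Qed.
#[global] Hint Resolve PT_tower_word : pt.

Lemma PT_lit : PT (fun p : cnf * nat * nat => lit p.1.1 p.1.2 p.2).
Proof. by rewrite /lit /clause; pt. Qed.
#[global] Hint Resolve PT_lit : pt.

Lemma PT_occs : PT occs.
Proof. by rewrite /occs /clause; pt. Qed.
#[global] Hint Resolve PT_occs : pt.

Lemma PT_vars : PT vars.
Proof. by rewrite /vars; pt. Qed.
#[global] Hint Resolve PT_vars : pt.

Lemma PT_stacks_of : PT stacks_of.
Proof.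
rewrite /stacks_of /main_stack /var_stacks /lit_stack /Vtop /Vmid /Vbot /Lit /Fan /Wire /Token
  /Need /Done /Mdone /Mvar /Mrest /clause; pt.
Qed.
#[global] Hint Resolve PT_stacks_of : pt.

Lemma PT_cnf_word : PT cnf_word.
Proof. by rewrite /cnf_word /cnf_body; pt. Qed.
#[global] Hint Resolve PT_cnf_word : pt.

(** * Computations as formulas *)

(* Name of the fact with code [c] about cell [z] at time [t]. *)
Definition fact_name (t z c : nat) : seq bool :=
  delimit (nseq t true) ++ delimit (nseq z true) ++ nseq c true.

Lemma fact_name_inj t z c t' z' c' : fact_name t z c = fact_name t' z' c' -> [/\ t = t', z = z' & c = c'].
Proof.
have ns m n : nseq m true = nseq n true -> m = n by move/(congr1 size); rewrite !size_nseq.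
by move=> /delimit_inj[/ns-> /delimit_inj[/ns-> /ns->]].
Qed.

Section Tableau.
Variable M : machine.
Notation state := (tm_state M).
Notation sym := (symbol (tm_work M)).
Notation tapes := 'I_(tm_extra M).+1.
Notation tape := (tape M).
Notation config := (tm_config M).

(** A halted machine is treated as standing still, so that every step up to the horizon follows a
    rule. *)
Definition rule (q : state) (a : {ffun tapes -> sym}) : state * {ffun tapes -> sym * direction} :=
  if q == tm_halt M then (q, [ffun i => (a i, Stay)]) else tm_delta q a.

Definition reads (k : config) : {ffun tapes -> sym} := [ffun i => read (k.2 i)].

(* Cells are numbered relative to the head, which is at cell [R]. *)
Definition cell (R : nat) (x : tape) (z : nat) : sym :=
  if z < R then nth None x.1 (R - z.+1) else nth None x.2 (z - R).

(* After a move in direction [d], the cell with number [z] gets number [z + shift d - 2]. *)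
Definition shift (d : direction) : nat := match d with Left => 3 | Stay => 2 | Right => 1 end.

Lemma cell_head R x : cell R x R = read x.
Proof. by rewrite /cell ltnn subnn nth0. Qed.

Lemma cell_move_head R x a d : 0 < R -> cell R (write_move x (a, d)) (R + shift d - 2) = a.
Proof.
case: x => l r R0; case: d => /=; rewrite /cell /write_move /=.
- by rewrite ifF; [rewrite (_ : R + 3 - 2 - R = 1) //; lia | lia].
- by rewrite ifF; [rewrite (_ : R + 2 - 2 - R = 0) //; lia | lia].
by rewrite ifT; [rewrite (_ : R - (R + 1 - 2).+1 = 0) //; lia | lia].
Qed.

Lemma cell_move R x a d z : 0 < R -> 0 < z -> z != R ->
  cell R (write_move x (a, d)) (z + shift d - 2) = cell R x z.
Proof.
case: x => l r R0 z0 nz; case: d => /=; rewrite /cell /write_move /=.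
- case: (ltngtP z R) nz => // lt _.
    case: (ltnP (z + 3 - 2) R) => lt'.
      by rewrite nth_behead; congr nth; lia.
    have -> : z + 3 - 2 - R = 0 by lia.
    have -> : R - z.+1 = 0 by lia.
    by rewrite /= nth0.
  rewrite ifF; last by lia.
  have -> : z + 3 - 2 - R = (z - R.+1).+2 by lia.
  by rewrite /= nth_behead; congr nth; lia.
- rewrite (_ : z + 2 - 2 = z); last lia.
  case: (ltngtP z R) nz => // lt _.
  have -> : z - R = (z - R.+1).+1 by lia.
  by rewrite /= nth_behead.
case: (ltngtP z R) nz => // lt _.
  rewrite ifT; last by lia.
  have -> : R - (z + 1 - 2).+1 = (R - z.+1).+1 by lia.
  by [].
rewrite ifF; last by lia.
by rewrite nth_behead; congr nth; lia.
Qed.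

Lemma step_rule R (k : config) : 0 < R ->
  let: (q, act) := rule k.1 (reads k) in
  (tm_step k).1 = q /\ forall i,
    cell R ((tm_step k).2 i) (R + shift (act i).2 - 2) = (act i).1 /\
    forall z, 0 < z -> z != R ->
      cell R ((tm_step k).2 i) (z + shift (act i).2 - 2) = cell R (k.2 i) z.
Proof.
move=> R0; rewrite /rule /tm_step; case: ifP => _.
  split=> // i; rewrite !ffunE /= !addnK; split=> [|z _ _]; last by rewrite addnK.
  exact: cell_head.
case E: (tm_delta _ _) => [q act] /=; split=> // i; rewrite ffunE.
by case: (act i) => a d; split=> [|z z0 nz]; [exact: cell_move_head | exact: cell_move].
Qed.

Definition fact := (state + tapes * sym)%type.
(** Ranking the facts turns all that depends on the machine into numerals. The templates below are
    then constant data for the program that instantiates them. *)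
Definition fact_code (f : fact) : nat := enum_rank f.
Definition code_state (q : state) := fact_code (inl q).
Definition code_cell (i : tapes) (a : sym) := fact_code (inr (i, a)).

Definition holds_at R (k : config) (z : nat) (f : fact) : bool :=
  match f with inl q => k.1 == q | inr (i, a) => cell R (k.2 i) z == a end.

(* A literal template: the time offset, the cell ([0] for the head, [s] for
   [z + s - 2] otherwise), the code of the fact and the sign. *)
Definition template := (nat * nat * nat * bool)%type.

Definition cell_of (s z R : nat) : nat := if s == 0 then R else z + s - 2.

Definition inst (t z R : nat) (l : template) : literal :=
  (fact_name (t + l.1.1.1) (cell_of l.1.1.2 z R) l.1.2, l.2).

Definition premises (q : state) (a : {ffun tapes -> sym}) : seq template :=
  (0, 0, code_state q, false) :: [seq (0, 0, code_cell i (a i), false) | i <- enum tapes].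

Definition head_templates : seq (seq template) :=
  flatten [seq (rcons (premises q a) (1, 0, code_state (rule q a).1, true)) ::
    [seq rcons (premises q a) (1, shift ((rule q a).2 i).2, code_cell i ((rule q a).2 i).1, true)
      | i <- enum tapes]
    | q <- enum state, a <- enum {ffun tapes -> sym}].

(** Frame conditions: a cell away from the head keeps its symbol but changes its number when the
    head moves. *)
Definition cell_templates : seq (seq template) :=
  flatten [seq [seq (0, 2, code_cell i b, false) ::
      rcons (premises q a) (1, shift ((rule q a).2 i).2, code_cell i b, true)
      | i <- enum tapes, b <- enum sym]
    | q <- enum state, a <- enum {ffun tapes -> sym}].

Definition step_clauses (T W R : nat) : cnf :=
  flatten [seq [seq [seq inst t R R l | l <- c] | c <- head_templates] ++
    flatten [seq [seq [seq inst t z R l | l <- c] | c <- cell_templates]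
      | z <- iota 0 W & (0 < z) && (z != R)]
    | t <- iota 0 T].

Definition blank_codes : seq nat := [seq code_cell i None | i <- enum tapes & i != ord0].
Definition bad_codes : seq nat := [seq code_cell ord0 a | a <- enum sym & a != Some (inl true)].
Definition code_bit (b : bool) : nat := code_cell ord0 (Some (inl b)).
Definition code_blank : nat := code_cell ord0 None.

(* The initial tape holds [u] followed by a word of length at most [B]. *)
Definition init_clauses (u : seq bool) (B W R : nat) : cnf :=
  [:: (fact_name 0 R (code_state (tm_start M)), true)] ::
  flatten [seq [seq [:: (fact_name 0 z c, true)] | c <- blank_codes] | z <- iota 0 W] ++
  [seq [:: (fact_name 0 z code_blank, true)] | z <- iota 0 W & (z < R) || (R + size u + B <= z)] ++
  [seq [:: (fact_name 0 (R + j) (if nth false u j then code_bit true else code_bit false), true)]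
    | j <- iota 0 (size u)] ++
  [seq [:: (fact_name 0 (R + size u + j) (code_bit true), true);
           (fact_name 0 (R + size u + j) (code_bit false), true);
           (fact_name 0 (R + size u + j) code_blank, true)] | j <- iota 0 B] ++
  [seq [:: (fact_name 0 (R + size u + j) code_blank, false);
           (fact_name 0 (R + size u + j).+1 code_blank, true)] | j <- iota 0 B].

(** Acceptance has to be expressed by forbidding the wrong facts. Asserting the right ones would
    exclude nothing, because an assignment may contain facts beyond those of the run. *)
Definition final_clauses (T R : nat) : cnf :=
  [seq [:: (fact_name T R c, false)] | c <- bad_codes] ++
  [:: [:: (fact_name T R.+1 (code_bit true), false)]; [:: (fact_name T R.+1 (code_bit false), false)]].

(** After [t] steps the cells strictly between [t] and [W - t] are under control. The margins keep
    the cells [R] and [R.+1], on which the output depends, inside this window until time [T]. *)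
Definition tableau (u : seq bool) (B T : nat) : cnf :=
  let R := T.+1 in let W := R + size u + B + T + 3 in
  init_clauses u B W R ++ step_clauses T W R ++ final_clauses T R.

Lemma output_true (k : config) R : (tm_output k = [:: true]) <->
  (cell R (k.2 ord0) R = Some (inl true) /\ forall b, cell R (k.2 ord0) R.+1 != Some (inl b)).
Proof.
rewrite /tm_output /cell ltnn subnn ifF; last by lia.
rewrite subSnn; case: (k.2 ord0).2 => [|[[b|a]|] r] /=; split=> //; try by case.
  case=> -> h; split=> // c; case: r h => [|[[d|e]|] r] //=.
case=> [[->]] h; case: r h => [|[[d|e]|] r] //= h.
by have := h d; rewrite eqxx.
Qed.

End Tableau.

Lemma mem_consr (A : eqType) (x y : A) s : x \in s -> x \in y :: s.
Proof. by rewrite inE orbC => ->. Qed.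

Lemma mem_catl (A : eqType) (x : A) s1 s2 : x \in s1 -> x \in s1 ++ s2.
Proof. by rewrite mem_cat => ->. Qed.

Lemma mem_catr (A : eqType) (x : A) s1 s2 : x \in s2 -> x \in s1 ++ s2.
Proof. by rewrite mem_cat orbC => ->. Qed.

Lemma mem_cat_or (A : eqType) (x : A) s1 s2 : x \in s1 ++ s2 -> x \in s1 \/ x \in s2.
Proof. by rewrite mem_cat => /orP. Qed.

Section TableauCorrect.
Variables (M : machine) (u : seq bool) (B T : nat).
Notation state := (tm_state M).
Notation sym := (symbol (tm_work M)).
Notation tapes := 'I_(tm_extra M).+1.
Let R := T.+1.
Let W := R + size u + B + T + 3.

Lemma mem_head_template (q : state) a : rcons (premises q a) (1, 0, code_state (rule q a).1, true)
  \in head_templates M.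
Proof.
apply/flattenP; eexists; first by apply/allpairsP; exists (q, a); rewrite !mem_enum.
exact: mem_head.
Qed.

Lemma mem_head_template_tape (q : state) a i :
  rcons (premises q a) (1, shift ((rule q a).2 i).2, code_cell i ((rule q a).2 i).1, true)
  \in head_templates M.
Proof.
apply/flattenP; eexists; first by apply/allpairsP; exists (q, a); rewrite !mem_enum.
by rewrite inE; apply/orP; right; apply/mapP; exists i; rewrite ?mem_enum.
Qed.

Lemma mem_cell_template (q : state) a i b :
  (0, 2, code_cell i b, false) ::
    rcons (premises q a) (1, shift ((rule q a).2 i).2, code_cell i b, true)
  \in cell_templates M.
Proof.
apply/flattenP; eexists; first by apply/allpairsP; exists (q, a); rewrite !mem_enum.
by apply/allpairsP; exists (i, b); rewrite !mem_enum.
Qed.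

Lemma head_templateP c : c \in head_templates M -> exists (q : state) a,
  c = rcons (premises q a) (1, 0, code_state (rule q a).1, true) \/
  exists i, c = rcons (premises q a) (1, shift ((rule q a).2 i).2, code_cell i ((rule q a).2 i).1, true).
Proof.
case/flattenP => s /allpairsP[[q a] [_ _ ->]] h; exists q, a; move: h.
by rewrite inE => /orP[/eqP->|/mapP[i _ ->]]; [left | right; exists i].
Qed.

Lemma cell_templateP c : c \in cell_templates M -> exists (q : state) a i b,
  c = (0, 2, code_cell i b, false) ::
    rcons (premises q a) (1, shift ((rule q a).2 i).2, code_cell i b, true).
Proof.
by case/flattenP => s /allpairsP[[q a] [_ _ ->]] /allpairsP[[i b] [_ _ ->]]; exists q, a, i, b.
Qed.

(** * From a satisfying assignment to an accepting run *)

Section FromAssignment.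
Variable v : seq bool -> bool.
Hypothesis sat : satisfies v (tableau M u B T).

Let true_at t z (f : fact M) : bool := v (fact_name t z (fact_code f)).

Lemma sat_init c : c \in init_clauses M u B W R -> has (fun l : literal => v l.1 == l.2) c.
Proof. by move=> h; move/allP: sat; apply; rewrite mem_cat h. Qed.

Lemma sat_head t c : t < T -> c \in head_templates M ->
  has (fun l : literal => v l.1 == l.2) [seq inst t R R l | l <- c].
Proof.
move=> lt h; move/allP: sat; apply; rewrite !mem_cat; apply/or3P; apply: Or32.
apply/flattenP; eexists; first by apply/mapP; exists t; rewrite ?mem_iota.
by rewrite mem_cat; apply/orP; left; apply: map_f.
Qed.

Lemma sat_cell t z c : t < T -> 0 < z < W -> z != R -> c \in cell_templates M ->
  has (fun l : literal => v l.1 == l.2) [seq inst t z R l | l <- c].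
Proof.
move=> lt /andP[z0 zW] nz h; move/allP: sat; apply; rewrite !mem_cat; apply/or3P; apply: Or32.
apply/flattenP; eexists; first by apply/mapP; exists t; rewrite ?mem_iota.
rewrite mem_cat; apply/orP; right; apply/flattenP; eexists; last exact: map_f h.
by apply/mapP; exists z => //; rewrite mem_filter mem_iota z0 nz.
Qed.

Lemma sat_final c : c \in final_clauses M T R -> has (fun l : literal => v l.1 == l.2) c.
Proof. by move=> h; move/allP: sat; apply; do 2 apply: mem_catr. Qed.

(** Only one inclusion: the facts of the run are true, and others may be. The window loses a cell at
    each end per step, because a head move renumbers cells by one and a border cell would come from
    outside. *)
Definition tracks t (k : tm_config M) : Prop :=
  true_at t R (inl k.1) /\
  forall i z, t < z < W - t -> true_at t z (inr (i, cell R (k.2 i) z)).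

(** The premises are facts of the tracked run, so every negative literal that stands for one fails,
    and the clause has to be satisfied by [X]. *)
Lemma conclude t z q a X (k : tm_config M) : t < T -> tracks t k -> k.1 = q -> reads k = a ->
  has (fun l : literal => v l.1 == l.2) [seq inst t z R l | l <- rcons (premises q a) X] ->
  v (inst t z R X).1 == (inst t z R X).2.
Proof.
move=> lt [h1 h2] eq ea; rewrite map_rcons -cats1 has_cat /= orbF.
case/orP; last by [].
rewrite /true_at eq in h1; rewrite addn0 [cell_of _ _ _]/= h1 /= -map_comp has_map.
case/hasP => i _; rewrite /= addn0 [cell_of _ _ _]/= -ea ffunE -(cell_head R).
have h3 : v (fact_name t R (code_cell i (cell R (k.2 i) R))) by apply: h2; rewrite /W /R; lia.
by rewrite h3.
Qed.

Lemma tracks_step t k : t < T -> tracks t k -> tracks t.+1 (tm_step k).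
Proof.
move=> lt tr; have := step_rule k (isT : 0 < R).
case E: (rule _ _) => [q act] [h1 h2]; split.
  have := conclude lt tr erefl erefl (sat_head lt (mem_head_template k.1 (reads k))).
  by rewrite /inst /cell_of /= addn1 eqb_id E h1.
move=> i z hz; have [h3 h4] := h2 i.
have sh : 0 < shift (act i).2 <= 3 by case: (act i).2.
case: (eqVneq z (R + shift (act i).2 - 2)) => [->|nz].
  have := conclude lt tr erefl erefl (sat_head lt (mem_head_template_tape k.1 (reads k) i)).
  rewrite /inst /= addn1 eqb_id E /= /true_at h3 /cell_of.
  by case: eqP => // e; move: sh; rewrite e.
(* The number that this cell had before the head moved. *)
set z' := z + 2 - shift (act i).2.
have ez : z = z' + shift (act i).2 - 2 by rewrite /z'; lia.
have z0 : 0 < z' by rewrite /z'; lia.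
have nz' : z' != R by apply: contra nz => /eqP e; rewrite -e -ez.
have zW : z' < W by rewrite /z' /W in hz *; lia.
have z0W : 0 < z' < W by rewrite z0.
have hcell := sat_cell lt z0W nz' (mem_cell_template k.1 (reads k) i (cell R (k.2 i) z')).
have /= := hcell; rewrite -/(map _ _) => /orP[].
  rewrite addn0 /cell_of [_ == 0]/= addnK.
  have [_ /(_ i z')] := tr; rewrite /true_at => -> //.
  by rewrite /z' in z0 zW *; move: hz; rewrite /W; lia.
move/(conclude lt tr erefl erefl); rewrite /inst /= addn1 eqb_id E /= /true_at.
rewrite {2}ez h4 // /cell_of; case: eqP => [e|_]; first by move: sh; rewrite e.
by rewrite -ez.
Qed.

Let vbit j b := v (fact_name 0 (R + size u + j) (code_bit M b)).

(** The certificate ends before the first cell for which neither bit is asserted. Where both are,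
    [true] is read. *)
Definition guess : seq bool :=
  [seq vbit j true | j <- iota 0 (find (fun j => ~~ (vbit j true || vbit j false)) (iota 0 B))].

Lemma size_guess : size guess <= B.
Proof. by rewrite size_map size_iota -[leqRHS](size_iota 0 B) find_size. Qed.

Lemma vbit_guess j : j < size guess -> vbit j (nth false guess j).
Proof.
rewrite size_map size_iota => lt.
rewrite (nth_map 0) ?size_iota // nth_iota // add0n.
have := before_find 0 lt; rewrite nth_iota ?add0n; last first.
  by apply: leq_trans lt _; rewrite -[leqRHS](size_iota 0 B) find_size.
by move/negbFE; case E: (vbit j true).
Qed.

(** The first cell without a bit must be blank by its three-way clause, and the implications carry
    blankness on to the right. If every cell of the guess has a bit, the blank at position [B] is
    given outright. *)
Lemma blank_after j : size guess <= j -> j <= B ->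
  v (fact_name 0 (R + size u + j) (code_blank M)).
Proof.
set m := size guess; have em : m = find (fun j => ~~ (vbit j true || vbit j false)) (iota 0 B).
  by rewrite /m size_map size_iota.
have hB : v (fact_name 0 (R + size u + B) (code_blank M)).
  have /sat_init /= : [:: (fact_name 0 (R + size u + B) (code_blank M), true)] \in init_clauses M u B W R.
    apply: mem_consr; apply: mem_catr; apply: mem_catl.
    by apply/mapP; exists (R + size u + B); rewrite // mem_filter leqnn orbT mem_iota /W; lia.
  by rewrite orbF eqb_id.
move=> lm; rewrite -(subnKC lm); elim: (j - m) => {lm j} [|d IH] lB.
  rewrite addn0 in lB *; case: (ltngtP m B) lB => // [lt|-> //] _.
  have /sat_init /= : [:: (fact_name 0 (R + size u + m) (code_bit M true), true);
           (fact_name 0 (R + size u + m) (code_bit M false), true);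
           (fact_name 0 (R + size u + m) (code_blank M), true)] \in init_clauses M u B W R.
    apply: mem_consr; do 3 apply: mem_catr; apply: mem_catl.
    by apply/mapP; exists m; rewrite ?mem_iota.
  rewrite orbF !eqb_id orbA -!/(vbit m _) => /orP[|//]; apply: contraTT => _.
  have := nth_find 0 (_ : has (fun j => ~~ (vbit j true || vbit j false)) (iota 0 B)).
  by rewrite -em nth_iota // add0n; apply; rewrite has_find -em size_iota.
have /sat_init /= : [:: (fact_name 0 (R + size u + (m + d)) (code_blank M), false);
     (fact_name 0 (R + size u + (m + d)).+1 (code_blank M), true)] \in init_clauses M u B W R.
  apply: mem_consr; do 4 apply: mem_catr.
  by apply/mapP; exists (m + d); rewrite ?mem_iota //=; lia.
by rewrite IH ?orbF; [rewrite eqb_id addnS -addnS | lia].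
Qed.

Lemma tracks_init : tracks 0 (tm_init M (u ++ guess)).
Proof.
split.
  have /sat_init /= : [:: (fact_name 0 R (code_state (tm_start M)), true)] \in init_clauses M u B W R.
    exact: mem_head.
  by rewrite orbF eqb_id.
move=> i z; rewrite subn0 => /andP[_ zW]; rewrite /true_at.
have blank : (i != ord0) || ((z < R) || (R + size u + B <= z)) ->
    v (fact_name 0 z (code_cell i None)).
  case/orP => hi.
    have /sat_init /= : [:: (fact_name 0 z (code_cell i None), true)] \in init_clauses M u B W R.
      apply: mem_consr; apply: mem_catl.
      apply/flattenP; eexists; first by apply/mapP; exists z; rewrite ?mem_iota.
      by apply/mapP; exists (code_cell i None) => //; apply: map_f; rewrite mem_filter hi mem_enum.
    by rewrite orbF eqb_id.
  case: (eqVneq i ord0) => [->|ni].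
    have /sat_init /= : [:: (fact_name 0 z (code_blank M), true)] \in init_clauses M u B W R.
      apply: mem_consr; apply: mem_catr; apply: mem_catl.
      by apply/mapP; exists z; rewrite // mem_filter hi mem_iota.
    by rewrite orbF eqb_id.
  have /sat_init /= : [:: (fact_name 0 z (code_cell i None), true)] \in init_clauses M u B W R.
    apply: mem_consr; apply: mem_catl.
    apply/flattenP; eexists; first by apply/mapP; exists z; rewrite ?mem_iota.
    by apply/mapP; exists (code_cell i None) => //; apply: map_f; rewrite mem_filter ni mem_enum.
  by rewrite orbF eqb_id.
rewrite /tm_init ffunE; case: eqP => [ei|/eqP ni] /=; last first.
  rewrite (_ : cell _ _ _ = None); first by apply: blank; rewrite ni.
  by rewrite /cell /= !nth_nil if_same.
rewrite /cell /=; case: ltnP => hz; first by rewrite nth_nil; apply: blank; rewrite hz orbT.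
rewrite {i}ei in blank *.
case: (ltnP (z - R) (size (u ++ guess))) => hu; last first.
  rewrite nth_default ?size_map //; rewrite size_cat in hu.
  case: (leqP (R + size u + B) z) => hB; first by apply: blank; rewrite hB !orbT.
  have ez : z = R + size u + (z - R - size u) by lia.
  by rewrite ez; apply: blank_after; lia.
rewrite (nth_map false) // nth_cat; case: ltnP => hj.
  have /sat_init /= : [:: (fact_name 0 (R + (z - R)) (if nth false u (z - R) then code_bit M true
     else code_bit M false), true)] \in init_clauses M u B W R.
    apply: mem_consr; do 2 apply: mem_catr; apply: mem_catl.
    by apply/mapP; exists (z - R); rewrite ?mem_iota.
  by rewrite orbF eqb_id subnKC //; case: (nth _ _ _).
have := @vbit_guess (z - R - size u); rewrite size_cat in hu.
have ez : R + size u + (z - R - size u) = z by lia.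
rewrite /vbit ez; apply; lia.
Qed.

Lemma accepts_of_satisfies :
  tm_output (iter T (@tm_step M) (tm_init M (u ++ guess))) = [:: true].
Proof.
have tr t : t <= T -> tracks t (iter t (@tm_step M) (tm_init M (u ++ guess))).
  by elim: t => [|t IH] le; [exact: tracks_init | apply: tracks_step => //; apply: IH; lia].
have [_ h] := tr T (leqnn T); set k := iter _ _ _ in h *.
apply/(output_true k R); split=> [|b]; apply/eqP.
  have h1 := h ord0 R ltac:(rewrite /W /R; lia); apply: contraT => ne.
  have /sat_final /= : [:: (fact_name T R (code_cell ord0 (cell R (k.2 ord0) R)), false)] \in final_clauses M T R.
    rewrite mem_cat; apply/orP; left.
    by apply/mapP; exists (code_cell ord0 (cell R (k.2 ord0) R)) => //; apply: map_f; rewrite mem_filter ne mem_enum.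
  by rewrite orbF; move: h1; rewrite /true_at /code_cell => ->.
move=> e; have := h ord0 R.+1 ltac:(rewrite /W /R; lia); rewrite /true_at e => h1.
have /sat_final /= : [:: (fact_name T R.+1 (code_bit M b), false)] \in final_clauses M T R.
  by rewrite mem_cat !inE; case: (b); rewrite eqxx ?orbT.
by rewrite orbF /code_bit /code_cell h1.
Qed.

End FromAssignment.

(** * From an accepting run to a satisfying assignment *)

Section FromRun.
Variable y : seq bool.
Hypothesis sy : size y <= B.
Let k t := iter t (@tm_step M) (tm_init M (u ++ y)).
Hypothesis acc : tm_output (k T) = [:: true].

(** The facts of the run, searched for in a finite range. Cell [W] is included because a left move
    takes cell [W - 1] to that number. *)
Definition run_assignment (s : seq bool) : bool :=
  has (fun t => has (fun z => [exists f : fact M, (s == fact_name t z (fact_code f)) &&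
    holds_at R (k t) z f]) (iota 0 W.+1)) (iota 0 T.+1).
Notation v := run_assignment.

Lemma run_assignmentE t z (f : fact M) : t <= T -> z <= W ->
  v (fact_name t z (fact_code f)) = holds_at R (k t) z f.
Proof.
move=> lt lz; apply/hasP/idP => [[t' _ /hasP[z' _ /existsP[f' /andP[/eqP/fact_name_inj[-> -> e]]]]]|h].
  by rewrite /fact_code in e; rewrite (enum_rank_inj (ord_inj e)).
exists t; rewrite ?mem_iota //; apply/hasP; exists z; rewrite ?mem_iota //.
by apply/existsP; exists f; rewrite eqxx.
Qed.

(** A premise that is false in the run satisfies the clause; otherwise the hypothesis on [X]
    does. *)
Lemma satisfied_template t z q a X : t < T -> z < W ->
  ((k t).1 = q -> reads (k t) = a -> v (inst t z R X).1 == (inst t z R X).2) ->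
  has (fun l : literal => v l.1 == l.2) [seq inst t z R l | l <- rcons (premises q a) X].
Proof.
move=> lt lz hX; rewrite map_rcons -cats1 has_cat.
have RW : R <= W by rewrite /W; lia.
rewrite /= addn0 /cell_of /= run_assignmentE ?(ltnW lt) //=.
case: (eqVneq (k t).1 q) => [e1|_] //=.
rewrite orbF -map_comp has_map.
case: (eqVneq (reads (k t)) a) => [e2|ne].
  by have := hX e1 e2; rewrite /inst /cell_of /= => ->; rewrite orbT.
apply/orP; left.
have [i ni] : exists i, reads (k t) i != a i.
  by apply/existsP; rewrite -negb_forall; apply: contra ne => /forallP h; apply/eqP/ffunP => i; exact/eqP.
apply/hasP; exists i; first by rewrite mem_enum.
rewrite /= addn0 /cell_of /= run_assignmentE ?(ltnW lt) //= cell_head.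
by move: ni; rewrite ffunE => /negbTE ->.
Qed.

Lemma kS t : k t.+1 = tm_step (k t). Proof. by []. Qed.

Lemma cell_init z i : cell R ((k 0).2 i) z =
  if i == ord0 then (if z < R then None else nth None [seq Some (inl b) | b <- u ++ y] (z - R)) else None.
Proof.
rewrite /k /= /tm_init ffunE /cell; case: eqP => _ /=; first by rewrite nth_nil.
by rewrite !nth_nil if_same.
Qed.

Lemma run_satisfies : satisfies v (tableau M u B T).
Proof.
apply/allP => c; rewrite /tableau -/R -/W => /mem_cat_or[hc|/mem_cat_or[hc|hc]].
- have sv z (f : fact M) : z <= W -> v (fact_name 0 z (fact_code f)) = holds_at R (k 0) z f.
    by move=> h; apply: run_assignmentE.
  move: hc; rewrite inE => /orP[/eqP ->|].
    rewrite has_seq1 sv /=; first by rewrite eqxx.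
    by rewrite /W; lia.
  case/mem_cat_or => [|/mem_cat_or[|/mem_cat_or[|/mem_cat_or[|]]]].
  + case/flattenP => s /mapP[z]; rewrite mem_iota => /= zW -> /mapP[d /mapP[i + ->] ->].
    rewrite mem_filter => /andP[ni _]; rewrite has_seq1 sv; last by lia.
    by rewrite /holds_at cell_init (negbTE ni).
  + case/mapP => z; rewrite mem_filter mem_iota => /andP[hz /= zW] ->.
    rewrite has_seq1 sv; last by lia.
    rewrite /holds_at cell_init eqxx; case: ltnP hz => //= h1 h2.
    by rewrite nth_default // size_map size_cat; lia.
  + case/mapP => j; rewrite mem_iota => /= lj ->; rewrite has_seq1.
    have : v (fact_name 0 (R + j) (code_bit M (nth false u j))).
      rewrite sv; last by rewrite /W; lia.
      rewrite /holds_at cell_init eqxx ifF; last by lia.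
      by rewrite addKn (nth_map false) ?size_cat ?nth_cat ?lj //; lia.
    by case: (nth _ _ _) => ->.
  + case/mapP => j; rewrite mem_iota => /= lj ->.
    have zW : R + size u + j <= W by rewrite /W; lia.
    rewrite /= !sv // /holds_at cell_init eqxx ifF; last by lia.
    rewrite (_ : R + size u + j - R = size u + j); last by lia.
    rewrite map_cat nth_cat size_map ifF; last by lia.
    rewrite addKn; case: (ltnP j (size y)) => h; last by rewrite nth_default ?size_map //.
    by rewrite (nth_map false) //; case: (nth _ _ _).
  case/mapP => j; rewrite mem_iota => /= lj ->.
  have zW : (R + size u + j).+1 <= W by rewrite /W; lia.
  rewrite /= !sv //; last by lia.
  rewrite /holds_at !cell_init eqxx ifF; last by lia.
  rewrite ifF; last by lia.
  case: (ltnP (R + size u + j - R) (size (u ++ y))) => h.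
    by rewrite (nth_map false).
  by rewrite !nth_default ?size_map //; lia.
- case/flattenP: hc => s /mapP[t]; rewrite mem_iota => /= lt ->; rewrite mem_cat.
  have RW : R < W by rewrite /W; lia.
  have := step_rule (k t) (isT : 0 < R); case E: (rule _ _) => [q0 act] [h1 h2].
  case/orP => [/mapP[d /head_templateP[q [a [->|[i ->]]]] ->]|].
  + apply: satisfied_template => // eq ea.
    rewrite /inst /= addn1 /cell_of /= run_assignmentE //; last exact: ltnW.
    by rewrite /holds_at kS h1 -eq -ea E eqb_id.
  + apply: satisfied_template => // eq ea; rewrite -eq -ea E /=.
    have [h3 _] := h2 i; move: h3; have : 0 < shift (act i).2 <= 3 by case: (act i).2.
    rewrite /inst /= addn1 /cell_of; case: (shift (act i).2 =P 0) => [-> //|_] sh h3.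
    rewrite run_assignmentE //; last by rewrite /W; lia.
    by rewrite /holds_at kS h3 !eqxx.
  case/flattenP => s' /mapP[z]; rewrite mem_filter mem_iota => /andP[/andP[z0 nz] zW] ->.
  have {}zW : z < W by case/andP: zW.
  case/mapP => d /cell_templateP[q [a [i [b ->]]]] ->.
  rewrite map_cons -cat1s has_cat has_seq1; apply/orP.
  case: (eqVneq (cell R ((k t).2 i) z) b) => [eb|nb]; [right | left]; last first.
    rewrite /inst /= addn0 /cell_of /= addnK run_assignmentE ?(ltnW lt) ?(ltnW zW) //=.
    by rewrite (negbTE nb).
  apply: satisfied_template => // eq ea; rewrite -eq -ea E /=.
  have [_ h4] := h2 i; move: (h4 z z0 nz).
  have : 0 < shift (act i).2 <= 3 by case: (act i).2.
  rewrite /inst /= addn1 /cell_of; case: (shift (act i).2 =P 0) => [-> //|_] sh h5.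
  rewrite run_assignmentE //; last by lia.
  by rewrite /holds_at kS h5 eb !eqxx.
have [h1 h2] := iffLR (output_true (k T) R) acc.
have RW : R < W by rewrite /W; lia.
move: hc; rewrite mem_cat => /orP[/mapP[d /mapP[a + ->] ->]|].
  rewrite mem_filter has_seq1 => /andP[na _]; rewrite run_assignmentE ?(ltnW RW) //=.
  by rewrite h1; apply/eqP/negbTE; rewrite eq_sym.
have hb b : v (fact_name T R.+1 (code_bit M b)) = false.
  by rewrite run_assignmentE //=; apply/negbTE.
by rewrite !inE => /orP[] /eqP->; rewrite has_seq1 hb.
Qed.

End FromRun.

Theorem tableau_correct :
  (exists v, satisfies v (tableau M u B T)) <->
  exists y, size y <= B /\ tm_output (iter T (@tm_step M) (tm_init M (u ++ y))) = [:: true].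
Proof.
split=> [[v sat]|[y [sy acc]]].
  by exists (guess v); split; [exact: size_guess | exact: accepts_of_satisfies].
by exists (run_assignment y); apply: run_satisfies.
Qed.

End TableauCorrect.

Lemma PT_horner (p : {poly nat}) : PT (fun n : nat => (p.[n]%R : nat)).
Proof.
elim/poly_ind: p => [|p c IH].
  by apply: (@PT_ext _ _ (fun=> 0)); [move=> n; rewrite horner0 | pt].
apply: (@PT_ext _ _ (fun n : nat => (p.[n]%R : nat) * n + c)); last by pt.
by move=> n; rewrite !hornerE.
Qed.

Lemma PT_fact_name : PT (fun p : nat * nat * nat => fact_name p.1.1 p.1.2 p.2).
Proof. by rewrite /fact_name; pt. Qed.
#[global] Hint Resolve PT_fact_name : pt.

(** * Computing the tableau in polynomial time *)

Section PTTableau.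
Variable M : machine.

Lemma PT_step_clauses : PT (fun p : nat * nat * nat => step_clauses M p.1.1 p.1.2 p.2).
Proof. by rewrite /step_clauses /inst /cell_of; pt. Qed.

Lemma PT_init_clauses :
  PT (fun p : seq bool * nat * nat * nat => init_clauses M p.1.1.1 p.1.1.2 p.1.2 p.2).
Proof. by rewrite /init_clauses; pt. Qed.

Lemma PT_final_clauses : PT (fun p : nat * nat => final_clauses M p.1 p.2).
Proof. by rewrite /final_clauses; pt. Qed.

Lemma PT_tableau (E : encType) (u : E -> seq bool) (B T : E -> nat) :
  PT u -> PT B -> PT T -> PT (fun e => tableau M (u e) (B e) (T e)).
Proof.
move=> hu hB hT; rewrite /tableau.
have h1 := PT_step_clauses; have h2 := PT_final_clauses; have h3 := PT_init_clauses.
have h4 : PT (fun e => init_clauses M (u e) (B e) ((T e).+1 + size (u e) + B e + T e + 3) (T e).+1).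
  apply: (PT_comp (f := fun e => (u e, B e, (T e).+1 + size (u e) + B e + T e + 3, (T e).+1)) h3).
  by pt.
by pt.
Qed.

End PTTableau.

Lemma iter_halted M (k : tm_config M) n : k.1 = tm_halt M -> iter n (@tm_step M) k = k.
Proof. by move=> h; elim: n => //= n ->; rewrite /tm_step h eqxx. Qed.

Theorem mahjong_NP_hard : NP_hard mahjong_solitaire.
Proof.
move=> L [p [V [[M [r hM]] hL]]].
pose B (x : seq bool) : nat := p.[size x]%R.
(* A single horizon for all certificates: the time bound at the greatest length of a pair, which
   suffices as polynomials over [nat] are monotone and a halted machine stands still. *)
pose T (x : seq bool) : nat := r.[size (delimit x) + B x]%R.
exists (fun x => cnf_word (tableau M (delimit x) (B x) (T x))); split.
  apply: poly_time_of_PT; apply: (PT_comp PT_cnf_word); apply: PT_tableau.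
  - by pt.
  - by have h := PT_horner p; rewrite /B; pt.
  - have h := PT_horner r; have h' := PT_horner p; rewrite /T /B.
    by apply: (PT_comp (f := fun x : seq bool => size (delimit x) + p.[size x]%R) h); pt.
move=> x; rewrite hL -cnf_word_correct tableau_correct.
have acc y : size y <= B x ->
    tm_output (iter (T x) (@tm_step M) (tm_init M (delimit x ++ y))) = V (pair_code x y).
  move=> le; have [h <-] := hM (pair_code x y); rewrite -/(pair_code x y) -/(tm_run _ _ _).
  have lt : r.[size (pair_code x y)]%R <= T x by apply: horner_nat_mono; rewrite size_cat leq_add2l.
  by congr tm_output; rewrite -(subnK lt) /tm_run iterD iter_halted.
by split=> -[y [h1 h2]]; exists y; [rewrite acc | rewrite -acc].
Qed.

(** * Checking a play *)

(* The state is a pending marker, the chunk being read and the finished chunks. *)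
Definition chunk_step (st : bool * seq bool * seq (seq bool)) (b : bool) :=
  if st.1.1 then (false, st.1.2 ++ [:: b], st.2)
  else if b then (true, st.1.2, st.2)
  else (false, [::], st.2 ++ [:: st.1.2]).

Definition chunks (w : seq bool) : seq (seq bool) :=
  (foldl chunk_step (false, [::], [::]) w).2.

Lemma chunk_delimit c o w : foldl chunk_step (false, c, o) (delimit w) = (false, [::], o ++ [:: c ++ w]).
Proof.
rewrite /delimit foldl_cat; elim: w c => [|b w IH] c; first by rewrite /= cats0.
by have := IH (c ++ [:: b]); rewrite -catA.
Qed.

Lemma chunksK ws : chunks (flatten (map delimit ws)) = ws.
Proof.
suff h o : foldl chunk_step (false, [::], o) (flatten (map delimit ws)) = (false, [::], o ++ ws).
  by rewrite /chunks h.
by elim: ws o => [|w ws IH] o /=; rewrite ?cats0 // foldl_cat chunk_delimit IH -catA.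
Qed.

(** For soundness the certificate is arbitrary, so the instance must be recovered whatever follows
    it. *)
Lemma head_chunks x y : nth [::] (chunks (delimit x ++ y)) 0 = x.
Proof.
rewrite /chunks foldl_cat chunk_delimit /=; suff: forall st,
  exists s, (foldl chunk_step st y).2 = st.2 ++ s by move=> /(_ (false, [::], [:: x]))[s ->].
elim: y => [|b y IH] st /=; first by exists [::]; rewrite cats0.
have [s ->] := IH (chunk_step st b); rewrite /chunk_step.
by case: st.1.1 b => [] [] /=; eexists; rewrite -?catA; reflexivity.
Qed.

Lemma sz_rcons (A : encType) (s : seq A) a : sz (s ++ [:: a]) = (sz s + sz a).+1.
Proof.
elim: s => [|b s IH] /=; rewrite !sz_cons ?IH; last by lia.
by rewrite (_ : sz [::] = 1) //; lia.
Qed.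

Lemma PT_chunks : PT chunks.
Proof.
have h : PT (fun w : seq bool => foldl chunk_step (false, [::], [::]) w).
  apply: (PT_foldl_add (s := id) (z := fun=> (false, [::], [::])) (f := fun=> chunk_step)); try by pt.
  exists (fun=> 20) => [|e [[o c] out] b]; first by polyfun_tac.
  have h0 : 0 < sz o := sz_gt0 _; have h1 : 0 < sz c := sz_gt0 _; have h2 := sz_bool b.
  have h3 := sz_bool false; have h4 := sz_bool true.
  rewrite /chunk_step /=; case: ifP => _; last case: ifP => _; rewrite !sz_pair /= ?sz_rcons.
  - by lia.
  - by lia.
  by rewrite (_ : sz [::] = 1) //; lia.
by rewrite /chunks; pt.
Qed.
#[global] Hint Resolve PT_chunks : pt.

(** Comparison from the least significant bit: a later difference overrides the verdict so far. Bits
    of the second word beyond the end of the first decide in its favour if one of them is set. *)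
Definition lt_step (st : bool * seq bool) (a : bool) :=
  (if a == head false st.2 then st.1 else head false st.2, behead st.2).

Definition ltw (s t : seq bool) : bool :=
  let st := foldl lt_step (false, t) s in st.1 || has id st.2.

Lemma ltwP s t : ltw s t = (val_bits s < val_bits t).
Proof.
(* Generalized over the flag, which counts as an extra unit on the right-hand side of the
   comparison. *)
rewrite /ltw -[val_bits t]addn0 -[0 in X in _ = X]/(nat_of_bool false).
elim: s t false => [|a s IH] t o /=.
  case: o => /=; first by lia.
  by rewrite addn0; elim: t => //= b t ->; case: b => //=; lia.
rewrite {1}/lt_step /= IH; case: t => [|b t] /=.
  by case: a o => [] [] /=; lia.
by case: a b o => [] [] [] /=; lia.
Qed.

Lemma PT_ltw : PT (fun p : seq bool * seq bool => ltw p.1 p.2).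
Proof.
have h : PT (fun p : seq bool * seq bool => foldl lt_step (false, p.2) p.1).
  apply: (PT_foldl_add (f := fun=> lt_step)); try by rewrite /lt_step; pt.
  exists (fun=> 3) => [|e [o r] a]; first by polyfun_tac.
  rewrite /lt_step !sz_pair /=; have := sz_bool (if a == head false r then o else head false r).
  have h0 : 0 < sz o := sz_gt0 _.
  by case: r => [|b r] /=; rewrite ?sz_cons; lia.
by rewrite /ltw; pt.
Qed.
#[global] Hint Resolve PT_ltw : pt.

(* Entries are handled as their code words, with fields [i], [j], [k], [p], [q]. *)
Definition field (e : seq bool) (n : nat) : seq bool := nth [::] (chunks e) n.

Definition same_row (e e' : seq bool) : bool := (field e 0 == field e' 0) && (field e 2 == field e' 2).

(** Neighbours are recognized with [inc] only. At [j = 0] the test for a left neighbour fails by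
    itself, since [inc] never yields the numeral of zero. *)
Definition unblocked (B : seq (seq bool)) (a : seq bool) : bool :=
  ~~ has (fun e => [&& field e 0 == field a 0, field e 1 == field a 1 & field e 2 == inc (field a 2)]) B &&
  (~~ has (fun e => same_row e a && (inc (field e 1) == field a 1)) B ||
   ~~ has (fun e => same_row e a && (field e 1 == inc (field a 1))) B).

Definition move_step (st : bool * seq (seq bool)) (m : seq bool) : bool * seq (seq bool) :=
  let a := nth [::] (chunks m) 0 in let b := nth [::] (chunks m) 1 in
  (st.1 && [&& a \in st.2, b \in st.2, a != b, field a 3 == field b 3, unblocked st.2 a & unblocked st.2 b],
   [seq e <- st.2 | (e != a) && (e != b)]).

Definition check_moves (B ms : seq (seq bool)) : bool :=
  let st := foldl move_step (true, B) ms in st.1 && nilp st.2.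

Definition is_canonical (w : seq bool) : bool := nilp w || nth false w (size w).-1.

(** Splitting into chunks ignores an incomplete tail. Encoding the chunks again and comparing rules
    this out. *)
Definition check_entry (m e : seq bool) : bool :=
  [&& size (chunks e) == 5, all is_canonical (chunks e), flatten (map delimit (chunks e)) == e
    & ltw (field e 3) m].

(** Contiguity of a row is tested by successors: an entry with another one further right in its row
    needs an immediate right neighbour. Coordinates are binary and may be huge, so the intermediate
    values could not be enumerated. *)
Definition check_layout (B : seq (seq bool)) : bool :=
  [&& uniq [seq delimit (field e 0) ++ delimit (field e 1) ++ delimit (field e 2) | e <- B],
      uniq [seq delimit (field e 3) ++ delimit (field e 4) | e <- B],
      all (fun e => all (fun e' => ~~ (same_row e e' && ltw (field e 1) (field e' 1)) ||
        has (fun e'' => same_row e'' e && (field e'' 1 == inc (field e 1))) B) B) B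
    & all (fun e => nilp (field e 2) ||
        has (fun e' => [&& field e' 0 == field e 0, field e' 1 == field e 1
          & inc (field e' 2) == field e 2]) B) B].

Definition check (x m : seq bool) (B ms : seq (seq bool)) : bool :=
  [&& x == delimit m ++ flatten B, is_canonical m, all (check_entry m) B, check_layout B
    & check_moves B ms].

(** The instance is chunk 0 of the pair. The certificate supplies the number of tile sets, the
    entries and the moves, with lists delimited a second time. *)
Definition verifier (w : seq bool) : seq bool :=
  let c := chunks w in
  [:: check (nth [::] c 0) (nth [::] c 1) (chunks (nth [::] c 2)) (chunks (nth [::] c 3))].

Lemma PT_field : PT (fun p : seq bool * nat => field p.1 p.2).
Proof. by rewrite /field; pt. Qed.
#[global] Hint Resolve PT_field : pt.

Lemma PT_same_row : PT (fun p : seq bool * seq bool => same_row p.1 p.2).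
Proof. by rewrite /same_row; pt. Qed.
#[global] Hint Resolve PT_same_row : pt.

Lemma PT_unblocked : PT (fun p : seq (seq bool) * seq bool => unblocked p.1 p.2).
Proof. by rewrite /unblocked; pt. Qed.
#[global] Hint Resolve PT_unblocked : pt.

Lemma PT_move_step : PT (fun p : (bool * seq (seq bool)) * seq bool => move_step p.1 p.2).
Proof. by rewrite /move_step; pt. Qed.
#[global] Hint Resolve PT_move_step : pt.

Lemma sz_filter (A : encType) (p : pred A) (s : seq A) : sz (filter p s) <= sz s.
Proof. by elim: s => //= a s IH; case: ifP; rewrite !sz_cons; lia. Qed.

Lemma PT_check_moves : PT (fun p : seq (seq bool) * seq (seq bool) => check_moves p.1 p.2).
Proof.
have h : PT (fun p : seq (seq bool) * seq (seq bool) => foldl move_step (true, p.1) p.2).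
  apply: (PT_foldl_add (f := fun=> move_step)); try by pt.
  exists (fun=> 3) => [|e [o B] m]; first by polyfun_tac.
  rewrite /move_step sz_pair [(_, _).2]/= [(_, _).1]/= sz_pair /=; set b := o && _.
  have h1 := sz_bool b; have h0 : 0 < sz o := sz_gt0 _.
  apply: (@leq_trans (3 + sz B).+1); last by lia.
  by rewrite ltnS; apply: leq_add => //; exact: sz_filter.
by rewrite /check_moves; pt.
Qed.
#[global] Hint Resolve PT_check_moves : pt.

Lemma PT_is_canonical : PT is_canonical.
Proof. by rewrite /is_canonical; pt. Qed.
#[global] Hint Resolve PT_is_canonical : pt.

Lemma PT_check_entry : PT (fun p : seq bool * seq bool => check_entry p.1 p.2).
Proof. by rewrite /check_entry; pt. Qed.
#[global] Hint Resolve PT_check_entry : pt.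

Lemma PT_check_layout : PT check_layout.
Proof. by rewrite /check_layout; pt. Qed.
#[global] Hint Resolve PT_check_layout : pt.

Lemma PT_verifier : PT verifier.
Proof. by rewrite /verifier /check; pt. Qed.

(** * Correctness of the verifier *)

Notation entry := (position * tile)%type.

Definition entry_fields (e : entry) : seq nat :=
  [:: e.1.1.1; e.1.1.2; e.1.2; e.2.1; e.2.2].

Lemma entry_codeE e : entry_code e = flatten (map delimit (map nat_bits (entry_fields e))).
Proof. by case: e => [[[i j] k] [p q]]; rewrite /= cats0. Qed.

Lemma chunks_entry e : chunks (entry_code e) = map nat_bits (entry_fields e).
Proof. by rewrite entry_codeE chunksK. Qed.

Lemma entry_code_inj : injective entry_code.
Proof.
move=> e e' /(congr1 chunks); rewrite !chunks_entry => /(inj_map nat_bits_inj).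
by case: e e' => [[[i j] k] [p q]] [[[i' j'] k'] [p' q']] [-> -> -> -> ->].
Qed.

Lemma field_entry e n : n < 5 -> field (entry_code e) n = nat_bits (nth 0 (entry_fields e) n).
Proof. by move=> lt; rewrite /field chunks_entry (nth_map 0). Qed.

Lemma eq_nat_bits m n : (nat_bits m == nat_bits n) = (m == n).
Proof. exact: inj_eq nat_bits_inj _ _. Qed.

Lemma same_row_entry e e' : same_row (entry_code e) (entry_code e') =
  (e.1.1.1 == e'.1.1.1) && (e.1.2 == e'.1.2).
Proof. by rewrite /same_row !field_entry // !eq_nat_bits. Qed.

Lemma mem_positions_has (B : board) x : (x \in positions B) = has (fun e => e.1 == x) B.
Proof. by rewrite -has_pred1 /positions /unzip1 has_map. Qed.

Lemma position_eq (x : position) i j k :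
  (x == (i, j, k)) = [&& x.1.1 == i, x.1.2 == j & x.2 == k].
Proof. by case: x => [[a b] c]; rewrite !xpair_eqE andbA. Qed.

Lemma unblocked_available (B : board) e : e \in B ->
  unblocked (map entry_code B) (entry_code e) = available (positions B) e.1.
Proof.
move=> he; have hp : e.1 \in positions B by apply: map_f.
case E: e.1 hp => [[i j] k] hp; rewrite /available hp /hidden /unblocked !mem_positions_has !has_map.
have [ei ej ek] : [/\ e.1.1.1 = i, e.1.1.2 = j & e.1.2 = k] by rewrite E.
congr (~~ _ && (_ || ~~ _)); last 1 first.
- apply: eq_has => f /=; rewrite same_row_entry !field_entry // -nat_bits_succ eq_nat_bits position_eq.
  by rewrite /= ei ej ek -andbA [(_ == k) && _]andbC.
- by apply: eq_has => f /=; rewrite !field_entry // -nat_bits_succ !eq_nat_bits position_eq /= ei ej ek.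
(* The guard is moved into the search, where a predecessor condition for [0 < j] can be compared
   with a successor condition. *)
congr (~~ _); rewrite (_ : (0 < j) && _ = has (fun f : entry => [&& 0 < j, f.1.1.1 == i, f.1.1.2 == j.-1 & f.1.2 == k]) B).
  apply: eq_has => f /=; rewrite same_row_entry !field_entry // -nat_bits_succ eq_nat_bits /= ei ej ek.
  by case: j {hp E ej} => [|j] /=; rewrite ?andbF // eqSS -andbA [(_ == k) && _]andbC.
case: (0 < j) => /=; last by rewrite has_pred0.
by apply: eq_has => f; rewrite position_eq.
Qed.

Lemma filter_entries (B : board) a b :
  [seq e <- map entry_code B | (e != entry_code a) && (e != entry_code b)] =
  map entry_code [seq e <- B | (e != a) && (e != b)].
Proof.
by rewrite filter_map; congr map; apply: eq_filter => e /=; rewrite !(inj_eq entry_code_inj).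
Qed.

Lemma move_step_false B ms : (foldl move_step (false, B) ms).1 = false.
Proof. by elim: ms B => //= m ms IH B; rewrite {2}/move_step /= IH. Qed.

Lemma check_moves_sound ms (B : board) : check_moves (map entry_code B) ms -> plays B [::].
Proof.
rewrite /check_moves; elim: ms B => [|m ms IH] B.
  by case: B => // _; apply: Relation_Operators.rt1n_refl.
rewrite [foldl _ _ _]/=; case E: (move_step _ m) => [o B1].
case: o E => E; last by rewrite move_step_false.
case: E => /and5P[/mapP[a ha ->] /mapP[b hb ->] nab mat /andP[fa fb]] <-.
rewrite filter_entries => /IH; apply: Relation_Operators.rt1n_trans.
exists a, b; split; split=> //.
- by move: nab; rewrite (inj_eq entry_code_inj).
- by move: mat; rewrite !field_entry // eq_nat_bits.
- by rewrite -unblocked_available.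
by rewrite -unblocked_available.
Qed.

Definition move_word (m : entry * entry) : seq bool :=
  flatten (map delimit [:: entry_code m.1; entry_code m.2]).

(** The number of moves and the origin of the entries they name are recorded because they bound the
    length of the certificate. *)
Lemma check_moves_complete (B : board) : plays B [::] -> exists ms : seq (entry * entry),
  [/\ size ms <= size B, {subset map fst ms <= B}, {subset map snd ms <= B}
    & check_moves (map entry_code B) (map move_word ms)].
Proof.
move eN: [::] => N h; elim: h eN => [_ <-|{}B B' B'' [a [b [[ha hb nab] [mat fa fb ->]]]] _ IH eN].
  by exists [::].
have [ms [h1 h2 h3 h4]] := IH eN; exists ((a, b) :: ms); split=> /=.
- apply: leq_ltn_trans h1 _.
  rewrite size_filter -(count_predC (fun e => (e != a) && (e != b)) B) -[ltnLHS]addn0 ltn_add2l.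
  by rewrite -has_count; apply/hasP; exists a => //=; rewrite eqxx.
- by move=> x; rewrite inE => /orP[/eqP->//|/h2]; rewrite mem_filter => /andP[].
- by move=> x; rewrite inE => /orP[/eqP->//|/h3]; rewrite mem_filter => /andP[].
have E : move_step (true, map entry_code B) (move_word (a, b)) =
    (true, map entry_code [seq e <- B | (e != a) && (e != b)]).
  rewrite /move_step chunksK /= filter_entries !map_f // (inj_eq entry_code_inj) nab.
  by rewrite !unblocked_available // fa fb !field_entry // eq_nat_bits -/(matching a.2 b.2) mat.
by move: h4; rewrite /check_moves /= E.
Qed.

Lemma is_canonicalE w : is_canonical w = canonical w.
Proof. by rewrite /is_canonical nth_last. Qed.

Lemma check_entryP m e : reflect (exists2 E : entry, e = entry_code E & E.2.1 < val_bits m) (check_entry m e).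
Proof.
apply: (iffP and4P) => [[/eqP hs hc /eqP he lt]|[E -> lt]].
  pose f n := val_bits (field e n).
  exists ((f 0, f 1, f 2), (f 3, f 4)); last by rewrite -ltwP.
  rewrite entry_codeE -[LHS]he; congr (flatten (map _ _)); rewrite /entry_fields /= /f /field.
  case: (chunks e) hs hc => [|a [|b [|c [|d [|g [|? ?]]]]]] //= _.
  by rewrite !is_canonicalE => /and5P[h1 h2 h3 h4 /andP[h5 _]]; rewrite !val_bitsK.
rewrite chunks_entry -entry_codeE eqxx field_entry // ltwP nat_bitsK; split=> //.
by apply/allP => _ /mapP[n _ ->]; rewrite is_canonicalE canonical_nat_bits.
Qed.

Lemma uniq_words (T : eqType) (f : T -> seq bool) (g : entry -> T) (h : entry -> seq bool) (B : board) :
  injective f -> (forall e, h e = f (g e)) -> uniq (map h B) = uniq (map g B).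
Proof. by move=> inj e; rewrite (eq_map e) (map_comp f g) map_inj_uniq. Qed.

Lemma entry_position (e : entry) : e.1 = (e.1.1.1, e.1.1.2, e.1.2).
Proof. by case: e => [[[]]]. Qed.

Lemma check_layoutP (B : board) :
  reflect (configuration (positions B) /\ uniq (tiles B)) (check_layout (map entry_code B)).
Proof.
have u1 : uniq [seq delimit (field e 0) ++ delimit (field e 1) ++ delimit (field e 2) | e <- map entry_code B]
    = uniq (positions B).
  rewrite -map_comp; apply: (uniq_words (f := fun x : position => nat_code x.1.1 ++ nat_code x.1.2 ++ nat_code x.2)).
    move=> [[i j] k] [[i' j'] k'] /= /nat_code_inj[-> /nat_code_inj[->]].
    by rewrite -[nat_code k]cats0 -[nat_code k']cats0 => /nat_code_inj[->].
  by move=> e; rewrite /= !field_entry.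
have u2 : uniq [seq delimit (field e 3) ++ delimit (field e 4) | e <- map entry_code B] = uniq (tiles B).
  rewrite -map_comp; apply: (uniq_words (f := fun x : tile => nat_code x.1 ++ nat_code x.2)).
    move=> [p q] [p' q'] /= /nat_code_inj[->].
    by rewrite -[nat_code q]cats0 -[nat_code q']cats0 => /nat_code_inj[->].
  by move=> e; rewrite /= !field_entry.
rewrite /check_layout u1 u2; apply: (iffP and4P) => [[h1 h2 h3 h4]|[[h1 h3 h4] h2]].
  split=> //; split=> // [i j j' j'' k|i j k].
    move=> hj hj' lt /andP[le1 le2]; rewrite -(subnKC le1).
    elim: (j'' - j) (leq_sub2r j le2) => {le1 le2 j''} [|d IH] le; first by rewrite addn0.
    have /mapP[e he ee] := IH (ltnW le); have /mapP[e' he' ee'] := hj'.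
    have /allP/(_ _ (map_f _ he))/allP/(_ _ (map_f _ he')) := h3.
    rewrite same_row_entry !field_entry // ltwP !nat_bitsK /= -ee -ee' /= !eqxx /=.
    rewrite (_ : j + d < j'); last by lia.
    rewrite /= has_map => /hasP[f hf] /=; rewrite same_row_entry !field_entry // -nat_bits_succ eq_nat_bits /=.
    rewrite -ee /= => /andP[/andP[/eqP e1 /eqP e2] /eqP e3]; apply/mapP; exists f => //.
    by rewrite addnS -e3 -e1 -e2 -entry_position.
  move=> /mapP[e he ee] k0; have /allP/(_ _ (map_f _ he)) := h4.
  rewrite field_entry //= -ee /= => /orP[/nilP hk|].
    by move: k0; rewrite -(nat_bitsK k) hk.
  rewrite has_map => /hasP[f hf] /=; rewrite !field_entry // -nat_bits_succ !eq_nat_bits /= -ee /=.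
  move=> /and3P[/eqP e1 /eqP e2 /eqP e3]; apply/mapP; exists f => //.
  by rewrite -e3 -e1 -e2 -entry_position.
split=> //.
  rewrite all_map; apply/allP => e he; rewrite /= all_map; apply/allP => e' he' /=.
  rewrite same_row_entry !field_entry // ltwP !nat_bitsK /=; case: andP => //= -[/andP[/eqP e1 /eqP e2] lt].
  have m : (e.1.1.1, e.1.1.2, e.1.2) \in positions B by rewrite -entry_position; exact: map_f.
  have m' : (e.1.1.1, e'.1.1.2, e.1.2) \in positions B.
    by rewrite e1 e2 -entry_position; exact: map_f.
  have /mapP[f hf ef] := h3 _ _ _ e.1.1.2.+1 _ m m' lt ltac:(rewrite leqnSn lt; done).
  rewrite has_map; apply/hasP; exists f => //=.
  by rewrite same_row_entry !field_entry // -nat_bits_succ eq_nat_bits /= -ef !eqxx.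
rewrite all_map; apply/allP => e he; rewrite /= field_entry //=.
case ek: e.1.2 => [|k] //; apply/orP; right.
have m : (e.1.1.1, e.1.1.2, e.1.2) \in positions B by rewrite -entry_position; exact: map_f.
have /mapP[f hf ef] := h4 _ _ _ m ltac:(rewrite ek; done).
rewrite has_map; apply/hasP; exists f => //=.
by rewrite !field_entry // -nat_bits_succ !eq_nat_bits /= -ef /= ek /= !eqxx.
Qed.

Lemma entries_of_words m (W : seq (seq bool)) : all (check_entry m) W -> exists2 B : board,
  W = map entry_code B & forall e, e \in B -> e.2.1 < val_bits m.
Proof.
elim: W => [_|w W IH /= /andP[/check_entryP[e -> lt] /IH[B -> hB]]]; first by exists [::] => // e.
by exists (e :: B) => // f; rewrite inE => /orP[/eqP->|/hB].
Qed.

Lemma check_sound x m W ms : check x m W ms -> mahjong_solitaire x.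
Proof.
case/and5P => /eqP-> hm /entries_of_words[B -> lt] /check_layoutP[hC hT] /check_moves_sound hp.
exists (Arrangement (val_bits m) B); split=> //.
- split=> //= [t /mapP[e he ->]|p _]; first exact: lt.
  by apply: plays_even => //; case: hC => uC _ _; apply: map_uniq uC.
by rewrite /arrangement_code /nat_code val_bitsK // -is_canonicalE.
Qed.

Lemma check_complete (A : arrangement) : is_arrangement A -> winnable A -> exists ms : seq (entry * entry),
  [/\ size ms <= size (layout A), {subset map fst ms <= layout A}, {subset map snd ms <= layout A}
   & check (arrangement_code A) (nat_bits (num_sets A)) (map entry_code (layout A)) (map move_word ms)].
Proof.
case: A => n B [hC hT lt _] /check_moves_complete[ms [h1 h2 h3 h4]]; exists ms; split=> //.
rewrite /check eqxx is_canonicalE canonical_nat_bits h4 andbT /=; apply/andP; split.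
  rewrite all_map; apply/allP => e he; apply/check_entryP; exists e => //.
  by rewrite nat_bitsK; apply: lt; apply: map_f.
by apply/check_layoutP.
Qed.

Lemma size_delimitE w : size (delimit w) = 2 * size w + 1.
Proof. by rewrite /delimit size_cat; congr (_ + _); elim: w => //= b w ->; lia. Qed.

Lemma size_flatten_delimit n (ws : seq (seq bool)) : all (fun w => size w <= n) ws ->
  size (flatten (map delimit ws)) <= size ws * (2 * n + 1).
Proof.
elim: ws => //= w ws IH /andP[h /IH le]; rewrite size_cat size_delimitE mulSn.
by apply: leq_add => //; lia.
Qed.

Theorem mahjong_in_NP : in_NP mahjong_solitaire.
Proof.
(* Delimiting turns length [l] into [2 * l + 1]. With [n] the length of the instance, the summands
   are for the number of tile sets, for at most [n] entries of length at most [n], and for at most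
   [n] moves that consist of two delimited entries each. *)
have [p hp] : polyfun (fun n => (2 * n + 1) + ((2 * (n * (2 * n + 1)) + 1) +
    (2 * (n * (2 * (2 * (2 * n + 1)) + 1)) + 1))) by polyfun_tac.
exists p, verifier; split; first exact: poly_time_of_PT PT_verifier.
move=> x; split=> [[A [hA -> hw]]|[y [_]]]; last first.
  by rewrite /verifier /pair_code head_chunks => -[/check_sound].
have [ms [h1 h2 h3 h4]] := check_complete hA hw.
pose y := flatten (map delimit [:: nat_bits (num_sets A);
  flatten (map delimit (map entry_code (layout A)));
  flatten (map delimit (map move_word ms))]).
exists y; split; last first.
  rewrite /verifier (_ : pair_code _ _ = flatten (map delimit [:: arrangement_code A;
    nat_bits (num_sets A); flatten (map delimit (map entry_code (layout A)));
    flatten (map delimit (map move_word ms))])) //.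
  by rewrite chunksK /= !chunksK h4.
rewrite -hp; set n := size (arrangement_code A).
have en : n = size (nat_code (num_sets A)) + size (flatten (map entry_code (layout A))).
  by rewrite -size_cat.
have hn : size (nat_bits (num_sets A)) <= n.
  by rewrite en [size (nat_code _)]size_delimitE; lia.
have hf : size (flatten (map entry_code (layout A))) <= n by rewrite en leq_addl.
have he e : e \in layout A -> size (entry_code e) <= n.
  by move=> h; apply: leq_trans hf; apply: size_flatten_mem; apply: map_f.
have hl : size (layout A) <= n.
  apply: leq_trans hf; elim: (layout A) => //= e B IH; rewrite size_cat.
  have : 0 < size (entry_code e); last by lia.
  by rewrite entry_codeE -[flatten _]/(delimit _ ++ _) size_cat size_delimitE addn1.
have hL : size (flatten (map delimit (map entry_code (layout A)))) <= n * (2 * n + 1).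
  apply: leq_trans (size_flatten_delimit (n := n) _) _.
    by rewrite all_map; apply/allP => e /he.
  by rewrite size_map leq_mul2r hl orbT.
have hM : size (flatten (map delimit (map move_word ms))) <= n * (2 * (2 * (2 * n + 1)) + 1).
  apply: leq_trans (size_flatten_delimit (n := 2 * (2 * n + 1)) _) _.
    rewrite all_map; apply/allP => m hm /=; apply: leq_trans (size_flatten_delimit (n := n) _) _ => //=.
    by rewrite (he _ (h2 _ (map_f _ hm))) (he _ (h3 _ (map_f _ hm))).
  by rewrite size_map leq_mul2r (leq_trans h1 hl) orbT.
rewrite /y [map delimit _]/= [flatten _]/= cats0 2!size_cat !size_delimitE.
by rewrite !leq_add // leq_mul2l.
Qed.

Theorem theorem2 : NP_complete mahjong_solitaire.
Proof. exact: (conj mahjong_in_NP mahjong_NP_hard). Qed.
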